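(* Let $p$ and the group sizes $d_1,\dots,d_p$ be fixed (not depending on $n$). Suppose that the following hold. (A1) The errors $\varepsilon_1,\dots,\varepsilon_n$ are independent and identically distributed, have $0$ as their $\tau$-th expectile (i.e. $\mathbb{E}[g_\tau(\varepsilon_i)]=0$), have a positive density which is continuous near $0$, and $\mathbb{E}(\varepsilon_i^4)<\infty$. (A2) There is a constant $C_0>0$ with $\max_{1\le i\le n}\|\mathbb{X}_i\|_\infty\le C_0$. (A3) There are constants $0<m_0\le M_0<\infty$ such that $m_0\le\delta_{\min}(\Upsilon_n)\le\delta_{\max}(\Upsilon_n)\le M_0$, where $\Upsilon_n=n^{-1}\sum_{i=1}^n\mathbb{X}_i\mathbb{X}_i^\top$; moreover $\Upsilon_n\to\Upsilon$ as $n\to\infty$ for some positive definite $r\times r$ matrix $\Upsilon$. Suppose also that $\lambda_n\to0$, $n^{1/2}\lambda_n\to 0$ and $n^{(\gamma+1)/2}\lambda_n\to\infty$ as $n\to\infty$. Then $$n^{1/2}(\widehat{\beta}_n-\beta^0)_{\mathcal{A}}\ \xrightarrow[n\to\infty]{\mathcal{L}}\ \mathcal{N}\big(\mathbf{0}_{r^0},\ \sigma^2_{g_\tau}\,\mu_{h_\tau}^{-2}\,\Upsilon_{\mathcal{A}}^{-1}\big),$$ where $\Upsilon_{\mathcal{A}}$ is the sub-matrix of $\Upsilon$ with row and column indices in $\{1,\dots,r^0\}$, $r^0=\sum_{j=1}^{p^0}d_j$ (the coordinates of the first $p^0$ groups).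
   Context: Model: for $i=1,\dots,n$, $Y_i=\sum_{j=1}^p\mathbf{X}_{ij}^\top\beta_j^0+\varepsilon_i=\mathbb{X}_i^\top\beta^0+\varepsilon_i$, where for each group $j\in\{1,\dots,p\}$ the deterministic design vector $\mathbf{X}_{ij}$ and the true (unknown) parameter $\beta_j^0$ lie in $\mathbb{R}^{d_j}$, $\mathbb{X}_i=(\mathbf{X}_{i1},\dots,\mathbf{X}_{ip})\in\mathbb{R}^r$, $\beta^0=(\beta_1^0,\dots,\beta_p^0)\in\mathbb{R}^r$, $r=\sum_{j=1}^p d_j$, and $\varepsilon_i$ is a random error. Any $\beta\in\mathbb{R}^r$ is written $\beta=(\beta_1,\dots,\beta_p)$ with $\beta_j\in\mathbb{R}^{d_j}$. It is assumed that $\|\beta_j^0\|_2\ne0$ for $j\le p^0$ and $\|\beta_j^0\|_2=0$ for $j>p^0$, where $p^0\le p$ is unknown. $\mathcal{A}=\{j:\|\beta_j^0\|_2\ne0\}=\{1,\dots,p^0\}$, and for $v\in\mathbb{R}^r$, $v_{\mathcal{A}}\in\mathbb{R}^{r^0}$ is the sub-vector made of the groups $v_j$, $j\in\mathcal{A}$. For a fixed $\tau\in(0,1)$: $\rho_\tau(u)=u^2\,|\tau-\mathbb{1}_{u<0}|$, $g_\tau(\varepsilon)=-2\varepsilon(\tau\mathbb{1}_{\varepsilon\ge0}+(1-\tau)\mathbb{1}_{\varepsilon<0})$, $h_\tau(\varepsilon)=2(\tau\mathbb{1}_{\varepsilon\ge0}+(1-\tau)\mathbb{1}_{\varepsilon<0})$,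 $\sigma^2_{g_\tau}=\mathrm{Var}[g_\tau(\varepsilon)]$, $\mu_{h_\tau}=\mathbb{E}[h_\tau(\varepsilon)]$, where $\varepsilon$ has the common distribution of the errors. Expectile estimator: $\widetilde{\beta}_n=(\widetilde{\beta}_{n;1},\dots,\widetilde{\beta}_{n;p})=\arg\min_{\beta\in\mathbb{R}^r}\sum_{i=1}^n\rho_\tau(Y_i-\mathbb{X}_i^\top\beta)$. Adaptive group LASSO expectile estimator: $\widehat{\beta}_n=\arg\min_{\beta\in\mathbb{R}^r}\big\{n^{-1}\sum_{i=1}^n\rho_\tau(Y_i-\mathbb{X}_i^\top\beta)+\lambda_n\sum_{j=1}^p\widehat{\omega}_{n;j}\|\beta_j\|_2\big\}$, with weights $\widehat{\omega}_{n;j}=\|\widetilde{\beta}_{n;j}\|_2^{-\gamma}$, where $\gamma>0$ is a known constant and $(\lambda_n)$ is a sequence of positive tuning parameters. $\delta_{\min},\delta_{\max}$ denote smallest and largest eigenvalues; $\|\cdot\|_2$, $\|\cdot\|_\infty$ are the Euclidean and sup norms; $\xrightarrow{\mathcal{L}}$ is convergence in distribution. The constants in the assumptions do not depend on $n$. *)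

(* Defs.v *)
From HB Require Import structures.
From mathcomp Require Import all_boot all_order all_algebra finmap.
From mathcomp Require Import all_classical all_reals all_analysis.

Set Implicit Arguments.
Unset Strict Implicit.
Unset Printing Implicit Defensive.

Import Order.TTheory GRing.Theory Num.Theory.
Import numFieldNormedType.Exports.

Local Open Scope classical_set_scope.
Local Open Scope ring_scope.

Section linear_algebra.
Context {R : realType}.

Definition dotv (k : nat) (u v : 'cV[R]_k) : R := \sum_i u i ord0 * v i ord0.

Definition norm2 (k : nat) (v : 'cV[R]_k) : R :=
  Num.sqrt (\sum_i v i ord0 ^+ 2).

(* For a symmetric real matrix of positive size the set of eigenvalues is
   finite and nonempty, so that inf and sup are a minimum and a maximum. *)
Definition eigen_min (k : nat) (S : 'M[R]_k) : R :=
  inf [set a : R | eigenvalue S a].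
Definition eigen_max (k : nat) (S : 'M[R]_k) : R :=
  sup [set a : R | eigenvalue S a].

Definition posdef (k : nat) (S : 'M[R]_k) : Prop :=
  S^T = S /\ forall v : 'cV[R]_k, v != 0 -> 0 < dotv v (S *m v).

(* Vectors made of p groups, the j-th one of size d j, are columns of size
   \sum_j d j, and the j-th group of v is submxcol v j. The two next operations
   keep the coordinates of the first p0 groups. *)
Definition first_groups (p p0 : nat) (hp : (p0 <= p)%N) (d : 'I_p -> nat)
    (v : 'cV[R]_(\sum_(j < p) d j)) :
    'cV[R]_(\sum_(j < p0) d (widen_ord hp j)) :=
  \mxcol_(j < p0) submxcol v (widen_ord hp j).

Definition first_groups_mx (p p0 : nat) (hp : (p0 <= p)%N) (d : 'I_p -> nat)
    (S : 'M[R]_(\sum_(j < p) d j)) :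
    'M[R]_(\sum_(j < p0) d (widen_ord hp j)) :=
  \mxblock_(i < p0, j < p0) submxblock S (widen_ord hp i) (widen_ord hp j).

End linear_algebra.

Section probability_notions.
Context {R : realType}.

Definition mutually_independent (disp : measure_display)
    (T : measurableType disp) (P : probability T R) (I : choiceType)
    (X : I -> {RV P >-> R}) : Prop :=
  forall (J : {fset I}) (A : I -> set R), (forall i, measurable (A i)) ->
    P (\bigcap_(i in [set` J]) (X i @^-1` A i)) =
    (\prod_(i <- J) P (X i @^-1` A i))%E.

Definition identically_distributed (disp : measure_display)
    (T : measurableType disp) (P : probability T R) (I : Type)
    (X : I -> {RV P >-> R}) : Prop :=
  forall (i j : I) (A : set R), measurable A ->
    distribution P (X i) A = distribution P (X j) A.

Definition has_density (disp : measure_display) (T : measurableType disp)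
    (P : probability T R) (X : {RV P >-> R}) (f : R -> R) : Prop :=
  measurable_fun setT f /\
  forall A : set R, measurable A ->
    distribution P X A = (\int[lebesgue_measure]_(x in A) (f x)%:E)%E.

Definition random_vector (disp : measure_display) (T : measurableType disp)
    (k : nat) (Z : T -> 'cV[R]_k) : Prop :=
  forall i, measurable_fun setT (fun w => Z w i ord0).

Definition cvg_in_law (disp : measure_display) (T : measurableType disp)
    (P : probability T R) (disp' : measure_display)
    (T' : measurableType disp') (P' : probability T' R) (k : nat)
    (Z : nat -> T -> 'cV[R]_k) (G : T' -> 'cV[R]_k) : Prop :=
  forall f : 'cV[R]_k -> R, continuous f -> (exists M : R, forall x, `|f x| <= M) ->
    'E_P[fun w => f (Z n w)]%E @[n --> \oo] --> 'E_P'[fun w => f (G w)]%E.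

(* G = m + A W with A A^T = S and W a vector of independent standard normal
   variables. *)
Definition multivariate_normal (disp : measure_display)
    (T : measurableType disp) (P : probability T R) (k : nat)
    (m : 'cV[R]_k) (S : 'M[R]_k) (G : T -> 'cV[R]_k) : Prop :=
  exists (l : nat) (A : 'M[R]_(k, l)) (W : 'I_l -> {RV P >-> R}),
    [/\ mutually_independent W,
        forall (i : 'I_l) (B : set R), measurable B ->
          distribution P (W i) B = normal_prob 0 1 B,
        A *m A^T = S &
        forall w, G w = m + A *m \col_i W i w].

Definition cvg_in_law_normal (disp : measure_display)
    (T : measurableType disp) (P : probability T R) (k : nat)
    (Z : nat -> T -> 'cV[R]_k) (m : 'cV[R]_k) (S : 'M[R]_k) : Prop :=
  exists (disp' : measure_display) (T' : measurableType disp')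
    (P' : probability T' R) (G : T' -> 'cV[R]_k),
    multivariate_normal P' m S G /\ cvg_in_law P P' Z G.

End probability_notions.

Section expectile_regression.
Context {R : realType}.

Definition rho (tau u : R) : R := u ^+ 2 * `|tau - (u < 0)%R%:R|.

Definition g_tau (tau e : R) : R :=
  - 2 * e * (tau * (0 <= e)%R%:R + (1 - tau) * (e < 0)%R%:R).

Definition h_tau (tau e : R) : R :=
  2 * (tau * (0 <= e)%R%:R + (1 - tau) * (e < 0)%R%:R).

(* Observations are numbered from 0: the sample of size n is X 0, ..., X n.-1. *)
Definition gram (r : nat) (X : nat -> 'cV[R]_r) (n : nat) : 'M[R]_r :=
  n%:R^-1 *: \sum_(i < n) X i *m (X i)^T.

Definition expectile_loss (r : nat) (tau : R) (X : nat -> 'cV[R]_r)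
    (y : nat -> R) (n : nat) (b : 'cV[R]_r) : R :=
  \sum_(i < n) rho tau (y i - dotv (X i) b).

Definition is_expectile_estimate (r : nat) (tau : R) (X : nat -> 'cV[R]_r)
    (y : nat -> R) (n : nat) (b : 'cV[R]_r) : Prop :=
  forall b', expectile_loss tau X y n b <= expectile_loss tau X y n b'.

(* The inverse is the one of extended reals, for which 0^-1 = +oo: a group whose
   initial estimate vanishes has an infinite weight (and +oo * 0 = 0). *)
Definition adaptive_weight (p : nat) (d : 'I_p -> nat) (gamma : R)
    (bt : 'cV[R]_(\sum_(j < p) d j)) (j : 'I_p) : \bar R :=
  ((norm2 (submxcol bt j) `^ gamma)%:E^-1)%E.

Definition lasso_objective (p : nat) (d : 'I_p -> nat) (tau gamma lam : R)
    (X : nat -> 'cV[R]_(\sum_(j < p) d j)) (y : nat -> R) (n : nat)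
    (bt b : 'cV[R]_(\sum_(j < p) d j)) : \bar R :=
  ((n%:R^-1 * expectile_loss tau X y n b)%:E +
   lam%:E * \sum_(j < p)
     (adaptive_weight gamma bt j * (norm2 (submxcol b j))%:E))%E.

Definition is_lasso_estimate (p : nat) (d : 'I_p -> nat) (tau gamma lam : R)
    (X : nat -> 'cV[R]_(\sum_(j < p) d j)) (y : nat -> R) (n : nat)
    (bt b : 'cV[R]_(\sum_(j < p) d j)) : Prop :=
  forall b', (lasso_objective tau gamma lam X y n bt b <=
              lasso_objective tau gamma lam X y n bt b')%E.

End expectile_regression.

(* Main.v *)
Require Import Defs.
From HB Require Import structures.
From mathcomp Require Import all_boot all_order all_algebra finmap.
From mathcomp Require Import all_classical all_reals all_analysis.
From mathcomp Require Import measurable_realfun ring lra.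

(** Put [u = sqrt n (b - beta0)].  When the score [n^(-1/2) sum g(eps_i) X_i] is
    bounded, strong convexity of the expectile loss makes the expectile estimate
    [sqrt n]-consistent.  The weights of the inactive groups are then at least of
    order [n^(gamma/2)], so that, beyond a deterministic rank, the penalty kills
    these groups, whereas on the active groups it moves the rescaled objective by
    [O(sqrt n lam_n) = o(1)] only.  If moreover the weighted Gram matrix
    [n^-1 sum h(eps_i) X_i X_i^T] is close to [mu Upsilon] and few errors are of
    order [n^(-1/2)], the loss is close to a quadratic function, and comparing the
    estimate with the minimizer of the latter shows that
    [sqrt n (beta_hat - beta0)_A] is close to [- mu^-1 Upsilon_A^-1 score_A].
    Markov's inequality shows that these events have probability close to one.

    The central limit theorem for the score follows Trotter.  A random summand
    [xi u] acts on test functions by [f |-> E f(. + xi u)]; these operators are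
    commuting contractions, so that the summands can be replaced one by one by
    Gaussian ones, at the cost of third moments.  Stability of the normal law under
    [(W + W') / sqrt 2] shows that a composition of Gaussian operators depends on
    the covariance matrix only.  Approximation by cubic splines extends the
    convergence from smooth to continuous bounded test functions. *)

Import Order.TTheory GRing.Theory Num.Theory.
Import numFieldNormedType.Exports.
Set Implicit Arguments.
Unset Strict Implicit.
Unset Printing Implicit Defensive.
Local Open Scope classical_set_scope.
Local Open Scope ring_scope.

(** * Matrix norms and positive definite matrices *)

(** The analysis of the estimates is purely deterministic: for [n] beyond a rank that does not
    depend on the errors, [lasso_support] and [lasso_expansion] hold for every error sequence [e]
    with suitably bounded statistics. The two minimizers are used only through their minimality
    against a few explicit competitors, so that no optimality condition has to be differentiated.
    Randomness enters through one exceptional event, on whose complement the three statistics of [e]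
    are under control.

    The derivative of the loss has a kink at [0]: the second order expansion is exact unless a
    residual changes sign, which concerns only errors of order [n^(-1/2)]. The law of the errors has
    a density, hence no atom at [0], and such errors are asymptotically negligible.

    In the limit theorem, [n] Gaussian steps along [n] vectors have to be compared with the columns
    of a fixed matrix: the covariance matrices are close, the vectors are unrelated. Cutting every
    step into [2 ^ m] smaller ones of the same law reduces the comparison to a second order
    expansion, where the vectors appear only through their covariance matrix. *)

Section matrix_norms.
Context {R : realType}.

(** The norm of a matrix is the largest absolute value of its entries, whence the dimensions that
    enter the constants of all later estimates. *)
Lemma mx_norm_entry m n (A : 'M[R]_(m, n)) i j : `|A i j| <= `|A|.
Proof.
rewrite [X in _ <= X]mx_normrE.
exact: (le_bigmax _ (fun ij : 'I_m * 'I_n => `|A ij.1 ij.2|) (i, j)).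
Qed.

Lemma mx_norm_le m n (A : 'M[R]_(m, n)) (c : R) :
  0 <= c -> (forall i j, `|A i j| <= c) -> `|A| <= c.
Proof.
by move=> c0 Ac; rewrite [X in X <= _]mx_normrE; apply: bigmax_le => // -[i j] _ /=.
Qed.

Lemma mx_normM m n k (A : 'M[R]_(m, n)) (B : 'M[R]_(n, k)) :
  `|A *m B| <= n%:R * `|A| * `|B|.
Proof.
apply: mx_norm_le => [|i j]; first by rewrite !mulr_ge0.
rewrite mxE (le_trans (ler_norm_sum _ _ _))//.
rewrite (le_trans (_ : _ <= \sum_(i < n) `|A| * `|B|))//.
  by apply: ler_sum => l _; rewrite normrM ler_pM// mx_norm_entry.
by rewrite sumr_const card_ord -mulrA mulr_natl.
Qed.

Lemma mx_norm_tr m n (A : 'M[R]_(m, n)) : `|A^T| = `|A|.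
Proof.
apply/le_anti/andP; split; apply: mx_norm_le => // i j.
  by rewrite mxE mx_norm_entry.
by have := mx_norm_entry A^T j i; rewrite mxE.
Qed.

Lemma dotvE k (u v : 'cV[R]_k) : dotv u v = (u^T *m v) ord0 ord0.
Proof. by rewrite mxE; apply: eq_bigr => i _; rewrite mxE. Qed.

Lemma dotvC k (u v : 'cV[R]_k) : dotv u v = dotv v u.
Proof. by apply: eq_bigr => i _; rewrite mulrC. Qed.

Lemma dotvDr k (u v w : 'cV[R]_k) : dotv u (v + w) = dotv u v + dotv u w.
Proof. by rewrite !dotvE mulmxDr mxE. Qed.

Lemma dotvNr k (u v : 'cV[R]_k) : dotv u (- v) = - dotv u v.
Proof. by rewrite !dotvE mulmxN mxE. Qed.

Lemma dotvBr k (u v w : 'cV[R]_k) : dotv u (v - w) = dotv u v - dotv u w.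
Proof. by rewrite dotvDr dotvNr. Qed.

Lemma dotvZr k (a : R) (u v : 'cV[R]_k) : dotv u (a *: v) = a * dotv u v.
Proof. by rewrite !dotvE -scalemxAr mxE. Qed.

Lemma dotvDl k (u v w : 'cV[R]_k) : dotv (u + v) w = dotv u w + dotv v w.
Proof. by rewrite dotvC dotvDr !(dotvC w). Qed.

Lemma dotvNl k (u v : 'cV[R]_k) : dotv (- u) v = - dotv u v.
Proof. by rewrite dotvC dotvNr dotvC. Qed.

Lemma dotvBl k (u v w : 'cV[R]_k) : dotv (u - v) w = dotv u w - dotv v w.
Proof. by rewrite dotvDl dotvNl. Qed.

Lemma dotvZl k (a : R) (u v : 'cV[R]_k) : dotv (a *: u) v = a * dotv u v.
Proof. by rewrite dotvC dotvZr dotvC. Qed.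

Lemma dotv0r k (u : 'cV[R]_k) : dotv u 0 = 0.
Proof. by rewrite dotvE mulmx0 mxE. Qed.

Lemma dotv_sumr k (I : Type) (s : seq I) (u : 'cV[R]_k) (v : I -> 'cV[R]_k) :
  dotv u (\sum_(i <- s) v i) = \sum_(i <- s) dotv u (v i).
Proof.
by elim/big_rec2: _ => [|i x y _ <-]; rewrite ?dotv0r // dotvDr.
Qed.

Lemma dotv_mulmx k l (u : 'cV[R]_k) (A : 'M[R]_(k, l)) (v : 'cV[R]_l) :
  dotv u (A *m v) = dotv (A^T *m u) v.
Proof. by rewrite !dotvE trmx_mul trmxK mulmxA. Qed.

Lemma dotv_le k (u v : 'cV[R]_k) : `|dotv u v| <= k%:R * `|u| * `|v|.
Proof.
rewrite dotvE (le_trans (mx_norm_entry _ _ _))// (le_trans (mx_normM _ _))//.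
by rewrite mx_norm_tr.
Qed.

Lemma dotvv_ge k (v : 'cV[R]_k) : `|v| ^+ 2 <= dotv v v.
Proof.
have d0 : 0 <= dotv v v by apply: sumr_ge0 => i _; rewrite -expr2 sqr_ge0.
rewrite -(sqr_sqrtr d0) ler_sqr ?nnegrE ?sqrtr_ge0//.
apply: mx_norm_le => [|i j]; first exact: sqrtr_ge0.
rewrite ord1 -sqrtr_sqr ler_sqrt// /dotv (bigD1 i)//= expr2 lerDl.
by apply: sumr_ge0 => l _; rewrite -expr2 sqr_ge0.
Qed.

Lemma norm2E k (v : 'cV[R]_k) : norm2 v = Num.sqrt (dotv v v).
Proof. by congr Num.sqrt; apply: eq_bigr => i _; rewrite expr2. Qed.

Lemma norm2_ge0 k (v : 'cV[R]_k) : 0 <= norm2 v.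
Proof. exact: sqrtr_ge0. Qed.

Lemma sqr_norm2 k (v : 'cV[R]_k) : norm2 v ^+ 2 = dotv v v.
Proof.
by rewrite norm2E sqr_sqrtr//; apply: sumr_ge0 => i _; rewrite -expr2 sqr_ge0.
Qed.

Lemma norm_le_norm2 k (v : 'cV[R]_k) : `|v| <= norm2 v.
Proof.
by rewrite -ler_sqr ?nnegrE ?norm2_ge0// sqr_norm2 dotvv_ge.
Qed.

Lemma norm20 k : norm2 (0 : 'cV[R]_k) = 0.
Proof. by rewrite norm2E dotv0r sqrtr0. Qed.

Lemma norm2_eq0 k (v : 'cV[R]_k) : norm2 v = 0 -> v = 0.
Proof.
move=> v0; apply/eqP; rewrite -normr_eq0 eq_le normr_ge0 andbT.
by rewrite -v0 norm_le_norm2.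
Qed.

Lemma norm2Z k a (v : 'cV[R]_k) : norm2 (a *: v) = `|a| * norm2 v.
Proof.
by rewrite !norm2E dotvZl dotvZr mulrA -expr2 sqrtrM ?sqr_ge0// sqrtr_sqr.
Qed.

Lemma norm2N k (v : 'cV[R]_k) : norm2 (- v) = norm2 v.
Proof. by rewrite -scaleN1r norm2Z normrN1 mul1r. Qed.

(** Expanding the square of [norm2 (norm2 u *: v - norm2 v *: u)] gives [2 * norm2 u * norm2 v]
    times the difference of the two sides. *)
Lemma dotv_norm2 k (u v : 'cV[R]_k) : dotv u v <= norm2 u * norm2 v.
Proof.
have [u0|u0] := eqVneq (norm2 u) 0.
  by rewrite (norm2_eq0 u0) norm20 mul0r dotvC dotv0r.
have up : 0 < norm2 u by rewrite lt_neqAle eq_sym u0 norm2_ge0.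
have : 0 <= norm2 (norm2 u *: v - norm2 v *: u) ^+ 2 by exact: sqr_ge0.
rewrite sqr_norm2 dotvBl !dotvBr !dotvZl !dotvZr -!sqr_norm2 (dotvC v u).
have [v0|v0] := eqVneq (norm2 v) 0.
  by rewrite (norm2_eq0 v0) norm20 mulr0 dotv0r.
have vp : 0 < norm2 v by rewrite lt_neqAle eq_sym v0 norm2_ge0.
move=> h; rewrite -subr_ge0 -(pmulr_lge0 _ (mulr_gt0 up vp)) -(@pmulr_rge0 _ 2)//.
by apply: le_trans h _; lra.
Qed.

Lemma norm2D k (u v : 'cV[R]_k) : norm2 (u + v) <= norm2 u + norm2 v.
Proof.
rewrite -ler_sqr ?nnegrE ?addr_ge0 ?norm2_ge0//.
rewrite sqr_norm2 dotvDl !dotvDr sqrrD -!sqr_norm2 (dotvC v u).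
by have := dotv_norm2 u v; rewrite mulr2n; lra.
Qed.

Lemma norm2_le k (v : 'cV[R]_k) : norm2 v <= k%:R * `|v|.
Proof.
rewrite -ler_sqr ?nnegrE ?mulr_ge0 ?norm2_ge0// sqr_norm2.
rewrite (le_trans (ler_norm _))// (le_trans (dotv_le _ _))// exprMn.
rewrite [_ ^+ 2]expr2 -!mulrA -expr2 ler_wpM2l//.
case: k v => [|k] v; first by rewrite mul0r [v]flatmx0 normr0 expr0n.
by rewrite ler_peMl ?sqr_ge0// ler1n.
Qed.

End matrix_norms.

Section positive_definite.
Context {R : realType}.

(* Recursion on the Schur complement of the upper left entry. *)
Lemma posdef_cholesky k (S : 'M[R]_k) :
  posdef S -> exists A : 'M[R]_k, A *m A^T = S.
Proof.
elim: k S => [|k IHk] S [St Sp].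
  by exists 0; apply/matrixP => -[].
move: S St Sp; rewrite -[k.+1]/(1 + k)%N => S St Sp.
pose s := S ord0 ord0; pose b := dlsubmx S; pose D := drsubmx S.
have ulS : ulsubmx S = s%:M.
  by apply/matrixP => i j; rewrite !ord1 !mxE/= mulr1n; congr (S _ _); exact/val_inj.
have SE : S = block_mx s%:M b^T b D.
  rewrite -[LHS]submxK ulS; congr block_mx.
  by rewrite trmx_dlsub St.
have Dt : D^T = D by rewrite trmx_drsub St.
have s0 : 0 < s.
  have /Sp : delta_mx ord0 ord0 != 0 :> 'cV[R]_(1 + k).
    apply/eqP => /matrixP/(_ ord0 ord0); rewrite !mxE !eqxx.
    by move/eqP; rewrite oner_eq0.
  by rewrite -colE dotvE trmx_delta -rowE !mxE.
have sN0 : s != 0 by rewrite gt_eqF.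
have [A AE] : exists A : 'M[R]_k, A *m A^T = D - s^-1 *: (b *m b^T).
  apply: IHk; split=> [|v vN0].
    by rewrite linearB linearZ/= trmx_mul trmxK Dt.
  pose t := (b^T *m v) ord0 ord0.
  (* As a function of the first coordinate the form is minimal at [- t / s], where its value is that
     of the Schur complement at [v]. *)
  have := Sp (col_mx ((- (s^-1 * t))%:M) v).
  have -> : col_mx (- (s^-1 * t))%:M v != 0 :> 'cV[R]_(1 + k).
    by apply: contra vN0 => /eqP; rewrite -[RHS]col_mx0 => /eq_col_mx [_ ->].
  move=> /(_ isT); rewrite [in dotv _ _]SE (mul_block_col s%:M b^T b D).
  rewrite !dotvE tr_col_mx mul_row_col.
  have -> : b^T *m v = t%:M by rewrite [LHS]mx11_scalar.
  rewrite -scalar_mxM -raddfD/= mulrN mulrA mulfV// mul1r addNr raddf0 mulmx0 add0r.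
  rewrite mulmxDr mulmxBl mulmxBr -scalemxAl -scalemxAr.
  rewrite -[b *m b^T *m v]mulmxA.
  have -> : b^T *m v = t%:M by rewrite [LHS]mx11_scalar.
  by rewrite !mul_mx_scalar -!scalemxAr scalerA scaleNr addrC.
exists (block_mx (Num.sqrt s)%:M 0 ((Num.sqrt s)^-1 *: b) A).
have ss : Num.sqrt s * Num.sqrt s = s by rewrite -expr2 sqr_sqrtr// ltW.
have sqN0 : Num.sqrt s != 0 by rewrite gt_eqF// sqrtr_gt0.
rewrite tr_block_mx (mulmx_block (Num.sqrt s)%:M).
rewrite tr_scalar_mx trmx0 !mul0mx !mulmx0 !addr0 SE.
rewrite -scalar_mxM ss linearZ/= -scalemxAr -scalemxAl mul_scalar_mx mul_mx_scalar.
rewrite !scalerA ?mulVf// ?mulfV// !scale1r -scalemxAl -scalemxAr scalerA -invfM ss AE.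
by congr block_mx; rewrite addrC subrK.
Qed.

Lemma posdef_unitmx k (S : 'M[R]_k) : posdef S -> S \in unitmx.
Proof.
move=> [St Sp]; rewrite -unitmx_tr -row_free_unit -kermx_eq0; apply/rowV0P => v.
move=> /sub_kermxP vS; apply/eqP; apply: contraPT isT => vN0.
have /Sp : v^T != 0 by rewrite trmx_eq0.
by rewrite dotvE -[S]trmxK -trmx_mul vS trmx0 mulmx0 mxE ltxx.
Qed.

(** With a Cholesky factor [A] the form is the squared Euclidean norm of [A^T *m v], from which [v]
    is recovered by the inverse of [A^T]. The summand [1] in [L] keeps it positive in every
    dimension. *)
Lemma posdef_coercive k (S : 'M[R]_k) : posdef S ->
  exists2 c : R, 0 < c & forall v : 'cV[R]_k, c * `|v| ^+ 2 <= dotv v (S *m v).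
Proof.
move=> Sp; have [A AE] := posdef_cholesky Sp.
have Au : A^T \in unitmx.
  by rewrite unitmx_tr; have := posdef_unitmx Sp; rewrite -AE unitmx_mul => /andP[].
pose L := 1 + k%:R * `|invmx A^T|.
have L0 : 0 < L by rewrite ltr_pwDl// mulr_ge0.
exists (L ^- 2) => [|v]; first by rewrite invr_gt0 exprn_gt0.
rewrite -AE -mulmxA dotv_mulmx; apply: le_trans (dotvv_ge _).
rewrite ler_pdivrMl ?exprn_gt0// -exprMn ler_sqr ?nnegrE ?mulr_ge0 ?(ltW L0)//.
rewrite -[v in `|v|](mulKmx Au) (le_trans (mx_normM _ _))//.
by rewrite ler_wpM2r// lerDr.
Qed.

Lemma posdef_invmx k (S : 'M[R]_k) : posdef S -> posdef (invmx S).
Proof.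
move=> Sp; have Su := posdef_unitmx Sp; case: Sp => [St Sp].
have iSt : (invmx S)^T = invmx S by rewrite trmx_inv St.
split=> // v vN0; rewrite dotvC -[v in dotv _ v](mulKVmx Su).
apply: Sp; apply: contra vN0 => /eqP iSv.
by rewrite -[v](mulKVmx Su) iSv mulmx0.
Qed.

End positive_definite.

(** * The expectile loss and the active coordinates *)

Section expectile_function.
Context {R : realType}.
Variable tau : R.
Hypothesis tau01 : 0 < tau < 1.

Lemma rhoE (u : R) : rho tau u = (if u < 0 then 1 - tau else tau) * u ^+ 2.
Proof.
have /andP[t0 t1] := tau01; rewrite /rho mulrC; congr (_ * _).
case: ltP => _ /=; first by rewrite distrC ger0_norm// subr_ge0 ltW.
by rewrite subr0 gtr0_norm.
Qed.

Lemma h_tauE (e : R) : h_tau tau e = 2 * (if e < 0 then 1 - tau else tau).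
Proof. by rewrite /h_tau; case: ltP => _ /=; congr (_ * _); ring. Qed.

Lemma g_tauE (e : R) : g_tau tau e = - h_tau tau e * e.
Proof. by rewrite /g_tau /h_tau; ring. Qed.

Lemma h_tau_le2 (e : R) : 0 <= h_tau tau e <= 2.
Proof. by have /andP[t0 t1] := tau01; rewrite h_tauE; case: ltP => _; lra. Qed.

Lemma normr_g_tau (e : R) : `|g_tau tau e| <= 2 * `|e|.
Proof.
have /andP[h0 h2] := h_tau_le2 e.
rewrite g_tauE normrM normrN (ger0_norm h0).
by apply: ler_wpM2r.
Qed.

Lemma normr_g_tauB (e t : R) : `|g_tau tau (e - t) - g_tau tau e| <= 2 * `|t|.
Proof.
have /andP[t0 t1] := tau01; rewrite !g_tauE !h_tauE ler_norml.
case: (leP 0 t) => h3; [rewrite ger0_norm//|rewrite ltr0_norm//];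
by case: ltP => h1; case: ltP => h2; apply/andP; split; nra.
Qed.

(** Strong convexity: [g_tau tau e] is the derivative of [t |-> rho tau (e - t)] at [0], and the
    second derivative of this function, where it exists, is [2 * tau] or [2 * (1 - tau)], hence at
    least [2 * c]. *)
Lemma rho_lower (c e t : R) : c <= tau -> c <= 1 - tau ->
  g_tau tau e * t + c * t ^+ 2 <= rho tau (e - t) - rho tau e.
Proof.
move=> ct c1t; rewrite g_tauE h_tauE !rhoE.
have e1 : 0 <= tau - c by lra.
have e2 : 0 <= 1 - tau - c by lra.
have t20 := sqr_ge0 t.
case: ltP => h1; case: ltP => h2; [nra| | |nra].
  (* Here [e - t] and [e] lie on opposite sides of [0], so that [e - t] is at most [t] in absolute
     value. *)
  rewrite -subr_ge0.
  suff : 0 <= (1 - tau) * t ^+ 2 + (2 * tau - 1) * (e - t) ^+ 2 - c * t ^+ 2 by lra.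
  have : (e - t) ^+ 2 <= t ^+ 2 by nra.
  have := sqr_ge0 (e - t); nra.
rewrite -subr_ge0.
suff : 0 <= tau * t ^+ 2 + (1 - 2 * tau) * (e - t) ^+ 2 - c * t ^+ 2 by lra.
have : (e - t) ^+ 2 <= t ^+ 2 by nra.
have := sqr_ge0 (e - t); nra.
Qed.

(** On either half-line [rho] is exactly quadratic, so that a remainder appears only when [e] and
    [e - t] lie on opposite sides of [0]. This forces [e] to be at most [t] in absolute value,
    whence the indicator. *)
Lemma rho_quadratic (e t : R) :
  `|rho tau (e - t) - rho tau e - g_tau tau e * t - h_tau tau e * t ^+ 2 / 2|
    <= t ^+ 2 * (`|e| <= `|t|)%R%:R.
Proof.
have /andP[t0 t1] := tau01.
rewrite g_tauE h_tauE !rhoE; have t20 := sqr_ge0 t.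
case: ltP => h1; case: ltP => h2.
- rewrite [X in `|X|](_ : _ = 0); last by field.
  by rewrite normr0 mulr_ge0.
- have -> : `|e| <= `|t| by rewrite (ger0_norm h2) gtr0_norm; lra.
  rewrite mulr1 [X in `|X|](_ : _ = (1 - 2 * tau) * (e - t) ^+ 2); last by field.
  have := sqr_ge0 (e - t); have : (e - t) ^+ 2 <= t ^+ 2 by nra.
  by move=> ? ?; rewrite ler_norml; apply/andP; split; nra.
- have -> : `|e| <= `|t| by rewrite (ltr0_norm h2) ltr0_norm; lra.
  rewrite mulr1 [X in `|X|](_ : _ = (2 * tau - 1) * (e - t) ^+ 2); last by field.
  have := sqr_ge0 (e - t); have : (e - t) ^+ 2 <= t ^+ 2 by nra.
  by move=> ? ?; rewrite ler_norml; apply/andP; split; nra.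
- rewrite [X in `|X|](_ : _ = 0); last by field.
  by rewrite normr0 mulr_ge0.
Qed.

(** Convexity at the point [e - t'], where the derivative differs from [g_tau tau e] by at most
    twice the size of [t']. The bound is linear in [t - t'], as needed to compete with a penalty
    that is itself linear near zero groups. *)
Lemma rho_diff_lower (e t t' : R) :
  g_tau tau e * (t - t') - 2 * `|t'| * `|t - t'|
    <= rho tau (e - t) - rho tau (e - t').
Proof.
have /andP[t0 t1] := tau01.
have := @rho_lower 0 (e - t') (t - t') (ltW t0).
rewrite subr_ge0 ltW// mul0r addr0 => /(_ isT).
rewrite [e - t' - _](_ : _ = e - t); last by ring.
apply: le_trans; rewrite -subr_ge0.
have : `|(g_tau tau (e - t') - g_tau tau e) * (t - t')| <= 2 * `|t'| * `|t - t'|.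
  by rewrite normrM ler_wpM2r// normr_g_tauB.
by rewrite ler_norml => /andP[+ _]; lra.
Qed.

End expectile_function.

(** * Restriction to the active coordinates as a matrix product *)

Section first_groups_selection.
Context {R : realType} (p p0 : nat) (hp : (p0 <= p)%N) (d : 'I_p -> nat).
Local Notation r := (\sum_(j < p) d j)%N.
Local Notation r0 := (\sum_(j < p0) d (widen_ord hp j))%N.

Definition sel_idx (s : 'I_r0) : 'I_r :=
  @tagnat.Rank p d (widen_ord hp (tagnat.sig1 s)) (tagnat.sig2 s).

(** With [J := sel_mx], restriction is [J^T *m v], extension by zero is [J *m v], and [J *m J^T] is
    the projection that erases the inactive groups. *)
Definition sel_mx : 'M[R]_(r, r0) := \matrix_(i, s) (i == sel_idx s)%:R.

Lemma sel_idx_inj : injective sel_idx.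
Proof.
move=> s t /(congr1 val)/eqP; rewrite tagnat.eq_Rank => /andP[/eqP st1 st2].
apply/val_inj/eqP; rewrite -(tagnat.sig2K s) -(tagnat.sig2K t) tagnat.eq_Rank.
by rewrite st2 andbT; apply/eqP/val_inj; exact: (congr1 val st1).
Qed.

Lemma tr_sel_mxE (m : nat) (v : 'M[R]_(r, m)) : sel_mx^T *m v = rowsub sel_idx v.
Proof.
apply/matrixP => s j; rewrite !mxE (bigD1 (sel_idx s))//= !mxE eqxx mul1r.
rewrite (big1 _ (fun i => i != sel_idx s)) ?addr0// => i /negPf is0.
by rewrite !mxE is0 mul0r.
Qed.

Lemma first_groupsE (v : 'cV[R]_r) : first_groups hp v = sel_mx^T *m v.
Proof.
rewrite tr_sel_mxE; apply/matrixP => s j; rewrite !mxE.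
by congr (v _ _); rewrite /sel_idx.
Qed.

Lemma first_groups_mxE (S : 'M[R]_r) :
  first_groups_mx hp S = sel_mx^T *m S *m sel_mx.
Proof.
rewrite -[RHS]trmxK trmx_mul tr_sel_mxE tr_sel_mxE.
by apply/matrixP => s t; rewrite !mxE.
Qed.

Lemma tr_sel_mxK : sel_mx^T *m sel_mx = 1%:M.
Proof.
rewrite tr_sel_mxE; apply/matrixP => s t; rewrite !mxE.
by rewrite (inj_eq sel_idx_inj).
Qed.

Lemma norm_sel_mx (v : 'cV[R]_r0) : `|sel_mx *m v| <= `|v|.
Proof.
apply: mx_norm_le => // i j; rewrite mxE ord1.
have [/existsP[s /eqP ->]|] := boolP [exists s, i == sel_idx s].
  rewrite (bigD1 s)//= (big1 _ (fun t => t != s)) => [|t ts]; last first.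
    by rewrite mxE (inj_eq sel_idx_inj) eq_sym (negPf ts) mul0r.
  by rewrite mxE eqxx mul1r addr0 mx_norm_entry.
rewrite negb_exists => /forallP ni; rewrite big1 ?normr0// => s _.
by rewrite mxE (negPf (ni s)) mul0r.
Qed.

Lemma norm_tr_sel_mx (v : 'cV[R]_r) : `|sel_mx^T *m v| <= `|v|.
Proof.
by apply: mx_norm_le => // s j; rewrite tr_sel_mxE mxE mx_norm_entry.
Qed.

Lemma submxcol_sel_proj (v : 'cV[R]_r) (j : 'I_p) :
  submxcol (sel_mx *m (sel_mx^T *m v)) j = if (j < p0)%N then submxcol v j else 0.
Proof.
apply/matrixP => i k; rewrite !mxE ord1.
case: ifPn => [jp0|jp0]; last first.
  rewrite big1 ?mxE// => s _; rewrite mxE -val_eqE /sel_idx tagnat.eq_Rank.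
  case: eqP => [js|]; last by rewrite mul0r.
  by move: jp0; rewrite {1}js/= ltn_ord.
have [s sE] : exists s, tagnat.Rank j i = sel_idx s.
  have jE : j = widen_ord hp (Ordinal jp0) by exact/val_inj.
  pose i' : 'I_(d (widen_ord hp (Ordinal jp0))) := 
    cast_ord (congr1 d jE) i.
  exists (@tagnat.Rank p0 (fun j => d (widen_ord hp j)) (Ordinal jp0) i').
  apply/val_inj/eqP; rewrite tagnat.eq_Rank; apply/andP; split.
    by apply/eqP/val_inj; rewrite /= tagnat.Rank1K.
  by rewrite tagnat.Rank2K.
rewrite (bigD1 s)//= !mxE sE eqxx mul1r (big1 _ (fun t => t != s)) ?addr0 => [|t ts].
  by have /matrixP/(_ s ord0) := tr_sel_mxE v; rewrite !mxE => ->.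
by rewrite mxE (inj_eq sel_idx_inj) eq_sym (negPf ts) mul0r.
Qed.

End first_groups_selection.

(** * Local expansion of the expectile loss *)

Section groups.
Context {R : realType} (p : nat) (d : 'I_p -> nat).
Local Notation r := (\sum_(j < p) d j)%N.

Lemma norm2_submxcol_le (v : 'cV[R]_r) j :
  norm2 (submxcol v j) <= r%:R * `|v|.
Proof.
rewrite (le_trans (norm2_le _))// ler_pM//.
  by rewrite ler_nat (bigD1 j)//= leq_addr.
by apply: mx_norm_le => // i k; rewrite mxE mx_norm_entry.
Qed.

Lemma norm_le_sum_norm2 (v : 'cV[R]_r) : `|v| <= \sum_j norm2 (submxcol v j).
Proof.
apply: mx_norm_le => [|i k]; first by apply: sumr_ge0 => j _; exact: norm2_ge0.
rewrite ord1 -[i]tagnat.sig2K.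
rewrite [leRHS](bigD1 (tagnat.sig1 i))//= ler_wpDr//.
  by apply: sumr_ge0 => j _; exact: norm2_ge0.
rewrite (le_trans _ (norm_le_norm2 _))//.
by have := mx_norm_entry (submxcol v (tagnat.sig1 i)) (tagnat.sig2 i) ord0; rewrite mxE.
Qed.

End groups.

Section local_expansion.
Context {R : realType} (r : nat).
Variables (tau : R) (X : nat -> 'cV[R]_r) (C0 : R).
Hypotheses (tau01 : 0 < tau < 1) (C0_gt0 : 0 < C0) (XC0 : forall i, `|X i| <= C0).

Let s (n : nat) : R := Num.sqrt n%:R.

Definition score (e : nat -> R) (n : nat) : 'cV[R]_r :=
  (s n)^-1 *: \sum_(i < n) g_tau tau (e i) *: X i.

(** Added to [mu *: gram X n], it gives the Gram matrix weighted by [h_tau tau (e i)], which is the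
    matrix of the second order term of [local_loss]; it is centred when [mu] is the mean of
    [h_tau]. *)
Definition hessian_dev (mu : R) (e : nat -> R) (n : nat) : 'M[R]_r :=
  n%:R^-1 *: \sum_(i < n) (h_tau tau (e i) - mu) *: (X i *m (X i)^T).

(** Counts the observations whose residual may change sign under a perturbation of size [kap / s n],
    that is, those for which the quadratic expansion of [rho] may fail. *)
Definition small_error_freq (kap : R) (e : nat -> R) (n : nat) : R :=
  n%:R^-1 * \sum_(i < n) (`|e i| <= kap / s n)%R%:R.

(* The increment of the expectile loss at [beta0 + n^(-1/2) u]. *)
Definition local_loss (e : nat -> R) (n : nat) (u : 'cV[R]_r) : R :=
  \sum_(i < n) (rho tau (e i - dotv (X i) u / s n) - rho tau (e i)).

Lemma sqr_s n : s n ^+ 2 = n%:R. Proof. by rewrite sqr_sqrtr. Qed.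

Lemma dotv_weighted_gram (w : nat -> R) n (u : 'cV[R]_r) :
  dotv u ((n%:R^-1 *: \sum_(i < n) w i *: (X i *m (X i)^T)) *m u) =
  \sum_(i < n) w i * (dotv (X i) u / s n) ^+ 2.
Proof.
rewrite -scalemxAl dotvZr mulmx_suml dotv_sumr mulr_sumr.
apply: eq_bigr => i _; rewrite -scalemxAl dotvZr -mulmxA dotv_mulmx dotvE.
rewrite trmx_mul trmxK [X in _ * (_ * X)]mxE big_ord1 -!dotvE (dotvC u).
by rewrite exprMn exprVn sqr_s; ring.
Qed.

Lemma gramE n : gram X n = n%:R^-1 *: \sum_(i < n) 1 *: (X i *m (X i)^T).
Proof.
by rewrite /gram; congr (_ *: _); apply: eq_bigr => i _; rewrite scale1r.
Qed.

Let B : R := r%:R * C0.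

Lemma dotvX_le i u : `|dotv (X i) u| <= B * `|u|.
Proof. by rewrite (le_trans (dotv_le _ _))// ler_wpM2r// ler_wpM2l. Qed.

Let B_ge0 : 0 <= B. Proof. by rewrite mulr_ge0// ltW. Qed.

Lemma dotv_score (e : nat -> R) n (u : 'cV[R]_r) :
  \sum_(i < n) g_tau tau (e i) * (dotv (X i) u / s n) = dotv (score e n) u.
Proof.
rewrite /score dotvZl dotvC dotv_sumr mulr_sumr; apply: eq_bigr => i _.
by rewrite dotvZr (dotvC u); ring.
Qed.

Lemma local_loss_lower (c : R) e n u : c <= tau -> c <= 1 - tau ->
  dotv (score e n) u + c * dotv u (gram X n *m u) <= local_loss e n u.
Proof.
move=> ct c1t; rewrite gramE (dotv_weighted_gram (fun=> 1)).
rewrite -dotv_score mulr_sumr -big_split/=; apply: ler_sum => i _.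
by rewrite mul1r; exact: rho_lower.
Qed.

Lemma mean_le n (F : nat -> R) c : 0 <= c -> (forall i, F i <= c) ->
  n%:R^-1 * \sum_(i < n) F i <= c.
Proof.
move=> c0 Fc; have [->|n0] := posnP n; first by rewrite big_ord0 mulr0.
rewrite ler_pdivrMl ?ltr0n//.
rewrite (le_trans (_ : _ <= \sum_(i < n) c))//; first exact: ler_sum.
by rewrite sumr_const card_ord mulr_natl.
Qed.

(** Each of the [n] terms of the error carries two factors of order [n^(-1/2)], so that the bound
    does not depend on [n]. It measures the cost of replacing the estimate by its projection on the
    active groups. *)
Lemma local_loss_diff e n u u' :
  dotv (score e n) (u - u') - 2 * B ^+ 2 * `|u'| * `|u - u'|
    <= local_loss e n u - local_loss e n u'.
Proof.
rewrite /local_loss -sumrB.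
have -> : dotv (score e n) (u - u') =
    \sum_(i < n) g_tau tau (e i) * (dotv (X i) u / s n - dotv (X i) u' / s n).
  by rewrite -dotv_score; apply: eq_bigr => i _; rewrite dotvBr; ring.
rewrite lerBlDr -lerBlDl -sumrB.
rewrite (le_trans (_ : _ <= \sum_(i < n)
   2 * `|dotv (X i) u' / s n| * `|dotv (X i) u / s n - dotv (X i) u' / s n|))//.
  apply: ler_sum => i _; have := rho_diff_lower tau01 (e i) (dotv (X i) u / s n) (dotv (X i) u' / s n).
  by lra.
rewrite (eq_bigr (fun i : 'I_n => n%:R^-1 * (2 * `|dotv (X i) u'| * `|dotv (X i) (u - u')|))); last first.
  move=> i _; rewrite -mulrBl -dotvBr !normrM normfV (@ger0_norm _ (s n)) ?sqrtr_ge0// -(sqr_s n).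
  by rewrite -exprVn; ring.
rewrite -mulr_sumr (@mean_le n (fun i => 2 * `|dotv (X i) u'| * `|dotv (X i) (u - u')|))//.
  by rewrite !mulr_ge0 ?(ltW C0_gt0).
move=> i; rewrite [leRHS](_ : _ = 2 * (B * `|u'|) * (B * `|u - u'|)); last by ring.
by rewrite ler_pM ?mulr_ge0// ?ler_pM2l// dotvX_le.
Qed.

(** Two sources of error: the observations whose residual may change sign, all with an error of size
    at most [B * K / s n] because the shift of a residual is, and the replacement of
    [h_tau tau (e i)] by [mu] in the second order term. *)
Lemma local_loss_quadratic (mu K : R) e n u : `|u| <= K ->
  `|local_loss e n u - dotv (score e n) u - mu / 2 * dotv u (gram X n *m u)| <=
  (B * K) ^+ 2 * small_error_freq (B * K) e n
    + r%:R ^+ 2 * K ^+ 2 * `|hessian_dev mu e n|.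
Proof.
move=> uK; have K0 : 0 <= K by apply: le_trans uK.
have -> : local_loss e n u - dotv (score e n) u - mu / 2 * dotv u (gram X n *m u) =
  (\sum_(i < n) (rho tau (e i - dotv (X i) u / s n) - rho tau (e i)
     - g_tau tau (e i) * (dotv (X i) u / s n)
     - h_tau tau (e i) * (dotv (X i) u / s n) ^+ 2 / 2)) +
  dotv u (hessian_dev mu e n *m u) / 2.
  rewrite gramE (dotv_weighted_gram (fun=> 1)).
  rewrite (dotv_weighted_gram (fun i => h_tau tau (e i) - mu)).
  rewrite -dotv_score mulr_sumr mulr_suml /local_loss.
  rewrite -!sumrB -big_split/=; apply: eq_bigr => i _; ring.
rewrite (le_trans (ler_normD _ _))// lerD//; last first.
  rewrite normrM (@ger0_norm _ 2^-1)// ler_pdivrMr// (le_trans (dotv_le _ _))//.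
  rewrite (le_trans (_ : _ <= r%:R * K * (r%:R * `|hessian_dev mu e n| * K)))//.
    rewrite ler_pM ?mulr_ge0// ?ler_wpM2l//.
    by rewrite (le_trans (mx_normM _ _))// ler_wpM2l// mulr_ge0.
  rewrite [leLHS](_ : _ = r%:R ^+ 2 * K ^+ 2 * `|hessian_dev mu e n|); last by ring.
  by rewrite ler_peMr ?mulr_ge0 ?sqr_ge0// ler1n.
rewrite (le_trans (ler_norm_sum _ _ _))//.
rewrite /small_error_freq mulrCA mulr_sumr mulr_sumr; apply: ler_sum => i _.
rewrite (le_trans (rho_quadratic tau01 _ _))//.
rewrite exprMn exprVn sqr_s [leLHS](_ : _ = n%:R^-1 *
  (dotv (X i) u ^+ 2 * (`|e i| <= `|dotv (X i) u / s n|)%R%:R)); last by ring.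
have dBK : `|dotv (X i) u| <= B * K by rewrite (le_trans (dotvX_le _ _))// ler_wpM2l.
rewrite ler_wpM2l// ler_pM ?sqr_ge0//.
  by rewrite -real_normK ?num_real// ler_sqr ?nnegrE// mulr_ge0.
rewrite ler_nat; case: (boolP (`|e i| <= _)) => // h.
rewrite (_ : (`|e i| <= B * K / s n)%R = true)//; apply/idP/(le_trans h).
by rewrite normrM normfV (@ger0_norm _ (s n)) ?sqrtr_ge0// ler_wpM2r// invr_ge0 sqrtr_ge0.
Qed.

End local_expansion.

(** * Deterministic analysis of the estimates *)

Section lasso_comparison.
Context {R : realType} (p p0 : nat) (d : 'I_p -> nat).
Local Notation r := (\sum_(j < p) d j)%N.

(** Passage from extended to real numbers. Infinite weights are replaced by a finite lower bound [w]
    on the side of the estimate, and multiply vanishing groups on the side of the competitor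
    [b']. *)
Lemma lasso_estimate_le (tau gamma lam : R) (X : nat -> 'cV[R]_r) y n
    (w : R) (a : 'I_p -> R) (bt b b' : 'cV[R]_r) :
  0 < lam -> 0 <= w ->
  (forall j : 'I_p, (j < p0)%N -> adaptive_weight gamma bt j = (a j)%:E) ->
  (forall j : 'I_p, (p0 <= j)%N -> (w%:E <= adaptive_weight gamma bt j)%E) ->
  (forall j : 'I_p, (p0 <= j)%N -> submxcol b' j = 0) ->
  is_lasso_estimate tau gamma lam X y n bt b ->
  n%:R^-1 * expectile_loss tau X y n b +
    lam * (\sum_(j < p | (j < p0)%N) a j * norm2 (submxcol b j) +
           w * \sum_(j < p | (p0 <= j)%N) norm2 (submxcol b j)) <=
  n%:R^-1 * expectile_loss tau X y n b' +
    lam * \sum_(j < p | (j < p0)%N) a j * norm2 (submxcol b' j).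
Proof.
move=> lam0 w0 aE wE b'0 /(_ b'); rewrite /lasso_objective.
set S := (\sum_(j < p) (adaptive_weight gamma bt j * (norm2 (submxcol b j))%:E))%E.
set S' := (\sum_(j < p) (adaptive_weight gamma bt j * (norm2 (submxcol b' j))%:E))%E.
have -> : S' = (\sum_(j < p | (j < p0)%N) a j * norm2 (submxcol b' j))%:E.
  rewrite -sumEFin /S' (bigID (fun j : 'I_p => (j < p0)%N))/= [X in (_ + X)%E]big1.
    by rewrite adde0; apply: eq_bigr => j jp0; rewrite aE// EFinM.
  by move=> j; rewrite -leqNgt => jp0; rewrite b'0// norm20 mule0.
have : ((\sum_(j < p | (j < p0)%N) a j * norm2 (submxcol b j) +
         w * \sum_(j < p | (p0 <= j)%N) norm2 (submxcol b j))%:E <= S)%E.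
  rewrite EFinD mulr_sumr -!sumEFin /S [leRHS](bigID (fun j : 'I_p => (j < p0)%N))/=.
  apply: leeD.
    by apply: lee_sum => j jp0; rewrite aE// EFinM.
  rewrite [leRHS](eq_bigl (fun j : 'I_p => (p0 <= j)%N)); last by move=> j; rewrite -leqNgt.
  apply: lee_sum => j jp0; rewrite EFinM lee_wpmul2r ?lee_fin ?norm2_ge0//.
  exact: wE.
move=> SS obj; rewrite -lee_fin; apply: le_trans obj.
by rewrite EFinD leeD2l// EFinM lee_wpmul2l// lee_fin ltW.
Qed.

Lemma active_penalty_le (a : 'I_p -> R) (Om D : R) (b b' : 'cV[R]_r) : 0 <= Om -> 0 <= D ->
  (forall j : 'I_p, (j < p0)%N -> 0 <= a j <= Om) ->
  (forall j : 'I_p, norm2 (submxcol b' j) - norm2 (submxcol b j) <= D) ->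
  \sum_(j < p | (j < p0)%N) a j * norm2 (submxcol b' j) -
  \sum_(j < p | (j < p0)%N) a j * norm2 (submxcol b j) <= p%:R * (Om * D).
Proof.
move=> Om0 D0 aOm bD.
rewrite -sumrB (le_trans (_ : _ <= \sum_(j < p | (j < p0)%N) Om * D))//.
  apply: ler_sum => j jp0; have /andP[a0 aO] := aOm _ jp0.
  by rewrite -mulrBr (le_trans (ler_wpM2l a0 (bD j)))// ler_wpM2r.
rewrite sumr_const -[leLHS]mulr_natl ler_wpM2r ?mulr_ge0//.
by rewrite ler_nat (leq_trans (max_card _))// card_ord.
Qed.

End lasso_comparison.

(** * Support and first order expansion of the lasso estimate *)

Section sparsity_and_expansion.
Context {R : realType} (p p0 : nat) (hp : (p0 <= p)%N) (d : 'I_p -> nat).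
Local Notation r := (\sum_(j < p) d j)%N.
Local Notation r0 := (\sum_(j < p0) d (widen_ord hp j))%N.
Local Notation J := (@sel_mx R p p0 hp d).
Variables (X : nat -> 'cV[R]_r) (beta0 : 'cV[R]_r) (tau gamma C0 : R).
Variables (lam : nat -> R) (Upsilon : 'M[R]_r).
Hypotheses (hbeta0 : forall j : 'I_p, norm2 (submxcol beta0 j) != 0 <-> (j < p0)%N).
Hypotheses (tau01 : 0 < tau < 1) (gamma0 : 0 < gamma) (lam0 : forall n, 0 < lam n).
Hypotheses (C0_gt0 : 0 < C0) (XC0 : forall i, `|X i| <= C0).
Hypotheses (gram_cvg : gram X n @[n --> \oo] --> Upsilon) (Upd : posdef Upsilon).
Hypothesis lam_sqrt : Num.sqrt n%:R * lam n @[n --> \oo] --> (0 : R).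
Hypothesis lam_gamma : n%:R `^ ((gamma + 1) / 2) * lam n @[n --> \oo] --> +oo.

Let y (e : nat -> R) (i : nat) : R := dotv (X i) beta0 + e i.
Let s (n : nat) : R := Num.sqrt n%:R.
Let B : R := r%:R * C0.
Let c : R := Num.min tau (1 - tau).

Let c_gt0 : 0 < c.
Proof. by have /andP[t0 t1] := tau01; rewrite lt_min t0 subr_gt0. Qed.

Lemma expectile_lossE e n b : (0 < n)%N ->
  expectile_loss tau X (y e) n b =
  local_loss tau X e n (s n *: (b - beta0)) + \sum_(i < n) rho tau (e i).
Proof.
move=> n0; rewrite /local_loss -big_split/=; apply: eq_bigr => i _.
rewrite subrK dotvZr mulrC mulKf; last first.
  by rewrite /s gt_eqF// sqrtr_gt0 ltr0n.
by rewrite /y dotvBr; congr rho; ring.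
Qed.

Lemma submxcol_inactive (j : 'I_p) : (p0 <= j)%N -> submxcol beta0 j = 0.
Proof.
move=> jp0; apply: norm2_eq0; apply/eqP/negPn/negP => /hbeta0.
by rewrite ltnNge jp0.
Qed.

(** The factor [2] leaves room for the estimation error: a group within distance [b] of an active
    group of [beta0] still has norm at least [b]. *)
Lemma active_lower : exists2 b : R, 0 < b &
  forall j : 'I_p, (j < p0)%N -> 2 * b <= norm2 (submxcol beta0 j).
Proof.
(* The initial value [1] is the witness when there is no active group. *)
exists (\big[Num.min/1]_(j < p | (j < p0)%N) (norm2 (submxcol beta0 j) / 2)).
  apply/bigmin_gtP; split => // j /hbeta0 j0.
  by rewrite divr_gt0// lt_neqAle eq_sym j0 norm2_ge0.
move=> j jp0; rewrite -ler_pdivlMl// mulrC.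
exact: (bigmin_le_cond _ (fun j => norm2 (submxcol beta0 j) / 2)).
Qed.

(** Replacing [Upsilon] by the Gram matrix changes the form by at most [r ^ 2] times the norm of the
    difference of the matrices, times the square of the norm of [v]; half of [m] absorbs it for [n]
    large. *)
Lemma gram_coercive (m : R) : 0 < m ->
  (forall v : 'cV[R]_r, m * `|v| ^+ 2 <= dotv v (Upsilon *m v)) ->
  \forall n \near \oo, forall v : 'cV[R]_r,
    m / 2 * `|v| ^+ 2 <= dotv v (gram X n *m v).
Proof.
move=> m0 mU.
have e0 : 0 < m / 2 / (r%:R ^+ 2 + 1).
  by rewrite !divr_gt0// ltr_wpDl// sqr_ge0.
have /cvgrPdist_le/(_ _ e0) := gram_cvg.
apply: filterS => n; rewrite ler_pdivlMr ?ltr_wpDl ?sqr_ge0// => gU v.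
have : `|dotv v ((Upsilon - gram X n) *m v)| <= m / 2 * `|v| ^+ 2.
  rewrite (le_trans (dotv_le _ _))// (le_trans (_ : _ <= r%:R * `|v| *
      (r%:R * `|Upsilon - gram X n| * `|v|)))//.
    by rewrite ler_wpM2l ?mulr_ge0// mx_normM.
  rewrite [leLHS](_ : _ = `|Upsilon - gram X n| * r%:R ^+ 2 * `|v| ^+ 2); last by ring.
  rewrite ler_wpM2r ?sqr_ge0// (le_trans _ gU)//.
  by rewrite ler_wpM2l// lerDl.
rewrite mulmxBl dotvBr ler_norml => /andP[_].
by have := mU v; lra.
Qed.

Lemma le_div_of_quadratic (a b x : R) : 0 < a -> 0 <= b -> 0 <= x ->
  a * x ^+ 2 <= b * x -> x <= b / a.
Proof.
move=> a0 b0; rewrite le_eqVlt => /predU1P[<- _|x0].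
  by rewrite divr_ge0// ltW.
by rewrite expr2 mulrA ler_pM2r// ler_pdivlMr// mulrC.
Qed.

(** At the minimizer [local_loss] is at most [0], its value for [beta0], while strong convexity
    makes it at least a quadratic term with coefficient [c * m] minus a linear term with coefficient
    [r * K]. *)
Lemma expectile_estimate_bound (m K : R) e n bt : 0 < m -> 0 <= K -> (0 < n)%N ->
  (forall v : 'cV[R]_r, m * `|v| ^+ 2 <= dotv v (gram X n *m v)) ->
  is_expectile_estimate tau X (y e) n bt -> `|score tau X e n| <= K ->
  `|s n *: (bt - beta0)| <= r%:R * K / (c * m).
Proof.
move=> m0 K0 n0 mg /(_ beta0) bt_min DK.
move: bt_min; rewrite !expectile_lossE// lerD2r subrr scaler0.
set u := _ *: _.
have -> : local_loss tau X e n 0 = 0.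
  by rewrite /local_loss big1// => i _; rewrite dotv0r mul0r subr0 subrr.
move=> Lu; apply: le_div_of_quadratic; rewrite ?mulr_gt0 ?mulr_ge0//.
have := @local_loss_lower _ _ tau X tau01 c e n u.
rewrite ge_min lexx ge_min lexx orbT => /(_ isT isT) Ll.
have := le_trans Ll Lu.
have : `|dotv (score tau X e n) u| <= r%:R * K * `|u|.
  by rewrite (le_trans (dotv_le _ _))// ler_wpM2r// ler_wpM2l.
rewrite ler_norml => /andP[+ _].
have : c * (m * `|u| ^+ 2) <= c * dotv u (gram X n *m u) by rewrite ler_pM2l// mg.
by rewrite mulrA; lra.
Qed.

Lemma active_weight (b : R) (bt : 'cV[R]_r) (j : 'I_p) : 0 < b -> b <= norm2 (submxcol bt j) ->
  adaptive_weight gamma bt j = ((norm2 (submxcol bt j) `^ gamma)^-1)%:E /\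
  0 <= (norm2 (submxcol bt j) `^ gamma)^-1 <= (b `^ gamma)^-1.
Proof.
move=> b0 bj; have j0 := lt_le_trans b0 bj.
have pj : 0 < norm2 (submxcol bt j) `^ gamma by rewrite powR_gt0.
split; first by rewrite /adaptive_weight inver gt_eqF.
rewrite invr_ge0 (ltW pj) lef_pV2 ?posrE// ?powR_gt0//.
by rewrite ge0_ler_powR ?nnegrE ?norm2_ge0// ltW.
Qed.

Lemma inactive_weight (b : R) (bt : 'cV[R]_r) (j : 'I_p) : 0 < b -> norm2 (submxcol bt j) <= b ->
  (((b `^ gamma)^-1)%:E <= adaptive_weight gamma bt j)%E.
Proof.
move=> b0 bj; rewrite /adaptive_weight inver; case: eqP => [_|/eqP j0].
  by rewrite leey.
have pj : 0 < norm2 (submxcol bt j) `^ gamma by rewrite lt_neqAle eq_sym j0 powR_ge0.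
rewrite lee_fin lef_pV2 ?posrE// ?powR_gt0//.
by rewrite ge0_ler_powR ?nnegrE ?norm2_ge0// ltW.
Qed.

(* On the event where the score is bounded, a deterministic threshold on [n]
   makes the penalty kill every inactive group. *)
Lemma lasso_support (m K : R) : 0 < m -> 0 <= K ->
  (forall v : 'cV[R]_r, m * `|v| ^+ 2 <= dotv v (Upsilon *m v)) ->
  exists K2 Om : R, [/\ 0 <= K2, 0 <= Om & \forall n \near \oo,
    forall e bt bh, is_expectile_estimate tau X (y e) n bt ->
    is_lasso_estimate tau gamma (lam n) X (y e) n bt bh ->
    `|score tau X e n| <= K ->
    exists a : 'I_p -> R,
      [/\ forall j : 'I_p, (j < p0)%N -> 0 <= a j <= Om,
          `|s n *: (bh - beta0)| <= K2,
          J *m (J^T *m (bh - beta0)) = bh - beta0 &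
          forall b', (forall j : 'I_p, (p0 <= j)%N -> submxcol b' j = 0) ->
            n%:R^-1 * expectile_loss tau X (y e) n bh +
              lam n * \sum_(j < p | (j < p0)%N) a j * norm2 (submxcol bh j) <=
            n%:R^-1 * expectile_loss tau X (y e) n b' +
              lam n * \sum_(j < p | (j < p0)%N) a j * norm2 (submxcol b' j)]].
Proof.
move=> m0 K0 mU; have [b b0 bP] := active_lower.
pose cm := c * (m / 2); have cm0 : 0 < cm by rewrite mulr_gt0// divr_gt0.
(* [K1] bounds every group of the rescaled error of the expectile estimate; the [1] makes it
   positive, so that [K1 / s n] has a usable negative power. *)
pose K1 := r%:R * (r%:R * K / cm) + 1.
have K10 : 0 < K1 by rewrite ltr_wpDl// mulr_ge0// divr_ge0 ?mulr_ge0// ltW.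
pose Om := (b `^ gamma)^-1; have Om0 : 0 <= Om by rewrite invr_ge0 powR_ge0.
(* [K2] bounds the rescaled error of the lasso estimate: as soon as [s n * lam n <= 1], the active
   penalty adds a linear term with slope [p * r * Om] to that of the score. *)
pose K2 := (r%:R * K + p%:R * r%:R * Om) / cm.
have K20 : 0 <= K2 by rewrite divr_ge0 ?(ltW cm0)// addr_ge0 ?mulr_ge0.
(* [L] bounds the decrease of [local_loss] per unit length when one moves from a point of the ball
   of radius [K2], by [local_loss_diff]. *)
pose L := r%:R * K + 2 * B ^+ 2 * K2.
have L0 : 0 <= L.
  apply: addr_ge0; first by rewrite mulr_ge0.
  by apply: mulr_ge0 => //; apply: mulr_ge0 => //; exact: sqr_ge0.
exists K2, Om; split => //.
have Hs : \forall n \near \oo, K1 / b <= s n.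
  near=> n; rewrite -ler_sqr ?nnegrE ?sqrtr_ge0 ?divr_ge0 ?(ltW K10) ?(ltW b0)//.
  by rewrite sqr_sqrtr//; near: n; exact: nbhs_infty_ger.
have Hlam : \forall n \near \oo, s n * lam n <= 1.
  have /cvgrPdist_le/(_ _ ltr01) := lam_sqrt.
  by apply: filterS => n; rewrite sub0r normrN => /(le_trans (ler_norm _)).
have Hgam : \forall n \near \oo,
    L * K1 `^ gamma < n%:R `^ ((gamma + 1) / 2) * lam n.
  by move/cvgryPgt : lam_gamma; exact.
have Hcoer := gram_coercive m0 mU.
near=> n => e bt bh bt_est bh_est DK.
have n0 : (0 < n)%N by near: n; exact: nbhs_infty_gt.
have s0 : 0 < s n by rewrite sqrtr_gt0 ltr0n.
have ss : s n ^+ 2 = n%:R by rewrite sqr_sqrtr.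
have nR0 : 0 < n%:R :> R by rewrite ltr0n.
have gm : forall v : 'cV[R]_r, m / 2 * `|v| ^+ 2 <= dotv v (gram X n *m v).
  by near: n.
have m20 : 0 < m / 2 by rewrite divr_gt0.
have ut := expectile_estimate_bound m20 K0 n0 gm bt_est DK.
have bt_close j : norm2 (submxcol (bt - beta0) j) <= K1 / s n.
  rewrite ler_pdivlMr// -(ger0_norm (ltW s0)) mulrC -norm2Z -linearZ/=.
  rewrite (le_trans (norm2_submxcol_le _ _))// (@le_trans _ _ (r%:R * (r%:R * K / cm)))//.
    by rewrite ler_wpM2l.
  by rewrite lerDl.
have K1s : K1 / s n <= b.
  by rewrite ler_pdivrMr// mulrC -ler_pdivrMr//; near: n.
pose a j := (norm2 (submxcol bt j) `^ gamma)^-1.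
have act (j : 'I_p) : (j < p0)%N -> b <= norm2 (submxcol bt j).
  move=> jp0; have := norm2D (submxcol bt j) (- submxcol (bt - beta0) j).
  rewrite norm2N -linearB/= opprB addrC subrK.
  by have := bP _ jp0; have := bt_close j; have := K1s; lra.
pose w := ((K1 / s n) `^ gamma)^-1.
have w0 : 0 <= w by rewrite invr_ge0 powR_ge0.
have aOm (j : 'I_p) : (j < p0)%N -> 0 <= a j <= Om.
  by move=> /act jb; have [] := active_weight b0 jb.
have cmp b' := @lasso_estimate_le R p p0 d tau gamma (lam n) X (y e) n w a bt bh b'
  (lam0 n) w0 (fun j jp0 => (active_weight b0 (act j jp0)).1).
have {}cmp b' : (forall j : 'I_p, (p0 <= j)%N -> submxcol b' j = 0) ->
  n%:R^-1 * expectile_loss tau X (y e) n bh +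
    lam n * (\sum_(j < p | (j < p0)%N) a j * norm2 (submxcol bh j) +
           w * \sum_(j < p | (p0 <= j)%N) norm2 (submxcol bh j)) <=
  n%:R^-1 * expectile_loss tau X (y e) n b' +
    lam n * \sum_(j < p | (j < p0)%N) a j * norm2 (submxcol b' j).
  move=> b'0; apply: cmp => // j jp0; apply: inactive_weight.
    by rewrite divr_gt0.
  by have := bt_close j; rewrite submxcolB submxcol_inactive// subr0.
pose u := s n *: (bh - beta0).
have scaled b' : (forall j : 'I_p, (p0 <= j)%N -> submxcol b' j = 0) ->
  local_loss tau X e n u + n%:R * lam n *
     (\sum_(j < p | (j < p0)%N) a j * norm2 (submxcol bh j) +
           w * \sum_(j < p | (p0 <= j)%N) norm2 (submxcol bh j)) <=
  local_loss tau X e n (s n *: (b' - beta0)) + n%:R * lam n *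
     \sum_(j < p | (j < p0)%N) a j * norm2 (submxcol b' j).
  move=> /cmp; rewrite !expectile_lossE// -(ler_pM2l nR0) !mulrDr !mulrA.
  by rewrite mulfV ?gt_eqF// !mul1r; lra.
have bet j : norm2 (submxcol (bh - beta0) j) <= r%:R * `|u| / s n.
  rewrite ler_pdivlMr// -(ger0_norm (ltW s0)) mulrC -norm2Z -linearZ/=.
  exact: norm2_submxcol_le.
have uK2 : `|u| <= K2.
  apply: le_div_of_quadratic => //; first by rewrite addr_ge0 ?mulr_ge0.
  have := scaled beta0 submxcol_inactive.
  rewrite subrr scaler0.
  have -> : local_loss tau X e n 0 = 0.
    by rewrite /local_loss big1// => i _; rewrite dotv0r mul0r subr0 subrr.
  have : \sum_(j < p | (j < p0)%N) a j * norm2 (submxcol beta0 j) -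
     \sum_(j < p | (j < p0)%N) a j * norm2 (submxcol bh j) <=
     p%:R * (Om * (r%:R * `|u| / s n)).
    apply: active_penalty_le => // [|j]; first by rewrite divr_ge0 ?mulr_ge0// ltW.
    have := norm2D (submxcol bh j) (- submxcol (bh - beta0) j).
    by rewrite norm2N -linearB/= opprB addrC subrK; have := bet j; lra.
  have nl0 : 0 <= n%:R * lam n by rewrite mulr_ge0 ?(ltW nR0) ?(ltW (lam0 n)).
  move=> /(ler_wpM2l nl0).
  have -> : n%:R * lam n * (p%:R * (Om * (r%:R * `|u| / s n))) =
     (s n * lam n) * (p%:R * r%:R * Om * `|u|).
    by rewrite -ss; field; rewrite gt_eqF.
  have : (s n * lam n) * (p%:R * r%:R * Om * `|u|) <= 1 * (p%:R * r%:R * Om * `|u|).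
    by rewrite ler_wpM2r ?mulr_ge0//; near: n.
  have : 0 <= n%:R * lam n * (w * \sum_(j < p | (p0 <= j)%N) norm2 (submxcol bh j)).
    by rewrite !mulr_ge0// ?(ltW (lam0 n))//; apply: sumr_ge0 => j _; exact: norm2_ge0.
  have := @local_loss_lower _ _ tau X tau01 c e n u.
  rewrite ge_min lexx ge_min lexx orbT => /(_ isT isT).
  have : `|dotv (score tau X e n) u| <= r%:R * K * `|u|.
    by rewrite (le_trans (dotv_le _ _))// ler_wpM2r// ler_wpM2l.
  rewrite ler_norml => /andP[+ _].
  have : c * (m / 2 * `|u| ^+ 2) <= c * dotv u (gram X n *m u) by rewrite ler_pM2l// gm.
  rewrite /cm mulrBr mulrDr -[c * (m / 2) * _]mulrA; lra.
(* The competitor is the estimate with its inactive groups erased. The active penalties agree, the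
   loss can increase by at most [L * (s n * G)], and at least [n * lam n * w * G] of penalty is
   saved; for [n] large the saving is larger unless [G = 0]. *)
have supp : J *m (J^T *m (bh - beta0)) = bh - beta0.
  pose v := J *m (J^T *m (bh - beta0)).
  have vE j : submxcol (beta0 + v) j = if (j < p0)%N then submxcol bh j else 0.
    rewrite submxcolD submxcol_sel_proj; case: ifPn => [jp0|].
      by rewrite submxcolB addrC subrK.
    by rewrite -leqNgt => jp0; rewrite submxcol_inactive// addr0.
  have v0 : forall j : 'I_p, (p0 <= j)%N -> submxcol (beta0 + v) j = 0.
    by move=> j jp0; rewrite vE ltnNge jp0.
  pose G := \sum_(j < p | (p0 <= j)%N) norm2 (submxcol bh j).
  have G0 : 0 <= G by apply: sumr_ge0 => j _; exact: norm2_ge0.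
  have diffG : `|bh - beta0 - v| <= G.
    rewrite (le_trans (norm_le_sum_norm2 _))// /G [leRHS]big_mkcond/=.
    apply: ler_sum => j _; have -> : bh - beta0 - v = bh - (beta0 + v) by rewrite opprD addrA.
    by rewrite submxcolB vE; case: (ltnP j p0) => _; rewrite ?subrr ?norm20 ?subr0.
  suff G00 : G = 0.
    by have := diffG; rewrite G00 normr_le0 subr_eq0 => /eqP.
  have pen : \sum_(j < p | (j < p0)%N) a j * norm2 (submxcol (beta0 + v) j) =
      \sum_(j < p | (j < p0)%N) a j * norm2 (submxcol bh j).
    by apply: eq_bigr => j jp0; rewrite vE jp0.
  have := scaled _ v0; rewrite pen [beta0 + v]addrC addrK -/G mulrDr.
  set P := n%:R * lam n * \sum_(j < p | _) _ => comp.
  have := local_loss_diff tau01 C0_gt0 XC0 e n u (s n *: v); rewrite -scalerBr.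
  set dv := s n *: (bh - beta0 - v).
  have dvG : `|dv| <= s n * G by rewrite normrZ gtr0_norm// ler_pM2l.
  have svK : `|s n *: v| <= K2.
    rewrite (le_trans _ uK2)// /u !normrZ ler_wpM2l//.
    by rewrite (le_trans (norm_sel_mx _))// norm_tr_sel_mx.
  have : `|dotv (score tau X e n) dv| <= r%:R * K * `|dv|.
    by rewrite (le_trans (dotv_le _ _))// ler_wpM2r// ler_wpM2l.
  have : 2 * B ^+ 2 * `|s n *: v| * `|dv| <= 2 * B ^+ 2 * K2 * `|dv|.
    by rewrite ler_wpM2r// ler_wpM2l// mulr_ge0// sqr_ge0.
  have : L * `|dv| <= L * (s n * G).
    by apply: ler_wpM2l.
  rewrite ler_norml => H1 H2 /andP[H3 _] H4.
  have main : n%:R * lam n * (w * G) <= L * (s n * G).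
    by move: H1; rewrite /L; rewrite -/B in H4 *; lra.
  apply/eqP; rewrite eq_le G0 andbT leNgt; apply/negP => Gp.
  move: main; rewrite leNgt => /negP; apply.
  rewrite -ss (_ : _ * lam n * _ = s n * lam n * w * (s n * G)); last by ring.
  rewrite ltr_pM2r ?mulr_gt0//.
  (* The factor [s n] and the power [gamma] coming from [w] combine to [s n] to the power
     [gamma + 1], that is [n] to the power [(gamma + 1) / 2]: the growth condition on [lam] is
     applied to this quantity. *)
  rewrite /w powRM ?(ltW K10) ?invr_ge0 ?(ltW s0)// invfM.
  rewrite -powR_inv1 ?(ltW s0)// -powRrM mulN1r powRN invrK.
  rewrite mulrCA mulrC ltr_pdivlMr ?powR_gt0//.
  have -> : s n * lam n * s n `^ gamma = n%:R `^ ((gamma + 1) / 2) * lam n.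
    rewrite mulrAC -{1}(powRr1 (ltW s0)) -powRD; last by rewrite (gt_eqF s0) implybT.
    rewrite /s -powR12_sqrt// -powRrM; congr (_ `^ _ * _).
    by field.
  by near: n.
exists a; split => // b' /cmp; apply: le_trans.
rewrite lerD2l ler_wpM2l ?(ltW (lam0 n))// lerDl mulr_ge0//.
by apply: sumr_ge0 => j _; exact: norm2_ge0.
Unshelve. all: by end_near. Qed.

(** The minimizer [x] of the limiting quadratic function, whose linear part is
    [dotv (score tau X e n) (J *m x)] and whose matrix is [mu] times the active block of
    [Upsilon]. *)
Definition leading_term (mu : R) (e : nat -> R) (n : nat) : 'cV[R]_r0 :=
  - (mu^-1 *: (invmx (J^T *m Upsilon *m J) *m (J^T *m score tau X e n))).

Lemma posdef_sel : posdef (J^T *m Upsilon *m J).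
Proof.
have [Ut Up] := Upd; split=> [|v v0]; first by rewrite !trmx_mul trmxK Ut mulmxA.
rewrite -!mulmxA dotv_mulmx trmxK; apply: Up; apply: contra v0 => /eqP Jv0.
by rewrite -[v]mul1mx -(@tr_sel_mxK R p p0 hp d) -mulmxA Jv0 mulmx0.
Qed.

Lemma dotv_sel (S : 'M[R]_r) (v w : 'cV[R]_r0) :
  dotv (J *m v) (S *m (J *m w)) = dotv v (J^T *m S *m J *m w).
Proof. by rewrite [RHS]dotvC -!mulmxA [RHS]dotvC [RHS]dotv_mulmx trmxK. Qed.

(** Both the rescaled estimate and the leading term lie in a ball whose radius [K4] depends on [K]
    but neither on [n] nor on [e]. The quadratic approximation is uniform on this ball, so that
    [kap] and [eta] can be fixed before the rank. *)
Lemma lasso_expansion (mu K delta : R) : 0 < mu -> 0 <= K -> 0 < delta ->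
  exists kap eta : R, [/\ 0 <= kap, 0 < eta & \forall n \near \oo,
    forall e bt bh, is_expectile_estimate tau X (y e) n bt ->
    is_lasso_estimate tau gamma (lam n) X (y e) n bt bh ->
    `|score tau X e n| <= K ->
    small_error_freq kap e n <= eta -> `|hessian_dev tau X mu e n| <= eta ->
    `|s n *: (J^T *m (bh - beta0)) - leading_term mu e n| <= delta].
Proof.
move=> mu0 K0 delta0; have [m m0 mU] := posdef_coercive Upd.
have [K2 [Om [K20 Om0 supp]]] := lasso_support m0 K0 mU.
pose UA := J^T *m Upsilon *m J; have UAu : UA \in unitmx := posdef_unitmx posdef_sel.
pose K3 := mu^-1 * (r0%:R * `|invmx UA| * K).
have K30 : 0 <= K3 by rewrite mulr_ge0 ?invr_ge0 ?(ltW mu0)// !mulr_ge0.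
pose K4 := K2 + K3; have K40 : 0 <= K4 by rewrite addr_ge0.
pose Q := (B * K4) ^+ 2 + r%:R ^+ 2 * K4 ^+ 2 + 1.
have Q0 : 0 < Q by rewrite ltr_wpDl// addr_ge0 ?sqr_ge0// mulr_ge0 ?sqr_ge0.
(* At distance [delta] from its minimizer the quadratic function exceeds its minimum by at least
   [tol]. One quarter of [tol] is allotted to the approximation error at each of the two points, and
   one to the penalty. *)
pose tol := mu / 2 * m * delta ^+ 2.
have tol0 : 0 < tol by rewrite !mulr_gt0 ?exprn_gt0// invr_gt0.
pose eta := tol / 8 / Q; have eta0 : 0 < eta by rewrite !divr_gt0.
have B0 : 0 <= B by rewrite mulr_ge0// ltW.
exists (B * K4), eta; split => //; first by rewrite mulr_ge0.
pose W := mu * (r%:R ^+ 2 * K4 ^+ 2) + 1.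
have W0 : 0 < W by rewrite ltr_wpDl// !mulr_ge0 ?sqr_ge0// ltW.
have Hg : \forall n \near \oo, `|Upsilon - gram X n| <= tol / 8 / W.
  by move/cvgrPdist_le : gram_cvg; apply; rewrite !divr_gt0.
pose V := p%:R * (Om * (r%:R * (2 * K4))) + 1.
have V0 : 0 < V by rewrite ltr_wpDl// !mulr_ge0.
have Hl : \forall n \near \oo, s n * lam n <= tol / 4 / V.
  have t0 : 0 < tol / 4 / V by rewrite !divr_gt0.
  have /cvgrPdist_le/(_ _ t0) := lam_sqrt.
  by apply: filterS => n; rewrite sub0r normrN => /(le_trans (ler_norm _)).
near=> n => e bt bh bt_est bh_est DK small dev.
have n0 : (0 < n)%N by near: n; exact: nbhs_infty_gt.
have s0 : 0 < s n by rewrite sqrtr_gt0 ltr0n.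
have ss : s n ^+ 2 = n%:R by rewrite sqr_sqrtr.
have nR0 : 0 < n%:R :> R by rewrite ltr0n.
have : forall e bt bh, is_expectile_estimate tau X (y e) n bt ->
    is_lasso_estimate tau gamma (lam n) X (y e) n bt bh ->
    `|score tau X e n| <= K ->
    exists a : 'I_p -> R,
      [/\ forall j : 'I_p, (j < p0)%N -> 0 <= a j <= Om,
          `|s n *: (bh - beta0)| <= K2,
          J *m (J^T *m (bh - beta0)) = bh - beta0 &
          forall b', (forall j : 'I_p, (p0 <= j)%N -> submxcol b' j = 0) ->
            n%:R^-1 * expectile_loss tau X (y e) n bh +
              lam n * \sum_(j < p | (j < p0)%N) a j * norm2 (submxcol bh j) <=
            n%:R^-1 * expectile_loss tau X (y e) n b' +
              lam n * \sum_(j < p | (j < p0)%N) a j * norm2 (submxcol b' j)].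
  by near: n.
move=> /(_ e bt bh bt_est bh_est DK) [a [aOm uK2 hsupp cmp]].
set D := score tau X e n in DK *; set v := s n *: (J^T *m (bh - beta0)).
set z := leading_term mu e n.
have zK : `|z| <= K4.
  rewrite /z /leading_term normrN normrZ gtr0_norm ?invr_gt0//.
  rewrite (le_trans (_ : _ <= K3))// ?lerDr// ler_wpM2l ?invr_ge0 ?(ltW mu0)//.
  rewrite (le_trans (mx_normM _ _))// ler_wpM2l ?mulr_ge0//.
  by rewrite (le_trans (norm_tr_sel_mx _ _)).
have uE : s n *: (bh - beta0) = J *m v by rewrite -scalemxAr hsupp.
have vK : `|v| <= K4.
  rewrite (le_trans _ (_ : K2 <= K4)) ?lerDl// (le_trans _ uK2)//.
  by rewrite /v scalemxAr norm_tr_sel_mx.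
have JK (x : 'cV[R]_r0) : `|x| <= K4 -> `|J *m x| <= K4.
  by apply: le_trans; exact: norm_sel_mx.
have quad (x : 'cV[R]_r0) : `|x| <= K4 ->
    `|local_loss tau X e n (J *m x) - dotv D (J *m x)
      - mu / 2 * dotv x (UA *m x)| <= tol / 4.
  move=> xK; have := local_loss_quadratic tau01 C0_gt0 XC0 mu e n (JK _ xK).
  rewrite -/B -/D -dotv_sel.
  have : (B * K4) ^+ 2 * small_error_freq (B * K4) e n
     + r%:R ^+ 2 * K4 ^+ 2 * `|hessian_dev tau X mu e n| <= tol / 8.
    rewrite (le_trans (_ : _ <= Q * eta))//; last by rewrite mulrC divfK ?gt_eqF.
    rewrite /Q !mulrDl mul1r ler_wpDr ?(ltW eta0)// lerD//.
      by rewrite ler_wpM2l// sqr_ge0.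
    by rewrite ler_wpM2l// mulr_ge0 ?sqr_ge0.
  have : `|dotv (J *m x) ((Upsilon - gram X n) *m (J *m x))| <=
      r%:R ^+ 2 * K4 ^+ 2 * `|Upsilon - gram X n|.
    rewrite (le_trans (dotv_le _ _))//.
    rewrite (_ : _ * K4 ^+ 2 * _ =
      r%:R * K4 * (r%:R * `|Upsilon - gram X n| * K4)); last by ring.
    rewrite ler_pM ?mulr_ge0// ?ler_wpM2l ?JK// (le_trans (mx_normM _ _))//.
    by rewrite ler_wpM2l ?mulr_ge0// JK.
  have : mu * (r%:R ^+ 2 * K4 ^+ 2 * `|Upsilon - gram X n|) <= tol / 8.
    rewrite mulrA (le_trans (_ : _ <= W * `|Upsilon - gram X n|))//.
      by rewrite ler_wpM2r// lerDl.
    by rewrite mulrC -ler_pdivlMr//; near: n.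
  rewrite mulmxBl dotvBr.
  set F1 := dotv _ (Upsilon *m _); set F2 := dotv _ (gram X n *m _) => h1 h2 h3 h4.
  have h5 : `|mu / 2 * (F1 - F2)| <= tol / 16.
    rewrite normrM (ger0_norm (ltW (divr_gt0 mu0 _)))//.
    have := ler_wpM2l (ltW (divr_gt0 mu0 (@ltr0Sn R 1))) h2; lra.
  move: h4 h5; rewrite !ler_norml => /andP[? ?] /andP[? ?].
  by apply/andP; split; lra.
have loss_le : local_loss tau X e n (J *m v) <=
    local_loss tau X e n (J *m z) + tol / 4.
  (* The leading term brought back to the original scale. Its inactive groups vanish, so that only
     the bounded active weights are involved in the comparison. *)
  pose b' := beta0 + J *m ((s n)^-1 *: z).
  have b'0 (j : 'I_p) : (p0 <= j)%N -> submxcol b' j = 0.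
    move=> jp0; rewrite /b' submxcolD submxcol_inactive// add0r.
    rewrite -[_ *: z]mul1mx -(@tr_sel_mxK R p p0 hp d) -mulmxA submxcol_sel_proj.
    by rewrite ltnNge jp0.
  have bE : s n *: (b' - beta0) = J *m z.
    by rewrite /b' addrAC subrr add0r scalemxAr scalerA mulfV ?gt_eqF// scale1r.
  have := cmp _ b'0; rewrite !expectile_lossE// -(ler_pM2l nR0) !mulrDr !mulrA.
  rewrite mulfV ?gt_eqF// !mul1r uE bE.
  have diff (j : 'I_p) : norm2 (submxcol b' j) - norm2 (submxcol bh j) <= r%:R * (2 * K4) / s n.
    have := norm2D (submxcol bh j) (submxcol (b' - bh) j).
    rewrite -submxcolD subrKC => tri.
    rewrite (le_trans (_ : _ <= norm2 (submxcol (b' - bh) j)))//; first by lra.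
    rewrite ler_pdivlMr// -(ger0_norm (ltW s0)) mulrC -norm2Z -linearZ/=.
    have -> : s n *: (b' - bh) = J *m z - J *m v.
      by rewrite -bE -uE -scalerBr opprB addrA subrK.
    rewrite (le_trans (norm2_submxcol_le _ _))// ler_wpM2l//.
    by rewrite (le_trans (ler_normB _ _))// mulrDl !mul1r lerD// JK.
  have : \sum_(j < p | (j < p0)%N) a j * norm2 (submxcol b' j) -
     \sum_(j < p | (j < p0)%N) a j * norm2 (submxcol bh j) <=
     p%:R * (Om * (r%:R * (2 * K4) / s n)).
    by apply: active_penalty_le => //; rewrite divr_ge0 ?mulr_ge0// ltW.
  have nl0 : 0 <= n%:R * lam n by rewrite mulr_ge0 ?(ltW nR0) ?(ltW (lam0 n)).
  move=> /(ler_wpM2l nl0).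
  have -> : n%:R * lam n * (p%:R * (Om * (r%:R * (2 * K4) / s n))) =
     (s n * lam n) * (p%:R * (Om * (r%:R * (2 * K4)))).
    by rewrite -ss; field; rewrite gt_eqF.
  have : (s n * lam n) * (p%:R * (Om * (r%:R * (2 * K4)))) <= tol / 4.
    rewrite (le_trans (_ : _ <= s n * lam n * V))//.
      by rewrite ler_wpM2l ?lerDl// mulr_ge0 ?(ltW s0) ?(ltW (lam0 n)).
    by rewrite -ler_pdivlMr//; near: n.
  by rewrite mulrBr; lra.
have grad : mu *: (UA *m z) = - (J^T *m D).
  by rewrite /z /leading_term mulmxN scalerN -scalemxAr mulKVmx// scalerA mulfV ?gt_eqF// scale1r.
(* By [grad], [z] is a critical point of the quadratic function, hence the excess over its value at
   [z] is a pure quadratic form in [v - z]. *)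
have Qdiff : mu / 2 * dotv (v - z) (UA *m (v - z)) =
  (dotv D (J *m v) + mu / 2 * dotv v (UA *m v)) -
  (dotv D (J *m z) + mu / 2 * dotv z (UA *m z)).
  have UAt : UA^T = UA by case: posdef_sel.
  have DJ (x : 'cV[R]_r0) : dotv D (J *m x) = - mu * dotv x (UA *m z).
    by rewrite dotv_mulmx dotvC mulNr -dotvZr grad dotvNr opprK.
  rewrite !DJ mulmxBr dotvBr !dotvBl.
  have -> : dotv z (UA *m v) = dotv v (UA *m z) by rewrite dotv_mulmx UAt dotvC.
  by field.
have coer : m * `|v - z| ^+ 2 <= dotv (v - z) (UA *m (v - z)).
  rewrite /UA -dotv_sel; apply: le_trans (mU _).
  rewrite ler_pM2l// ler_sqr ?nnegrE//.
  rewrite -[X in `|X| <= _]mul1mx -(@tr_sel_mxK R p p0 hp d) -mulmxA.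
  exact: norm_tr_sel_mx.
rewrite -ler_sqr ?nnegrE ?(ltW delta0)//.
have mu2 : 0 < mu / 2 by rewrite divr_gt0.
rewrite -(ler_pM2l (mulr_gt0 mu2 m0)) -/tol -mulrA.
rewrite (le_trans (ler_wpM2l (ltW mu2) coer))// Qdiff.
have := quad _ vK; have := quad _ zK.
by rewrite !ler_norml => /andP[? ?] /andP[? ?]; lra.
Unshelve. all: by end_near. Qed.

End sparsity_and_expansion.

(** * Averaging operators and independence *)

Section bounded_integrals.
Context d (T : measurableType d) {R : realType} (P : probability T R).
Implicit Types (f g : T -> R).

Lemma bounded_integrable f (C : R) : measurable_fun setT f ->
  (forall w, `|f w| <= C) -> P.-integrable setT (EFin \o f).
Proof.
move=> mf fC; apply: (@le_integrable _ _ _ P setT measurableT _ (EFin \o cst C)).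
- exact/measurable_EFinP.
- by move=> w _ /=; rewrite lee_fin (le_trans (fC w))// ler_norm.
- exact: finite_measure_integrable_cst.
Qed.

Lemma Rintegral_prob_cst (c : R) : \int[P]_w c = c.
Proof. by rewrite Rintegral_cst//= probability_setT mulr1. Qed.

Lemma Rintegral_le_cst f (C : R) : P.-integrable setT (EFin \o f) ->
  (forall w, `|f w| <= C) -> `|\int[P]_w f w| <= C.
Proof.
move=> fi fC; rewrite (le_trans (le_normr_Rintegral _ fi))//.
rewrite -[leRHS]Rintegral_prob_cst; apply: le_Rintegral => //.
- exact: (integrable_norm fi).
- exact: finite_measure_integrable_cst.
Qed.

Lemma Rintegrable_add f g : P.-integrable setT (EFin \o f) ->
  P.-integrable setT (EFin \o g) ->
  P.-integrable setT (EFin \o (fun w => f w + g w)).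
Proof.
move=> fi gi.
by apply: (@eq_integrable _ _ _ P setT measurableT ((EFin \o f) \+ (EFin \o g))%E) => //; exact: integrableD.
Qed.

Lemma Rintegrable_scale (a : R) f : P.-integrable setT (EFin \o f) ->
  P.-integrable setT (EFin \o (fun w => a * f w)).
Proof.
move=> fi; apply: (@eq_integrable _ _ _ P setT measurableT (fun w => a%:E * (EFin \o f) w)%E) => //.
exact: integrableZl.
Qed.

Lemma Rintegrable_sub f g : P.-integrable setT (EFin \o f) ->
  P.-integrable setT (EFin \o g) ->
  P.-integrable setT (EFin \o (fun w => f w - g w)).
Proof.
move=> fi gi; have := Rintegrable_add fi (Rintegrable_scale (-1) gi).
by apply: eq_integrable => // w _; rewrite /= mulN1r.
Qed.

Lemma Rintegrable_sum (I : Type) (s : seq I) (F : I -> T -> R) :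
  (forall i, P.-integrable setT (EFin \o F i)) ->
  P.-integrable setT (EFin \o (fun w => \sum_(i <- s) F i w)).
Proof.
move=> Fi; have -> : EFin \o (fun w => \sum_(j <- s) F j w) =
    (fun w => (\sum_(j <- s) (EFin \o F j) w)%E).
  by apply/funext => w; rewrite /= sumEFin.
exact: integrable_sum.
Qed.

Lemma Rintegral_sum (I : Type) (s : seq I) (F : I -> T -> R) :
  (forall i, P.-integrable setT (EFin \o F i)) ->
  \int[P]_w (\sum_(i <- s) F i w) = \sum_(i <- s) \int[P]_w F i w.
Proof.
move=> Fi; elim: s => [|i s ih].
  by under eq_Rintegral do rewrite big_nil; rewrite big_nil Rintegral_prob_cst.
under eq_Rintegral do rewrite big_cons; rewrite big_cons -ih RintegralD//.
exact: Rintegrable_sum.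
Qed.

End bounded_integrals.

Section bounded_fubini.
Context d1 d2 (T1 : measurableType d1) (T2 : measurableType d2) {R : realType}.

Lemma measurable_Rfubini (P2 : probability T2 R) (F : T1 * T2 -> R) (C : R) :
  measurable_fun setT F -> (forall z, `|F z| <= C) ->
  measurable_fun setT (fun x => \int[P2]_y F (x, y)).
Proof.
move=> mF FC.
(* Adding [C] makes the integrand nonnegative, and Tonelli's theorem then gives the measurability of
   the partial integral. *)
have -> : (fun x => \int[P2]_y F (x, y)) = (fun x => \int[P2]_y (F (x, y) + C) - C).
  apply/funext => x; rewrite RintegralD//; last 2 first.
  - apply: (@bounded_integrable _ _ _ _ _ C) => //.
    exact: (@measurable_fun_pair2 _ _ _ _ _ _ F x).
  - exact: finite_measure_integrable_cst.
  by rewrite Rintegral_prob_cst addrK.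
apply: measurable_funB => //.
apply: (@measurableT_comp _ _ _ _ _ _ fine) => //.
apply: (measurable_fun_fubini_tonelli_F (m2 := P2) (fun z => (F z + C)%:E)) => //.
  exact/measurable_EFinP/measurable_funD.
by move=> z; rewrite lee_fin; have := FC z; rewrite ler_norml => /andP[+ _]; lra.
Qed.

Variables (P1 : probability T1 R) (P2 : probability T2 R).

Lemma Rintegral12_prod (F : T1 * T2 -> R) :
  (P1 \x P2)%E.-integrable setT (EFin \o F) ->
  (forall x, P2.-integrable setT (EFin \o (fun y => F (x, y)))) ->
  \int[(P1 \x P2)%E]_z F z = \int[P1]_x \int[P2]_y F (x, y).
Proof.
move=> Fi F2; rewrite /Rintegral -(integral12_prod_meas1 Fi).
congr fine; apply: eq_integral => x _; rewrite /fubini_F fineK//.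
exact: (integrable_fin_num _ (F2 x)).
Qed.

Lemma Rintegral21_prod (F : T1 * T2 -> R) :
  (P1 \x P2)%E.-integrable setT (EFin \o F) ->
  (forall y, P1.-integrable setT (EFin \o (fun x => F (x, y)))) ->
  \int[(P1 \x P2)%E]_z F z = \int[P2]_y \int[P1]_x F (x, y).
Proof.
move=> Fi F1; rewrite /Rintegral -(integral21_prod_meas1 Fi).
congr fine; apply: eq_integral => y _; rewrite /fubini_G fineK//.
exact: (integrable_fin_num _ (F1 y)).
Qed.

End bounded_fubini.

Section averaging.
Context {R : realType} (k : nat).
Implicit Types (f g : 'cV[R]_k -> R).

(* ['cV[R]_k] carries no sigma-algebra here: measurability of a function of a
   vector is tested on random vectors. *)
Definition cmeas f : Prop :=
  forall d (T : measurableType d) (Z : T -> 'cV[R]_k),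
    random_vector Z -> measurable_fun setT (f \o Z).

Definition bounded_by (C : R) f : Prop := forall x, `|f x| <= C.

Definition avg (mu : probability R R) (u : 'cV[R]_k) f (x : 'cV[R]_k) : R :=
  \int[mu]_t f (x + t *: u).

Lemma random_vector_line d (T : measurableType d) (Z : T -> 'cV[R]_k) (X : T -> R) u :
  random_vector Z -> measurable_fun setT X ->
  random_vector (fun w => Z w + X w *: u).
Proof.
move=> mZ mX i; apply: (eq_measurable_fun (fun w => Z w i ord0 + X w * u i ord0)).
  by move=> w _; rewrite !mxE.
by apply: measurable_funD => //; apply: measurable_funM.
Qed.

Lemma random_vector_cst d (T : measurableType d) (x : 'cV[R]_k) :
  random_vector (fun _ : T => x).
Proof. by move=> i; exact: measurable_cst. Qed.

Lemma random_vector_sum d (T : measurableType d) (I : Type) (s : seq I)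
    (X : I -> T -> R) (u : I -> 'cV[R]_k) (x : 'cV[R]_k) :
  (forall i, measurable_fun setT (X i)) ->
  random_vector (fun w => x + \sum_(i <- s) X i w *: u i).
Proof.
move=> mX; elim: s => [|i s ih].
  by move=> j; under eq_fun do rewrite big_nil addr0; exact: measurable_cst.
have := random_vector_line (u i) ih (mX i); congr random_vector.
by apply/funext => w; rewrite big_cons -addrA [X in _ + X]addrC.
Qed.

Lemma line_measurable f x u : cmeas f -> measurable_fun setT (fun t : R => f (x + t *: u)).
Proof.
move=> mf; apply: (mf _ R (fun t => x + t *: u)).
exact: (@random_vector_line _ R (fun=> x) id u (random_vector_cst x)).
Qed.

Lemma line_integrable (mu : probability R R) C f x u : cmeas f -> bounded_by C f ->
  mu.-integrable setT (EFin \o (fun t => f (x + t *: u))).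
Proof.
move=> mf fC; apply: bounded_integrable; [exact: line_measurable|].
by move=> t; exact: fC.
Qed.

Lemma avg_bounded mu u C f : cmeas f -> bounded_by C f -> bounded_by C (avg mu u f).
Proof.
move=> mf fC x; apply: Rintegral_le_cst => [|t]; last exact: fC.
exact: line_integrable mf fC.
Qed.

Lemma avg_cmeas mu u C f : cmeas f -> bounded_by C f -> cmeas (avg mu u f).
Proof.
move=> mf fC d T Z mZ.
apply: (@measurable_Rfubini _ _ T R R mu (fun z => f (Z z.1 + z.2 *: u)) C) => //.
apply: (mf _ (T * R)%type (fun z => Z z.1 + z.2 *: u)).
apply: random_vector_line => // i.
exact: (@measurableT_comp _ _ _ _ _ _ (fun w => Z w i ord0)).
Qed.

Lemma avgC mu nu u v C f : cmeas f -> bounded_by C f ->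
  avg mu u (avg nu v f) = avg nu v (avg mu u f).
Proof.
move=> mf fC; apply/funext => x.
pose F (z : R * R) := f (x + z.1 *: u + z.2 *: v).
have mF : measurable_fun setT F.
  apply: (mf _ (R * R)%type (fun z => x + z.1 *: u + z.2 *: v)).
  apply: (@random_vector_line _ _ (fun z : R * R => x + z.1 *: u) snd) => //.
  exact: (@random_vector_line _ _ (fun=> x) fst u (random_vector_cst x)).
have Fi := bounded_integrable (mu \x nu)%E mF (fun z => fC _).
have F2 s : nu.-integrable setT (EFin \o (fun t => F (s, t))).
  exact: (line_integrable nu (x + s *: u) v mf fC).
have FE s t : F (s, t) = f ((x + t *: v) + s *: u) by rewrite /F/= addrAC.
have F1 t : mu.-integrable setT (EFin \o (fun s => F (s, t))).
  have -> : (fun s => F (s, t)) = (fun s => f ((x + t *: v) + s *: u)).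
    by apply/funext => s; rewrite FE.
  exact: (line_integrable mu (x + t *: v) u mf fC).
transitivity (\int[(mu \x nu)%E]_z F z); first by rewrite (Rintegral12_prod Fi F2).
rewrite (Rintegral21_prod Fi F1); apply: eq_Rintegral => t _.
by apply: eq_Rintegral => s _; rewrite FE.
Qed.

Lemma avg_le mu u C e f g : cmeas f -> cmeas g -> bounded_by C f -> bounded_by C g ->
  (forall x, `|f x - g x| <= e) -> forall x, `|avg mu u f x - avg mu u g x| <= e.
Proof.
move=> mf mg fC gC fg x.
have fi := line_integrable mu x u mf fC; have gi := line_integrable mu x u mg gC.
rewrite -RintegralB//; apply: Rintegral_le_cst => [|t]; last exact: fg.
apply: (@bounded_integrable _ _ _ _ _ (C + C)) => [|t].
  by apply: measurable_funB; exact: line_measurable.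
by rewrite (le_trans (ler_normB _ _))// lerD// ?fC ?gC.
Qed.

End averaging.

Section independent_pair.
Context d d' (T : measurableType d) (T' : measurableType d') {R : realType}.
Variables (P : probability T R) (phi : {mfun T >-> T'}) (X : {RV P >-> R}).
Hypothesis indep : forall B A, measurable B -> measurable A ->
  P (phi @^-1` B `&` X @^-1` A) = (P (phi @^-1` B) * P (X @^-1` A))%E.

Lemma joint_measurable : measurable_fun setT (fun w => (phi w, X w)).
Proof. by apply: measurable_fun_pair. Qed.

Definition joint_mfun : {mfun T >-> (T' * R)%type} :=
  HB.pack (fun w => (phi w, X w)) (isMeasurableFun.Build _ _ _ _ _ joint_measurable).

Lemma joint_distribution (A : set (T' * R)) : measurable A ->
  distribution P joint_mfun A = (distribution P phi \x distribution P X)%E A.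
Proof.
by move=> mA; apply/esym; apply: product_measure_unique => // B A' mB mA'.
Qed.

(** The pair has the product law, and Fubini's theorem integrates out [X] first. The target space of
    [phi] is arbitrary, so that [phi] may be the identity of [T] with values in the same set with a
    smaller sigma-algebra. *)
Lemma Rintegral_joint (F : T' * R -> R) (C : R) : measurable_fun setT F ->
  (forall z, `|F z| <= C) ->
  \int[P]_w F (phi w, X w) = \int[P]_w \int[distribution P X]_t F (phi w, t).
Proof.
move=> mF FC.
have mF2 y : measurable_fun setT (fun t => F (y, t)).
  exact: (@measurable_fun_pair2 _ _ _ _ _ _ F y).
transitivity (\int[distribution P joint_mfun]_z F z).
  rewrite /Rintegral; congr fine; rewrite integral_distribution//.
  - exact/measurable_EFinP.
  - apply: (@bounded_integrable _ _ _ _ (F \o joint_mfun) C) => [|w]; last exact: FC.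
    exact: measurableT_comp.
transitivity (\int[(distribution P phi \x distribution P X)%E]_z F z).
  congr fine; apply: eq_measure_integral => A mA _; exact: joint_distribution.
rewrite Rintegral12_prod; last 2 first.
- exact: bounded_integrable mF FC.
- by move=> y; apply: bounded_integrable (mF2 y) _ => t; exact: FC.
rewrite /Rintegral integral_distribution//.
- by apply/measurable_EFinP; exact: measurable_Rfubini mF FC.
- apply: (@bounded_integrable _ _ _ _ _ C).
    apply: (@measurableT_comp _ _ _ _ _ _
      (fun y => \int[distribution P X]_t F (y, t))) => //.
    exact: measurable_Rfubini mF FC.
  move=> w; apply: Rintegral_le_cst; last by move=> t; exact: FC.
  by apply: bounded_integrable (mF2 _) _ => t; exact: FC.
Qed.

End independent_pair.

(** * Independence from the sigma-algebra of finitely many variables *)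

Section independence.
Context d (T : measurableType d) {R : realType} (P : probability T R).
Context (I : choiceType) (X : I -> {RV P >-> R}).
Hypothesis indX : mutually_independent X.

(** A pi-system generating the sigma-algebra of the variables indexed by [s], on which mutual
    independence gives the product formula. *)
Let rect (s : seq I) : set (set T) := [set B | exists2 A : I -> set R,
  (forall j, measurable (A j)) & B = \bigcap_(j in [set` s]) (X j @^-1` A j)].

Let rectI s : setI_closed (rect s).
Proof.
move=> _ _ [A mA ->] [B mB ->]; exists (fun j => A j `&` B j).
  by move=> j; exact: measurableI.
by rewrite -bigcapI; apply: eq_bigcapr => j _; rewrite preimage_setI.
Qed.

Let rect_measurable s : rect s `<=` measurable.
Proof.
move=> _ [A mA ->]; apply: fin_bigcap_measurable => [|j _]; first exact: finite_seq.
by rewrite -[_ @^-1` _]setTI; exact: measurable_funP.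
Qed.

Let sigma_sub s : <<s rect s >> `<=` (measurable : set (set T)).
Proof.
by apply: smallest_sub; [exact: sigma_algebra_measurable|exact: rect_measurable].
Qed.

Let rect_setT s : rect s setT.
Proof.
by exists (fun=> setT) => //; apply/esym; rewrite bigcapT// => j _.
Qed.

(** Both sides are finite measures in [B]: the restriction of [P] to the event on [X i], and a
    multiple of [P]. They agree on the pi-system [rect s], hence on the sigma-algebra that it
    generates. *)
Lemma independent_sigma s i B A : i \notin s -> <<s rect s >> B -> measurable A ->
  P (B `&` X i @^-1` A) = (P B * P (X i @^-1` A))%E.
Proof.
move=> ins sB mA.
have mXA : measurable (X i @^-1` A).
  by rewrite -[_ @^-1` _]setTI; exact: measurable_funP.
have PA0 : (0 <= fine (P (X i @^-1` A)))%R by rewrite fine_ge0.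
pose m1 := mrestr P mXA; pose m2 := mscale (NngNum PA0) P.
have -> : P (B `&` X i @^-1` A) = m1 B by [].
have -> : (P B * P (X i @^-1` A))%E = m2 B.
  by rewrite /m2/= /mscale/= fineK ?fin_num_measure// muleC.
apply: (@g_sigma_algebra_measure_unique _ _ _ (rect s) _ (fun=> setT)) => //.
- by rewrite bigcup_const.
- move=> _ [A' mA' ->]; rewrite /m1/m2/= /mrestr /mscale/= fineK ?fin_num_measure//.
  pose A2 j := if j == i then A else A' j.
  have mA2 j : measurable (A2 j) by rewrite /A2; case: ifP.
  pose J := [fset j in i :: s]%fset; pose J' := [fset j in s]%fset.
  have E1 : \bigcap_(j in [set` s]) (X j @^-1` A' j) `&` X i @^-1` A =
      \bigcap_(j in [set` J]) (X j @^-1` A2 j).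
    apply/seteqP; split=> w.
      move=> [h1 h2] j; rewrite /= !inE /A2 => /orP[/eqP->|js].
        by rewrite eqxx.
      by case: eqP => [->//|_]; exact: h1.
    move=> h; split=> [j/= js|].
      have := h j; rewrite /= !inE js orbT /A2 => /(_ isT).
      by case: eqP => [ji|//]; move: js; rewrite ji (negPf ins).
    by have := h i; rewrite /= !inE eqxx /A2 eqxx => /(_ isT).
  have E2 : \bigcap_(j in [set` s]) (X j @^-1` A' j) =
      \bigcap_(j in [set` J']) (X j @^-1` A' j).
    by congr (\bigcap_(j in _) _); apply/seteqP; split=> j; rewrite /= !inE.
  rewrite E1 E2 !indX// /J fset_cons big_fsetU1 ?inE//= {1}/A2 eqxx.
  congr (_ * _)%E; rewrite big_seq [RHS]big_seq; apply: eq_bigr => j.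
  by rewrite /A2 !inE; case: eqP => [->|//]; rewrite (negPf ins).
- by move=> _; rewrite /m1 /= /mrestr setTI -ge0_fin_numE// fin_num_measure.
Qed.

Lemma expectation_add_independent k (f : 'cV[R]_k -> R) (C : R) (s : seq I) i
    (u : I -> 'cV[R]_k) x :
  i \notin s -> cmeas f -> bounded_by C f ->
  \int[P]_w f (x + \sum_(j <- i :: s) X j w *: u j) =
  \int[P]_w avg (distribution P (X i)) (u i) f (x + \sum_(j <- s) X j w *: u j).
Proof.
move=> ins mf fC.
(* The set [T] with the sigma-algebra of the variables of [s]; the partial sum is a random vector on
   it, and the identity from [T] to [TG] is independent of [X i]. *)
pose TG : measurableType _ := g_sigma_algebraType (rect s).
have mid : @measurable_fun _ _ T TG setT (fun w => w).
  by move=> _ B mB; rewrite setTI; exact: (sigma_sub mB).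
pose phi : {mfun T >-> TG} :=
  HB.pack (fun w : T => w : TG) (isMeasurableFun.Build _ _ _ _ _ mid).
pose S (w : TG) := x + \sum_(j <- s) X j w *: u j.
have XG j : j \in s -> measurable_fun (setT : set TG) (X j : TG -> R).
  move=> js _ A mA; rewrite setTI; apply: sub_sigma_algebra.
  exists (fun j' => if j' == j then A else setT) => [j'|]; first by case: ifP.
  apply/seteqP; split=> [w XA j' j's /=|w /(_ j js) /=]; last by rewrite eqxx.
  by case: eqP => [->|//].
have mS : random_vector S.
  move=> l; apply: (eq_measurable_fun (fun w : TG => x l ord0 + \sum_(j <- s) X j w * u j l ord0)).
    by move=> w _; rewrite !mxE summxE; congr (_ + _); apply: eq_bigr => j _; rewrite mxE.
  apply: measurable_funD => //.
  suff aux s' : {subset s' <= s} ->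
      measurable_fun (setT : set TG) (fun w : TG => \sum_(j <- s') X j w * u j l ord0).
    exact: aux.
  elim: s' => [_|j s' ih js'].
    by under eq_fun do rewrite big_nil; exact: measurable_cst.
  under eq_fun do rewrite big_cons; apply: measurable_funD.
    by apply: measurable_funM => //; apply: XG; rewrite js'// mem_head.
  by apply: ih => j' j's'; rewrite js'// inE j's' orbT.
pose F (z : TG * R) := f (S z.1 + z.2 *: u i).
have mF : measurable_fun setT F.
  apply: (mf _ (TG * R)%type (fun z => S z.1 + z.2 *: u i)).
  apply: random_vector_line => // l.
  exact: (@measurableT_comp _ _ _ _ _ _ (fun w => S w l ord0)).
have indep B A : measurable B -> measurable A ->
    P (phi @^-1` B `&` X i @^-1` A) = (P (phi @^-1` B) * P (X i @^-1` A))%E.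
  exact: independent_sigma.
transitivity (\int[P]_w F (phi w, X i w)).
  by apply: eq_Rintegral => w _; rewrite /F /S/= big_cons addrAC addrA.
exact: (Rintegral_joint indep mF (fun z => fC _)).
Qed.

Lemma expectation_independent_sum k (f : 'cV[R]_k -> R) (C : R) (s : seq I)
    (u : I -> 'cV[R]_k) x :
  uniq s -> cmeas f -> bounded_by C f ->
  \int[P]_w f (x + \sum_(j <- s) X j w *: u j) =
  foldl (fun g j => avg (distribution P (X j)) (u j) g) f s x.
Proof.
elim: s f => [|i s ih] f /=.
  move=> _ _ _; under eq_Rintegral do rewrite big_nil addr0.
  exact: Rintegral_prob_cst.
move=> /andP[ins us] mf fC; rewrite (expectation_add_independent _ _ ins mf fC).
by apply: ih => //; [exact: avg_cmeas mf fC|exact: avg_bounded mf fC].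
Qed.

End independence.

Lemma Rdominated_cvg d (T : measurableType d) {R : realType} (P : probability T R)
    (f_ : nat -> T -> R) (f g : T -> R) :
  (forall n, measurable_fun setT (f_ n)) -> P.-integrable setT (EFin \o g) ->
  (forall x, f_ ^~ x @ \oo --> f x) -> (forall n x, `|f_ n x| <= g x) ->
  \int[P]_x f_ n x @[n --> \oo] --> \int[P]_x f x.
Proof.
move=> mf gi cf fg.
have mlim : measurable_fun setT f.
  by apply: (@measurable_fun_cvg _ _ R setT f_) => // x _; exact: cf.
have [fi _ h] : [/\ P.-integrable setT (EFin \o f),
    (\int[P]_x `|(EFin \o f_ n) x - (EFin \o f) x| @[n --> \oo] --> 0)%E &
    (\int[P]_x (EFin \o f_ n) x @[n --> \oo] --> \int[P]_x (EFin \o f) x)%E].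
  apply: (@dominated_convergence _ _ _ P setT measurableT _ _ (EFin \o g)) => //.
  - by move=> n; exact/measurable_EFinP.
  - exact/measurable_EFinP.
  - apply: aeW => x _; apply: cvg_EFin; last exact: cf.
    by near=> n.
  - by apply: aeW => x n _; rewrite /= lee_fin.
by apply: fine_cvg; rewrite fineK//; exact: (integrable_fin_num _ fi).
Unshelve. all: by end_near.
Qed.

(** * The standard normal distribution *)

Section std_normal.
Context {R : realType}.

Lemma measurable_idR : @measurable_fun _ _ (measurableTypeR R) R setT idfun.
Proof. by move=> _ A mA; rewrite setTI. Qed.

Definition idR : {mfun measurableTypeR R >-> R} :=
  HB.pack (idfun : measurableTypeR R -> R) (isMeasurableFun.Build _ _ _ _ _ measurable_idR).

(* [normal_prob 0 1] lives on [measurableTypeR R], which has the same measurable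
   sets as [R] but another display. *)
Definition std_normal : probability R R :=
  distribution (@normal_prob R 0 1 : probability (measurableTypeR R) R) idR.

Lemma std_normalE (A : set R) : std_normal A = @normal_prob R 0 1 A.
Proof. by []. Qed.

End std_normal.

Section normal_density.
Context {R : realType}.
Local Notation mu := (@lebesgue_measure R).
Local Notation N := (@normal_prob R 0 1).
Local Notation M := (measurableTypeR R).
Local Notation phi := (normal_pdf (0 : R) 1).
Implicit Types (f g : R -> R) (m s t x : R).

(** The Radon-Nikodym derivative has the same integral as the density on every measurable set, hence
    coincides with it almost everywhere. *)
Lemma integral_normal_prob (f : M -> \bar R) :
  measurable_fun setT f -> (forall x, 0 <= f x)%E ->
  (\int[N]_x f x = \int[mu]_x (f x * (phi x)%:E))%E.
Proof.
move=> mf f0; have dom := normal_prob_dominates (0 : R) 1.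
have mphi : measurable_fun setT (fun x => (phi x)%:E).
  by apply/measurable_EFinP; exact: measurable_normal_pdf.
rewrite -(Radon_Nikodym_SigmaFinite.change_of_variables dom)//.
have Di := Radon_Nikodym_SigmaFinite.f_integrable dom.
apply: ae_eq_integral => //.
- by apply: emeasurable_funM => //; exact: measurable_int Di.
- exact: emeasurable_funM.
have : ae_eq mu setT (Radon_Nikodym_SigmaFinite.f N mu) (fun x => (phi x)%:E).
  apply: integral_ae_eq => // A _ mA.
  by rewrite -Radon_Nikodym_SigmaFinite.f_integral.
by apply: filterS => x /= h _; rewrite h.
Qed.

Lemma normal_pdf_affine m s t : 0 < s ->
  normal_pdf m s (m + s * t) * s = normal_pdf 0 1 t.
Proof.
move=> s0; have sN0 : s != 0 by rewrite gt_eqF.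
rewrite !normal_pdfE ?oner_eq0// /normal_fun /normal_peak.
rewrite [m + _]addrC addrK subr0 expr1n.
have -> : - (s * t) ^+ 2 / (s ^+ 2 *+ 2) = - t ^+ 2 / 2.
  by rewrite exprMn -mulr_natl; field; rewrite sN0.
rewrite -mulrnAr sqrtrM ?sqr_ge0// sqrtr_sqr mul1r invfM gtr0_norm//.
by rewrite mulrC !mulrA mulfV// mul1r.
Qed.

Lemma ge0_integral_normal_affine g m s : 0 < s -> continuous g ->
  (forall x, 0 <= g x) ->
  (\int[mu]_x (g x * normal_pdf m s x)%:E =
   \int[mu]_x (g (m + s * x) * phi x)%:E)%E.
Proof.
move=> s0 cg g0.
have cpdf : continuous (normal_pdf m s) by apply: continuous_normal_pdf; rewrite gt_eqF.
have dF (x : R) : is_derive x 1 (fun x => m + s * x) s.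
  by apply: is_derive_eq; rewrite add0r mul1r /GRing.scale/= mulr1.
have F'E : (fun x : R => m + s * x)^`()%classic = cst s.
  by apply/funext => x; rewrite derive1E derive_val.
rewrite (@increasing_ge0_integration_by_substitutionT R (fun x => m + s * x)
  (fun x => g x * normal_pdf m s x)) //.
- apply: eq_integral => x _; congr EFin; rewrite F'E !fctE/= -mulrA.
  by rewrite normal_pdf_affine.
- by move=> x y xy; rewrite ltrD2l ltr_pM2l.
- by rewrite F'E => x; exact: cvg_cst.
- by rewrite F'E; exact: is_cvg_cst.
- by rewrite F'E; exact: is_cvg_cst.
- apply/cvgrNyPle => A; exists (s^-1 * (A - m)); split; first exact: num_real.
  by move=> x /ltW xA; rewrite -lerBrDl -ler_pdivlMl.
- apply/cvgryPge => A; exists (s^-1 * (A - m)); split; first exact: num_real.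
  by move=> x /ltW xA; rewrite -lerBlDl -ler_pdivrMl.
- by move=> x; apply: cvgM; [exact: cg|exact: cpdf].
- by move=> x; rewrite mulr_ge0// normal_pdf_ge0.
Qed.

Local Notation c := ((Num.sqrt 2)^-1 : R).

Let c_gt0 : 0 < c. Proof. by rewrite invr_gt0 sqrtr_gt0. Qed.

Let sqr_c : c ^+ 2 *+ 2 = 1.
Proof. by rewrite exprVn sqr_sqrtr// -mulr_natl mulfV. Qed.

(* The joint law of [W] and [c * (W + W')] is symmetric. *)
Lemma normal_pdf_exchange s x :
  normal_pdf (c * s) c x * phi s = normal_pdf (c * x) c s * phi x.
Proof.
rewrite !normal_pdfE ?oner_eq0 ?gt_eqF// /normal_fun sqr_c !divr1 expr1n !subr0.
rewrite mulrACA [RHS]mulrACA -!expRD; congr (_ * expR _).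
have E (y z : R) : (z - c * y) ^+ 2 = z ^+ 2 - 2 * c * y * z + y ^+ 2 / 2.
  rewrite -[in RHS](mul1r (y ^+ 2)) -[in X in X * y ^+ 2]sqr_c.
  by move: c => e; rewrite -mulr_natl; field.
by rewrite !E; move: c => e; rewrite -[1 *+ 2]/2; field.
Qed.

Lemma measurable_affine (a b : R) :
  measurable_fun (setT : set M) (fun t : R => a + b * t : R).
Proof.
have mR : measurable_fun (setT : set R) (fun t : R => a + b * t : R).
  by apply: measurable_funD => //; apply: measurable_funM.
exact: (measurableT_comp mR measurable_idR).
Qed.

Lemma measurable_fstR : measurable_fun (setT : set (M * M)) (fun z => z.1 : R).
Proof. exact: (measurableT_comp measurable_idR (@measurable_fst _ _ M M)). Qed.

Lemma measurable_sndR : measurable_fun (setT : set (M * M)) (fun z => z.2 : R).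
Proof. exact: (measurableT_comp measurable_idR (@measurable_snd _ _ M M)). Qed.

Lemma measurable_affine2 (a b : R) :
  measurable_fun (setT : set (M * M)) (fun z => a * z.1 + b * z.2 : R).
Proof.
have mR (e : R) : measurable_fun (setT : set R) (fun t : R => e * t : R).
  exact: measurable_funM.
apply: (@measurable_funD _ (M * M)%type R setT (fun z => a * z.1) (fun z => b * z.2)).
  exact: (measurableT_comp (mR a) measurable_fstR).
exact: (measurableT_comp (mR b) measurable_sndR).
Qed.

(** After an affine substitution the inner integral uses the normal density of mean [c * s] and
    deviation [c]. Exchanging the roles of the variables by [normal_pdf_exchange] and integrating in
    [s] first leaves the total mass of a normal density, which is [1]. *)
Lemma ge0_std_normal_stable g : continuous g -> (forall x, 0 <= g x) ->
  (\int[N]_s \int[N]_t (g (c * s + c * t))%:E = \int[N]_t (g t)%:E)%E.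
Proof.
move=> cg g0; have mg : measurable_fun (setT : set R) g by exact: continuous_measurable_fun.
have mgM : measurable_fun (setT : set M) g by exact: (measurableT_comp mg measurable_idR).
have mphi : measurable_fun (setT : set R) phi by exact: measurable_normal_pdf.
have mgc (s : R) : measurable_fun (setT : set M) (fun t => g (c * s + c * t)).
  exact: (measurableT_comp mg (measurable_affine (c * s) c)).
pose K (z : M * M) : \bar R := (g z.2 * (normal_pdf (c * z.1) c z.2 * phi z.1))%:E.
have mK : measurable_fun setT K.
  apply/measurable_EFinP; apply: measurable_funM.
    exact: (measurableT_comp mg measurable_sndR).
  apply: measurable_funM; last exact: (measurableT_comp mphi measurable_fstR).
  rewrite [X in measurable_fun _ X](_ : _ = fun z : M * M =>
      normal_peak c * expR (- (z.2 - c * z.1) ^+ 2 / (c ^+ 2 *+ 2))); last first.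
    by apply/funext => z; rewrite normal_pdfE ?gt_eqF.
  apply: measurable_funM => //; apply: measurableT_comp => //.
  apply: measurable_funM => //; apply: measurableT_comp => //.
  apply: measurable_funX; apply: measurable_funB; first exact: measurable_sndR.
  by apply: measurable_funM => //; exact: measurable_fstR.
have K0 z : (0 <= K z)%E by rewrite lee_fin !mulr_ge0 ?normal_pdf_ge0.
have inner (s : R) : (\int[N]_t (g (c * s + c * t))%:E =
    \int[mu]_x (g x * normal_pdf (c * s) c x)%:E)%E.
  rewrite ge0_integral_normal_affine// integral_normal_prob//.
    exact/measurable_EFinP.
  by move=> x; rewrite lee_fin.
transitivity (\int[mu]_s \int[mu]_x K (s, x))%E.
  rewrite integral_normal_prob; last 2 first.
  - apply: (measurable_fun_fubini_tonelli_F (m2 := N) (fun z : M * M => (g (c * z.1 + c * z.2))%:E)).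
      by apply/measurable_EFinP; exact: (measurableT_comp mg (measurable_affine2 c c)).
    by move=> z; rewrite lee_fin.
  - by move=> s; apply: integral_ge0 => t _; rewrite lee_fin.
  apply: eq_integral => s _; rewrite inner -ge0_integralZr//.
  - by apply: eq_integral => x _; rewrite /K/= mulrA.
  - apply/measurable_EFinP; apply: measurable_funM => //; exact: measurable_normal_pdf.
  - by move=> x _; rewrite lee_fin mulr_ge0// normal_pdf_ge0.
  - by rewrite lee_fin normal_pdf_ge0.
rewrite (fubini_tonelli K)// integral_normal_prob//; last exact/measurable_EFinP.
apply: eq_integral => x _; rewrite /K/=.
under eq_integral do rewrite normal_pdf_exchange mulrCA EFinM.
rewrite ge0_integralZr//.
- by rewrite integral_normal_pdf mul1e.
- apply/measurable_EFinP; exact: measurable_normal_pdf.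
- by move=> s _; rewrite lee_fin normal_pdf_ge0.
- by rewrite lee_fin mulr_ge0// normal_pdf_ge0.
Qed.

(** Completing the square turns the integrand into a constant multiple of the normal density of mean
    [t]. *)
Lemma std_normal_mgf t : (\int[N]_x (expR (t * x))%:E = (expR (t ^+ 2 / 2))%:E)%E.
Proof.
rewrite integral_normal_prob; last 2 first.
- apply/measurable_EFinP; under eq_fun do rewrite -[t * _]add0r.
  exact: (measurableT_comp (@measurable_expR R) (measurable_affine 0 t)).
- by move=> x; rewrite lee_fin expR_ge0.
have E x : expR (t * x) * phi x = normal_pdf t 1 x * expR (t ^+ 2 / 2).
  rewrite !normal_pdfE ?oner_eq0// mulrCA -mulrA; congr (_ * _).
  rewrite /normal_fun -!expRD; congr expR.
  by rewrite expr1n -[1 *+ 2]/2 subr0; field.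
under eq_integral do rewrite -EFinM E EFinM.
rewrite ge0_integralZr ?lee_fin ?expR_ge0//; last 2 first.
- apply/measurable_EFinP; exact: measurable_normal_pdf.
- by move=> x _; rewrite lee_fin normal_pdf_ge0.
by rewrite integral_normal_pdf mul1e.
Qed.

End normal_density.

(** * Moments of the standard normal law from its moment generating function *)

Section std_normal_moments.
Context {R : realType}.
Local Notation S := (@std_normal R).
Local Notation c := ((Num.sqrt 2)^-1 : R).
Implicit Types (g : R -> R) (t x : R).

Lemma ge0_integral_std_normal (f : R -> \bar R) : measurable_fun setT f ->
  (forall x, 0 <= f x)%E -> (\int[S]_x f x = \int[@normal_prob R 0 1]_x f x)%E.
Proof. by move=> mf f0; rewrite ge0_integral_distribution. Qed.

Lemma std_normal_stable g (C : R) : continuous g -> (forall x, `|g x| <= C) ->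
  \int[S]_s \int[S]_t g (c * s + c * t) = \int[S]_t g t.
Proof.
(* The shift by [C] reduces the claim to nonnegative functions; the constant is subtracted from both
   sides at the end. *)
move=> cg gC; pose h x := g x + C.
have h0 x : 0 <= h x by have := gC x; rewrite ler_norml /h => /andP[+ _]; lra.
have hC x : `|h x| <= C + C.
  by rewrite (le_trans (ler_normD _ _))// lerD// ger0_norm// (le_trans _ (gC x)).
have mg : measurable_fun (setT : set R) g by exact: continuous_measurable_fun.
have mh : measurable_fun (setT : set R) h by exact: measurable_funD.
have ch : continuous h by move=> x; apply: cvgD; [exact: cg|exact: cvg_cst].
have m2 (f : R -> R) : measurable_fun (setT : set R) f ->
    measurable_fun setT (fun z : R * R => f (c * z.1 + c * z.2)).
  by move=> mf; apply: (measurableT_comp mf); apply: measurable_funD; apply: measurable_funM.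
have i2 (f : R -> R) D s : measurable_fun (setT : set R) f -> (forall x, `|f x| <= D) ->
    S.-integrable setT (EFin \o (fun t => f (c * s + c * t))).
  move=> mf fD; apply: (@bounded_integrable _ _ _ _ _ D) => //.
  exact: (@measurable_fun_pair2 _ _ _ _ _ _ (fun z : R * R => f (c * z.1 + c * z.2)) s (m2 _ mf)).
have main : \int[S]_s \int[S]_t h (c * s + c * t) = \int[S]_t h t.
  rewrite {1}/Rintegral ge0_integral_std_normal; last 2 first.
  - by apply/measurable_EFinP; apply: measurable_Rfubini (m2 _ mh) (fun z => hC _).
  - by move=> s; rewrite lee_fin; apply: Rintegral_ge0.
  rewrite /Rintegral ge0_integral_std_normal; last 2 first.
  - exact/measurable_EFinP.
  - by move=> t; rewrite lee_fin.
  rewrite -(ge0_std_normal_stable ch h0); congr fine; apply: eq_integral => s _.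
  rewrite fineK; last exact: (integrable_fin_num _ (i2 _ _ s mh hC)).
  rewrite ge0_integral_std_normal//; last by move=> t; rewrite lee_fin.
  exact: (measurable_int _ (i2 _ _ s mh hC)).
have cst_int : S.-integrable setT (EFin \o (fun=> C)).
  exact: finite_measure_integrable_cst.
have inner s : \int[S]_t h (c * s + c * t) = \int[S]_t g (c * s + c * t) + C.
  by rewrite RintegralD ?Rintegral_prob_cst//; exact: i2 mg gC.
move: main; under eq_Rintegral do rewrite inner.
rewrite RintegralD//; last first.
  apply: (@bounded_integrable _ _ _ _ _ C).
    exact: measurable_Rfubini (m2 _ mg) (fun z => gC _).
  by move=> s; apply: Rintegral_le_cst => //; exact: i2 mg gC.
rewrite [X in _ = X]RintegralD//; last exact: bounded_integrable mg gC.
by rewrite Rintegral_prob_cst => /addIr.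
Qed.

Lemma measurable_expR_scale t : measurable_fun (setT : set R) (fun x => expR (t * x)).
Proof. by apply: measurableT_comp => //; apply: measurable_funM. Qed.

Lemma integral_std_normal_expR t : (\int[S]_x (expR (t * x))%:E = (expR (t ^+ 2 / 2))%:E)%E.
Proof.
rewrite ge0_integral_std_normal ?std_normal_mgf//.
by apply/measurable_EFinP; exact: measurable_expR_scale.
Qed.

Lemma std_normal_expR_integrable t : S.-integrable setT (EFin \o (fun x => expR (t * x))).
Proof.
apply/integrableP; split; first by apply/measurable_EFinP; exact: measurable_expR_scale.
under eq_integral do rewrite /= ger0_norm ?expR_ge0//.
by rewrite integral_std_normal_expR ltry.
Qed.

Lemma std_normal_dominated_integrable (f : R -> R) (K : R) : measurable_fun setT f ->
  (forall x, `|f x| <= K * expR `|x|) -> S.-integrable setT (EFin \o f).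
Proof.
move=> mf fK.
have K0 : 0 <= K by have := fK 0; rewrite normr0 expR0 mulr1; apply: le_trans.
have ei : S.-integrable setT (EFin \o (fun x => K * (expR (1 * x) + expR (-1 * x)))).
  by apply/Rintegrable_scale/Rintegrable_add; exact: std_normal_expR_integrable.
apply: (le_integrable measurableT _ _ ei); first exact/measurable_EFinP.
move=> x _ /=; rewrite lee_fin (le_trans (fK x))// [leRHS]ger0_norm; last first.
  by rewrite mulr_ge0// addr_ge0// expR_ge0.
rewrite ler_wpM2l// mul1r mulN1r.
by case: (leP 0 x) => x0; rewrite ?(ger0_norm x0) ?(ltr0_norm x0) ?lerDl ?lerDr ?expR_ge0.
Qed.

Lemma normrX_le_expR x n : `|x| ^+ n.+1 <= n.+1`!%:R * expR `|x|.
Proof.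
have := @expR_ge1Dxn R `|x| n (normr_ge0 x).
rewrite -ler_pdivrMl ?ltr0n ?fact_gt0// => h; apply: le_trans h.
by rewrite mulrC lerDr.
Qed.

Lemma std_normal_abs_moment n : S.-integrable setT (EFin \o (fun x => `|x| ^+ n.+1)).
Proof.
apply: (@std_normal_dominated_integrable _ n.+1`!%:R) => [|x].
  by apply: measurable_funX; exact: continuous_measurable_fun (@norm_continuous _ R^o).
by rewrite ger0_norm ?exprn_ge0//; exact: normrX_le_expR.
Qed.

Lemma std_normal_id_integrable : S.-integrable setT (EFin \o (fun x : R => x)).
Proof.
apply: (@std_normal_dominated_integrable _ 1) => // x.
by have := normrX_le_expR x 0; rewrite expr1.
Qed.

Lemma std_normal_sqr_integrable : S.-integrable setT (EFin \o (fun x : R => x ^+ 2)).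
Proof.
apply: (@std_normal_dominated_integrable _ 2) => [|x]; first exact: measurable_funX.
by have := normrX_le_expR x 1; rewrite normrX.
Qed.

(** From [1 - y <= expR (- y)] one gets [expR y <= 1 / (1 - y)], and [(1 - y) * (1 + y + 2 * y ^ 2)
    = 1 + y ^ 2 * (1 - 2 * y)] is at least [1] on this interval. *)
Lemma expR_le_quadratic (y : R) : 0 <= y <= 2^-1 -> expR y <= 1 + y + 2 * y ^+ 2.
Proof.
move=> /andP[y0 y2]; have := @expR_ge1Dx R (- y); rewrite expRN.
move=> h; have y1 : 0 < 1 - y by lra.
have : expR y <= (1 - y)^-1 by rewrite -[expR y]invrK lef_pV2 ?posrE// invr_gt0 expR_gt0.
move=> /le_trans; apply; rewrite -[leLHS]mul1r ler_pdivrMr//.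
have : 0 <= y ^+ 2 by exact: sqr_ge0.
nra.
Qed.

(* [1 + t x <= exp (t x)] gives [t * E W <= exp (t^2 / 2) - 1] for both signs of [t]. *)
Lemma std_normal_mean : \int[S]_x x = 0.
Proof.
set a := \int[S]_x x.
have lin t : t * a <= expR (t ^+ 2 / 2) - 1.
  rewrite lerBrDl -[X in X + _](@Rintegral_prob_cst _ _ _ S) -RintegralZl//; last exact: std_normal_id_integrable.
  have ti : S.-integrable setT (EFin \o (fun x => t * x)).
    by apply: Rintegrable_scale; exact: std_normal_id_integrable.
  rewrite -RintegralD//; last exact: finite_measure_integrable_cst.
  have -> : expR (t ^+ 2 / 2) = \int[S]_x expR (t * x).
    by rewrite /Rintegral integral_std_normal_expR.
  apply: le_Rintegral => //; last by move=> x _; exact: expR_ge1Dx.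
    by apply: Rintegrable_add => //; exact: finite_measure_integrable_cst.
  exact: std_normal_expR_integrable.
have bnd t : -1 <= t <= 1 -> t * a <= t ^+ 2.
  move=> t1; rewrite (le_trans (lin t))// lerBlDl.
  have t21 : t ^+ 2 <= 1 by nra.
  have := sqr_ge0 t => t20.
  rewrite (le_trans (expR_le_quadratic _))//; first by lra.
  nra.
apply/eqP; apply/negPn/negP => a0.
have sa : `|Num.sg a| = 1 by rewrite normr_sg a0.
(* Applied at [q] times the sign of [a], the bound [bnd] shows that the absolute value of [a] is at
   most [q], hence at most half of itself. *)
pose q := Num.min `|a| 1 / 2.
have q0 : 0 < q by rewrite divr_gt0// lt_min normr_gt0 a0/=.
have q1 : q <= 2^-1 by rewrite ler_pdivrMr// mulVf// ge_min lexx orbT.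
have qa : q <= `|a| / 2 by rewrite ler_pdivrMr// divfK// ge_min lexx.
have := bnd (q * Num.sg a).
have -> : q * Num.sg a * a = q * `|a| by rewrite -mulrA mulrC [in RHS]mulrC -normrEsg.
have -> : (q * Num.sg a) ^+ 2 = q ^+ 2 by rewrite exprMn sqr_sg a0 mulr1.
rewrite expr2 ler_pM2l// => h.
have : `|a| <= q.
  apply: h; rewrite -ler_norml normrM sa mulr1 gtr0_norm//; lra.
have : 0 < `|a| by rewrite normr_gt0.
lra.
Qed.

End std_normal_moments.

Section std_normal_variance.
Context {R : realType}.
Local Notation S := (@std_normal R).

Lemma expRB_bound (y : R) : 0 <= y <= 2^-1 ->
  `|expR y - expR (- y) - 2 * y| <= 2 * y ^+ 2.
Proof.
move=> /andP[y0 y2]; have y20 : 0 <= y ^+ 2 by exact: sqr_ge0.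
have h1 := @expR_ge1Dx R y; have h2 := @expR_ge1Dx R (- y).
have h3 : expR y <= 1 + y + 2 * y ^+ 2 by apply: expR_le_quadratic; rewrite y0.
have h4 : expR (- y) <= 1 - y + y ^+ 2.
  rewrite expRN; apply: (@le_trans _ _ (1 + y)^-1).
    by rewrite lef_pV2 ?posrE ?expR_gt0//; lra.
  rewrite -[leLHS]mul1r ler_pdivrMr; last by lra.
  nra.
by rewrite ler_norml; apply/andP; split; lra.
Qed.

(* It converges to [x ^+ 2] as [m] tends to infinity, and its normal integral is
   given by the moment generating function. *)
Definition second_difference (m : nat) (x : R) : R :=
  2 ^+ m ^+ 2 * (expR (2 ^- m * x) + expR (- 2 ^- m * x) - 2).

Lemma second_difference_cvg x : second_difference ^~ x @ \oo --> x ^+ 2.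
Proof.
apply/cvgrPdist_le => e e0.
(* The first term serves the final error, which is [3 / 2] times the cube of the absolute value of
   [x], divided by [2 ^ m]; the second ensures that [z = x / 2 ^ m] is at most [1] in absolute
   value. *)
pose M := 4 * `|x| ^+ 3 / e + 2 * `|x|.
have M0 : 0 <= M by rewrite addr_ge0 ?divr_ge0 ?mulr_ge0 ?exprn_ge0// ltW.
near=> m.
have mM : M <= m%:R by near: m; exact: nbhs_infty_ger.
have mp : M <= 2 ^+ m.
  by rewrite (le_trans mM)// -natrX ler_nat ltnW// ltn_expl.
set p := 2 ^+ m in mp; have p0 : 0 < p by rewrite exprn_gt0.
rewrite /second_difference -/p; pose z := p^-1 * x.
(* Written as a square, the second difference only requires a first order estimate of
   [expR (z / 2) - expR (- (z / 2))], which is [z] up to [z ^ 2 / 2]. *)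
have zE : expR (p^-1 * x) + expR (- p^-1 * x) - 2 = (expR (z / 2) - expR (- (z / 2))) ^+ 2.
  rewrite mulNr !expRN -/z -{1 2}(divfK (_ : 2 != 0) z)// expRM_natr.
  have : expR (z / 2) != 0 by rewrite gt_eqF// expR_gt0.
  by move: (expR _) => w w0; field.
have az : `|z| <= 1.
  rewrite normrM gtr0_norm ?invr_gt0// mulrC ler_pdivrMr// mul1r.
  rewrite (le_trans _ mp)// /M ler_wpDl ?divr_ge0 ?mulr_ge0 ?exprn_ge0 ?(ltW e0)//.
  by rewrite ler_peMl// ler1n.
have sz : `|expR (z / 2) - expR (- (z / 2)) - z| <= z ^+ 2 / 2.
  have half (t : R) : 0 <= t <= 1 -> `|expR (t / 2) - expR (- (t / 2)) - t| <= t ^+ 2 / 2.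
    move=> t01; have := @expRB_bound (t / 2).
    have -> : 2 * (t / 2) = t by field.
    have -> : 2 * (t / 2) ^+ 2 = t ^+ 2 / 2 by field.
    by apply; lra.
  case: (leP 0 z) => z0.
    by apply: half; rewrite z0/=; rewrite ger0_norm in az.
  have := half (- z); rewrite mulNr opprK sqrrN oppr_ge0 (ltW z0)/=.
  rewrite -(ltr0_norm z0) az => /(_ isT).
  by rewrite -normrN (ltr0_norm z0) opprK !opprD !opprK [- expR _ + _]addrC.
rewrite zE; set sh := expR _ - expR _ in sz *.
have -> : x ^+ 2 - p ^+ 2 * sh ^+ 2 = p ^+ 2 * ((z - sh) * (z + sh)).
  by rewrite /z; field; rewrite gt_eqF.
rewrite normrM ger0_norm ?sqr_ge0// normrM distrC.
have s2 : `|z + sh| <= 3 * `|z|.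
  have -> : z + sh = (sh - z) + 2 * z by ring.
  rewrite (le_trans (ler_normD _ _))// normrM gtr0_norm//.
  have : z ^+ 2 <= `|z| by rewrite -real_normK ?num_real// expr2 ler_piMl.
  move: sz (normr_ge0 z); move: (`|sh - z|) (`|z|) (z ^+ 2) => a b e'; lra.
rewrite (le_trans (_ : _ <= p ^+ 2 * (z ^+ 2 / 2 * (3 * `|z|))))//.
  by rewrite ler_wpM2l ?sqr_ge0// ler_pM.
rewrite -(real_normK (num_real z)) /z normrM gtr0_norm ?invr_gt0//.
have -> : p ^+ 2 * ((p^-1 * `|x|) ^+ 2 / 2 * (3 * (p^-1 * `|x|))) = (3 / 2 * `|x| ^+ 3) / p.
  by field; rewrite gt_eqF.
rewrite ler_pdivrMr//.
have : e * M <= e * p by rewrite ler_pM2l.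
have -> : e * M = 4 * `|x| ^+ 3 + 2 * e * `|x| by rewrite /M; field; rewrite gt_eqF.
have : 0 <= `|x| ^+ 3 by rewrite exprn_ge0.
have : 0 <= e * `|x| by rewrite mulr_ge0// ltW.
by move: (`|x| ^+ 3) (`|x|) => a b; lra.
Unshelve. all: by end_near. Qed.

(** The sequence decreases in [m]: with [w] and its inverse [v], [w ^ 2 + v ^ 2 - 2 = (w + v - 2) *
    (w + v + 2)], where the last factor is at least [4]. The term of index [0] is thus a dominating
    function. *)
Lemma second_difference_bound m x :
  0 <= second_difference m x <= second_difference 0 x.
Proof.
have pos (w : R) : 0 < w -> 2 <= w + w^-1.
  move=> w0; rewrite -subr_ge0; have -> : w + w^-1 - 2 = (w - 1) ^+ 2 / w.
    by field; rewrite gt_eqF.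
  by rewrite divr_ge0 ?sqr_ge0// ltW.
have ge0 k : 0 <= second_difference k x.
  by rewrite mulr_ge0 ?sqr_ge0// subr_ge0 mulNr expRN pos// expR_gt0.
rewrite ge0 /=; elim: m => // m ih; apply: le_trans ih.
rewrite /second_difference; set w := expR (2 ^- m.+1 * x).
have w0 : 0 < w by rewrite expR_gt0.
have E1 : expR (- 2 ^- m.+1 * x) = w^-1 by rewrite mulNr expRN.
have E2 : expR (2 ^- m * x) = w ^+ 2.
  by rewrite -expRM_natr; congr expR; rewrite exprS; field.
have E3 : expR (- 2 ^- m * x) = w^-1 ^+ 2 by rewrite mulNr expRN E2 exprVn.
rewrite E1 E2 E3 [2 ^+ m.+1]exprS exprMn -mulrA mulrCA ler_wpM2l ?sqr_ge0//.
have := pos _ w0; set v := w^-1 => h.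
have wv : w * v = 1 by rewrite mulfV ?gt_eqF.
nra.
Qed.

(** By dominated convergence the variance is the limit of the integrals of the second differences,
    namely of [2 * 4 ^ m * (expR (4 ^ (- m) / 2) - 1)], which tends to [1]. *)
Lemma std_normal_variance : \int[S]_x x ^+ 2 = 1.
Proof.
have di m : S.-integrable setT (EFin \o second_difference m).
  apply: Rintegrable_scale; apply: Rintegrable_sub; last exact: finite_measure_integrable_cst.
  by apply: Rintegrable_add; exact: std_normal_expR_integrable.
have val m : \int[S]_x second_difference m x =
    2 ^+ m ^+ 2 * (2 * (expR ((2 ^- m) ^+ 2 / 2) - 1)).
  have ei t : \int[S]_x expR (t * x) = expR (t ^+ 2 / 2).
    by rewrite /Rintegral integral_std_normal_expR.
  rewrite RintegralZl//; last first.
    apply: Rintegrable_sub; last exact: finite_measure_integrable_cst.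
    by apply: Rintegrable_add; exact: std_normal_expR_integrable.
  rewrite RintegralB//; last 2 first.
  - by apply: Rintegrable_add; exact: std_normal_expR_integrable.
  - exact: finite_measure_integrable_cst.
  rewrite RintegralD//; try exact: std_normal_expR_integrable.
  by rewrite !ei Rintegral_prob_cst sqrrN; ring.
have b0 m x := second_difference_bound m x.
have := @Rdominated_cvg _ _ _ S second_difference (fun x => x ^+ 2) (second_difference 0)
  (fun m => (measurable_EFinP _ _).1 (measurable_int _ (di m))) (di 0%N) second_difference_cvg.
move=> /(_ _)/(cvg_unique (@Rhausdorff R)); apply.
  by move=> m x; have /andP[h1 h2] := b0 m x; rewrite ger0_norm.
apply/cvgrPdist_le => e e0; near=> m; rewrite val.
have mM : e^-1 <= m%:R by near: m; exact: nbhs_infty_ger.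
have mp : e^-1 <= 2 ^+ m.
  by rewrite (le_trans mM)// -natrX ler_nat ltnW// ltn_expl.
have p1 : 1 <= 2 ^+ m :> R by rewrite exprn_ege1// ler1n.
move: mp p1; set p := 2 ^+ m => mp p1; have p0 : 0 < p by lra.
set y := p^-1 ^+ 2 / 2.
have y0 : 0 <= y by rewrite divr_ge0 ?sqr_ge0.
have yp : p ^+ 2 * y = 2^-1 by rewrite /y; field; rewrite gt_eqF.
have ie : p^-1 <= e by rewrite -[leRHS]invrK lef_pV2 ?posrE ?invr_gt0.
have i1 : p^-1 <= 1 by rewrite invf_le1.
have i0 : 0 < p^-1 by rewrite invr_gt0.
have ye : 2 * y <= e by rewrite /y; nra.
have y2 : y <= 2^-1 by rewrite /y; nra.
have h1 := @expR_ge1Dx R y.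
have h2 : expR y <= 1 + y + 2 * y ^+ 2 by apply: expR_le_quadratic; rewrite y0.
have p20 : 0 <= p ^+ 2 by exact: sqr_ge0.
have h1' : 1 <= p ^+ 2 * (2 * (expR y - 1)).
  have : p ^+ 2 * y <= p ^+ 2 * (expR y - 1) by apply: ler_wpM2l => //; lra.
  lra.
have h2' : p ^+ 2 * (2 * (expR y - 1)) <= 1 + e.
  have : p ^+ 2 * (expR y - 1) <= p ^+ 2 * y + p ^+ 2 * y * (2 * y).
    by rewrite -mulrA -mulrDr; apply: ler_wpM2l => //; lra.
  rewrite yp; lra.
rewrite ler_norml; apply/andP; split; lra.
Unshelve. all: by end_near. Qed.

End std_normal_variance.

(** * Compositions of averaging operators *)

Section iterated_averaging.
Context {R : realType} (k : nat).
Implicit Types (f g : 'cV[R]_k -> R) (s t : seq (probability R R * 'cV[R]_k)).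

Definition avgs s f := foldl (fun g m => avg m.1 m.2 g) f s.

Lemma avgs_nice s C f : cmeas f -> bounded_by C f ->
  cmeas (avgs s f) /\ bounded_by C (avgs s f).
Proof.
elim: s f => [//|m s ih] f mf fC; apply: ih; first exact: avg_cmeas mf fC.
exact: avg_bounded.
Qed.

Lemma avgs_cmeas s C f : cmeas f -> bounded_by C f -> cmeas (avgs s f).
Proof. by move=> mf fC; case: (avgs_nice s mf fC). Qed.

Lemma avgs_bounded s C f : cmeas f -> bounded_by C f -> bounded_by C (avgs s f).
Proof. by move=> mf fC; case: (avgs_nice s mf fC). Qed.

Lemma avgs_le s C e f g : cmeas f -> cmeas g -> bounded_by C f -> bounded_by C g ->
  (forall x, `|f x - g x| <= e) -> forall x, `|avgs s f x - avgs s g x| <= e.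
Proof.
elim: s f g => [//|m s ih] f g mf mg fC gC fg; apply: ih.
- exact: avg_cmeas mf fC.
- exact: avg_cmeas mg gC.
- exact: avg_bounded.
- exact: avg_bounded.
- exact: avg_le fg.
Qed.

Lemma avgs_avg s mu u C f : cmeas f -> bounded_by C f ->
  avgs s (avg mu u f) = avg mu u (avgs s f).
Proof.
elim: s f => [//|m s ih] f mf fC /=; rewrite -ih; last 2 first.
- exact: avg_cmeas mf fC.
- exact: avg_bounded.
by rewrite (avgC _ _ _ _ mf fC).
Qed.

Lemma avgsC s t C f : cmeas f -> bounded_by C f ->
  avgs s (avgs t f) = avgs t (avgs s f).
Proof.
elim: t f => [//|m t ih] f mf fC /=; rewrite ih; last 2 first.
- exact: avg_cmeas mf fC.
- exact: avg_bounded.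
by rewrite (avgs_avg _ _ _ mf fC).
Qed.

(* Commutation moves the two operators that differ next to [f]. *)
Lemma avgs_iter_le s t C e f N : cmeas f -> bounded_by C f ->
  (forall x, `|avgs s f x - avgs t f x| <= e) ->
  forall x, `|iter N (avgs s) f x - iter N (avgs t) f x| <= N%:R * e.
Proof.
move=> mf fC fe; elim: N f mf fC fe => [|N ih] f mf fC fe x.
  by rewrite /= subrr normr0 mul0r.
have ms := avgs_cmeas s mf fC; have mt := avgs_cmeas t mf fC.
have sC := avgs_bounded s mf fC; have tC := avgs_bounded t mf fC.
have iter_nice g : cmeas g -> bounded_by C g ->
    cmeas (iter N (avgs s) g) /\ bounded_by C (iter N (avgs s) g).
  move=> mg gC; elim: N {ih} => [//|N [h1 h2]] /=; exact: avgs_nice.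
have iter_le g h : cmeas g -> cmeas h -> bounded_by C g -> bounded_by C h ->
    (forall x, `|g x - h x| <= e) ->
    forall x, `|iter N (avgs s) g x - iter N (avgs s) h x| <= e.
  move=> mg mh gC hC gh; elim: N {ih iter_nice} => [//|N h1] /=.
  have it (j : seq (probability R R * 'cV_k)) u : cmeas u -> bounded_by C u -> cmeas (iter N (avgs j) u) /\
     bounded_by C (iter N (avgs j) u).
    by move=> mu uC; elim: N {h1} => [//|N [h1 h2]] /=; exact: avgs_nice.
  have [g1 g2] := it s g mg gC; have [h1' h2'] := it s h mh hC.
  exact: avgs_le h1.
rewrite !iterSr -natr1 mulrDl mul1r.
have h1 := iter_le _ _ ms mt sC tC fe x.
have h2 : `|iter N (avgs s) (avgs t f) x - iter N (avgs t) (avgs t f) x| <= N%:R * e.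
  apply: ih => // y; rewrite (avgsC _ _ mf fC); exact: avgs_le fe _.
rewrite -(subrKA (iter N (avgs s) (avgs t f) x)) (le_trans (ler_normD _ _))//.
by rewrite addrC lerD.
Qed.

(** Lindeberg's replacement of the summands one by one. By commutation the pair of operators that
    differ acts directly on [f], so that smoothness is required of [f] only and not of its averages;
    contraction propagates the error. *)
Lemma foldl_avg_le (I : Type) (mu nu : I -> probability R R) (u v : I -> 'cV[R]_k)
    (e : I -> R) (r : seq I) C f : cmeas f -> bounded_by C f ->
  (forall i x, `|avg (mu i) (u i) f x - avg (nu i) (v i) f x| <= e i) ->
  forall x, `|avgs [seq (mu i, u i) | i <- r] f x - avgs [seq (nu i, v i) | i <- r] f x|
    <= \sum_(i <- r) e i.
Proof.
elim: r f => [|i r ih] f mf fC fe x; first by rewrite big_nil subrr normr0.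
have mm := avg_cmeas (mu i) (u i) mf fC; have mn := avg_cmeas (nu i) (v i) mf fC.
have mC := avg_bounded (mu i) (u i) mf fC; have nC := avg_bounded (nu i) (v i) mf fC.
rewrite big_cons /=.
rewrite -(subrKA (avgs [seq (mu i, u i) | i <- r] (avg (nu i) (v i) f) x)).
rewrite (le_trans (ler_normD _ _))// lerD//.
  exact: avgs_le (fe i) x.
apply: ih => // j y; rewrite (avgC _ _ _ _ mf fC) [in X in _ - X](avgC _ _ _ _ mf fC).
have mm' := avg_cmeas (mu j) (u j) mf fC; have mn' := avg_cmeas (nu j) (v j) mf fC.
have mC' := avg_bounded (mu j) (u j) mf fC; have nC' := avg_bounded (nu j) (v j) mf fC.
exact: avg_le (fe j) y.
Qed.

Definition lipschitz_fun (L : R) f : Prop := forall x y, `|f x - f y| <= L * `|x - y|.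

Lemma avg_lipschitz mu u C L f : cmeas f -> bounded_by C f -> lipschitz_fun L f ->
  lipschitz_fun L (avg mu u f).
Proof.
move=> mf fC fL x y.
have fi z := line_integrable mu z u mf fC.
rewrite -RintegralB//; apply: Rintegral_le_cst => [|t].
  exact: Rintegrable_sub.
by rewrite (le_trans (fL _ _))// opprD addrACA subrr addr0.
Qed.

Lemma avgs_lipschitz s C L f : cmeas f -> bounded_by C f -> lipschitz_fun L f ->
  lipschitz_fun L (avgs s f).
Proof.
elim: s f => [//|m s ih] f mf fC fL; apply: ih.
- exact: avg_cmeas mf fC.
- exact: avg_bounded.
- exact: avg_lipschitz fL.
Qed.

End iterated_averaging.

(** * Rescaling of Gaussian operators *)

Section gaussian_steps.
Context {R : realType} (k : nat).
Implicit Types (f g : 'cV[R]_k -> R) (s : seq 'cV[R]_k).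
Local Notation S := (@std_normal R).
Local Notation c := ((Num.sqrt 2)^-1 : R).

Definition gsteps (a : R) s : seq (probability R R * 'cV[R]_k) :=
  [seq (S, a *: u) | u <- s].

Lemma avg_normal_stable u C L f : cmeas f -> bounded_by C f -> lipschitz_fun L f ->
  avg S u f = avg S (c *: u) (avg S (c *: u) f).
Proof.
move=> mf fC fL; apply/funext => x; rewrite /avg.
rewrite -(@std_normal_stable _ (fun t => f (x + t *: u)) C); last 2 first.
- move=> t; apply/cvgrPdist_le => e e0.
  pose d := e / (`|L| * `|u| + 1).
  have D0 : 0 < `|L| * `|u| + 1 by rewrite ltr_wpDl// mulr_ge0.
  have d0 : 0 < d by rewrite divr_gt0.
  near=> z; rewrite (le_trans (fL _ _))// opprD addrACA subrr add0r -scalerBl normrZ.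
  have : `|t - z| <= d by near: z; apply: cvgr_dist_le.
  rewrite ler_pdivlMr// => h.
  have h1 : L * (`|t - z| * `|u|) <= `|L| * (`|t - z| * `|u|).
    by rewrite ler_wpM2r ?mulr_ge0// ler_norm.
  have h2 : 0 <= `|t - z| by [].
  nra.
- by move=> t; exact: fC.
apply: eq_Rintegral => t _; apply: eq_Rintegral => t' _.
by rewrite scalerDl !scalerA addrA ![c * _]mulrC.
Unshelve. all: by end_near. Qed.

Lemma gsteps_stable a s C L f : cmeas f -> bounded_by C f -> lipschitz_fun L f ->
  avgs (gsteps a s) f = avgs (gsteps (a * c) s) (avgs (gsteps (a * c) s) f).
Proof.
elim: s f => [//|u s ih] f mf fC fL /=.
have nice g v : cmeas g -> bounded_by C g -> lipschitz_fun L g ->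
  [/\ cmeas (avg S v g), bounded_by C (avg S v g) & lipschitz_fun L (avg S v g)].
  move=> mg gC gL; split; [exact: avg_cmeas mg gC|exact: avg_bounded|].
  exact: avg_lipschitz gL.
have [h1 h2 h3] := nice f (a *: u) mf fC fL.
rewrite ih// (avg_normal_stable _ mf fC fL) scalerA [c * a]mulrC.
have [g1 g2 g3] := nice f ((a * c) *: u) mf fC fL.
by rewrite -[in RHS](avgs_avg _ _ _ g1 g2).
Qed.

Lemma gsteps_iter a s C L f m : cmeas f -> bounded_by C f -> lipschitz_fun L f ->
  avgs (gsteps a s) f = iter (2 ^ m) (avgs (gsteps (a * c ^+ m) s)) f.
Proof.
elim: m a f => [|m ih] a f mf fC fL; first by rewrite expr0 mulr1.
rewrite (gsteps_stable _ _ mf fC fL) expnS mul2n -addnn iterD.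
rewrite exprS mulrA -!ih//.
- exact: avgs_cmeas mf fC.
- exact: avgs_bounded.
- exact: avgs_lipschitz fL.
Qed.

(** A Gaussian operator is the [2 ^ m]-th iterate of the one with vectors scaled by [c ^ m]. This is
    profitable since two scaled operators differ by a quantity of order [(c ^ m) ^ 2], which is
    [2 ^ (- m)]. *)
Lemma gsteps_le s t C L e f m : cmeas f -> bounded_by C f -> lipschitz_fun L f ->
  (forall x, `|avgs (gsteps (c ^+ m) s) f x - avgs (gsteps (c ^+ m) t) f x| <= e) ->
  forall x, `|avgs (gsteps 1 s) f x - avgs (gsteps 1 t) f x| <= 2 ^+ m * e.
Proof.
move=> mf fC fL fe x; rewrite !(gsteps_iter _ _ m mf fC fL) !mul1r -natrX.
exact: avgs_iter_le mf fC fe x.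
Qed.

End gaussian_steps.

(** * Smooth test functions *)

Section smooth_functions.
Context {R : realType} (k : nat).
Implicit Types (f g : 'cV[R]_k -> R) (L : 'cV[R]_k -> 'cV[R]_k) (H : 'cV[R]_k -> 'M[R]_k).

(* [H x] stands for half of the Hessian matrix. *)
Definition taylor_rem f L H (x v : 'cV[R]_k) : R :=
  f (x + v) - f x - dotv (L x) v - dotv v (H x *m v).

(** Bounded functions with bounded first and second order coefficients and a uniformly cubic Taylor
    remainder. The coefficients are witnesses rather than derivatives, which makes stability under
    sums and products a matter of algebra. *)
Definition smooth3 f : Prop := exists C L H,
  [/\ cmeas f, bounded_by C f, forall x, `|L x| <= C, forall x, `|H x| <= C &
      forall x v, `|taylor_rem f L H x v| <= C * `|v| ^+ 3].

Lemma quad_le (v w : 'cV[R]_k) (H : 'M[R]_k) :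
  `|dotv v (H *m w)| <= k%:R * k%:R * `|H| * `|v| * `|w|.
Proof.
rewrite (le_trans (dotv_le _ _))//.
have := mx_normM H w => h.
have : k%:R * `|v| * `|H *m w| <= k%:R * `|v| * (k%:R * `|H| * `|w|).
  by rewrite ler_wpM2l// mulr_ge0.
by move=> /le_trans; apply; rewrite le_eqVlt; apply/orP; left; apply/eqP; ring.
Qed.

(* Beyond the unit ball the remainder is controlled by the bounds on the
   function and its derivatives. *)
Lemma smooth3_local C L H f : cmeas f -> bounded_by C f ->
  (forall x, `|L x| <= C) -> (forall x, `|H x| <= C) ->
  (forall x v, `|v| <= 1 -> `|taylor_rem f L H x v| <= C * `|v| ^+ 3) -> smooth3 f.
Proof.
move=> mf fC LC HC rC; have C0 : 0 <= C by rewrite (le_trans _ (fC 0)).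
have kk0 : 0 <= k%:R * k%:R :> R by rewrite mulr_ge0.
have k0 : 0 <= k%:R :> R by [].
have kC0 : 0 <= k%:R * C :> R by rewrite mulr_ge0.
have kkC0 : 0 <= k%:R * k%:R * C by rewrite mulr_ge0.
pose D := (C + C) + k%:R * C + k%:R * k%:R * C.
have CD : C <= D by rewrite /D; lra.
exists D, L, H; split=> //.
- by move=> x; exact: le_trans (fC x) CD.
- by move=> x; exact: le_trans (LC x) CD.
- by move=> x; exact: le_trans (HC x) CD.
move=> x v; have [v1|v1] := leP `|v| 1.
  by rewrite (le_trans (rC _ _ v1))// ler_wpM2r// exprn_ge0.
rewrite /taylor_rem.
have e1 : 1 <= `|v| ^+ 3 by rewrite exprn_ege1// ltW.
have e2 : `|v| <= `|v| ^+ 3 by rewrite ler_eXnr// ltW.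
have e3 : `|v| * `|v| <= `|v| ^+ 3 by rewrite -expr2 ler_eXn2l.
have h1 : `|f (x + v)| <= C * `|v| ^+ 3 by rewrite (le_trans (fC _))// ler_peMr.
have h2 : `|f x| <= C * `|v| ^+ 3 by rewrite (le_trans (fC _))// ler_peMr.
have h3 : `|dotv (L x) v| <= k%:R * C * `|v| ^+ 3.
  by rewrite (le_trans (dotv_le _ _))// ler_pM// ?mulr_ge0// ler_wpM2l.
have h4 : `|dotv v (H x *m v)| <= k%:R * k%:R * C * `|v| ^+ 3.
  rewrite (le_trans (quad_le _ _ _))// -[leLHS]mulrA ler_pM// ?mulr_ge0//.
  by rewrite ler_wpM2l.
rewrite (le_trans (ler_normB _ _))// /D mulrDl lerD//.
rewrite (le_trans (ler_normB _ _))// mulrDl lerD//.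
by rewrite (le_trans (ler_normB _ _))// mulrDl lerD.
Qed.

Lemma smooth3_cmeas f : smooth3 f -> cmeas f.
Proof. by case=> C [L [H []]]. Qed.

Lemma smooth3_bounded f : smooth3 f -> exists C, bounded_by C f.
Proof. by case=> C [L [H [_ fC _ _ _]]]; exists C. Qed.

Lemma smooth3_lipschitz f : smooth3 f -> exists D, lipschitz_fun D f.
Proof.
case=> C [L [H [mf fC LC HC rC]]]; have C0 : 0 <= C by rewrite (le_trans _ (fC 0)).
have kk0 : 0 <= k%:R * k%:R :> R by rewrite mulr_ge0.
have kC0 : 0 <= k%:R * C :> R by rewrite mulr_ge0.
have kkC0 : 0 <= k%:R * k%:R * C by rewrite mulr_ge0.
pose D := (C + C) + k%:R * C + k%:R * k%:R * C.
have main x v : `|f (x + v) - f x| <= D * `|v|.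
  have [v1|v1] := leP 1 `|v|.
    rewrite (le_trans (ler_normB _ _))// (le_trans (lerD (fC _) (fC _)))//.
    by rewrite -[leLHS]mulr1 ler_pM//; rewrite /D; lra.
  have e1 : `|v| ^+ 3 <= `|v| by rewrite exprS ler_piMr// exprn_ile1// ltW.
  have e2 : `|v| * `|v| <= `|v| by rewrite ler_piMr// ltW.
  have h3 : `|dotv (L x) v| <= k%:R * C * `|v|.
    by rewrite (le_trans (dotv_le _ _))// ler_wpM2r// ler_wpM2l.
  have h4 : `|dotv v (H x *m v)| <= k%:R * k%:R * C * `|v|.
    rewrite (le_trans (quad_le _ _ _))// -[leLHS]mulrA ler_pM// ?mulr_ge0//.
    by rewrite ler_wpM2l.
  have h5 : `|taylor_rem f L H x v| <= C * `|v|.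
    by rewrite (le_trans (rC _ _))// ler_wpM2l.
  have -> : f (x + v) - f x = taylor_rem f L H x v + dotv (L x) v + dotv v (H x *m v).
    by rewrite /taylor_rem; ring.
  rewrite /D !mulrDl (le_trans (ler_normD _ _))// lerD//.
  rewrite (le_trans (ler_normD _ _))// lerD//.
  by rewrite (le_trans h5)// lerDl mulr_ge0.
by exists D => x y; have := main y (x - y); rewrite [y + _]addrC subrK.
Qed.

Lemma smooth3_cst (a : R) : smooth3 (fun=> a).
Proof.
exists `|a|, (fun=> 0), (fun=> 0); split.
- by move=> d T Z mZ; exact: measurable_cst.
- by move=> x.
- by move=> x; rewrite normr0.
- by move=> x; rewrite normr0.
- move=> x v; rewrite /taylor_rem mul0mx dotv0r dotvC dotv0r subrr !subr0 normr0.
  by rewrite mulr_ge0// exprn_ge0.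
Qed.

Lemma smooth3D f g : smooth3 f -> smooth3 g -> smooth3 (fun x => f x + g x).
Proof.
move=> [C [L [H [mf fC LC HC rC]]]] [C' [L' [H' [mg gC LC' HC' rC']]]].
exists (C + C'), (fun x => L x + L' x), (fun x => H x + H' x); split.
- by move=> d T Z mZ; apply: measurable_funD; [exact: mf|exact: mg].
- by move=> x; rewrite (le_trans (ler_normD _ _))// lerD.
- by move=> x; rewrite (le_trans (ler_normD _ _))// lerD.
- by move=> x; rewrite (le_trans (ler_normD _ _))// lerD.
- move=> x v.
  have -> : taylor_rem (fun x => f x + g x) (fun x => L x + L' x) (fun x => H x + H' x) x v =
      taylor_rem f L H x v + taylor_rem g L' H' x v.
    by rewrite /taylor_rem mulmxDl dotvDr dotvDl; ring.
  by rewrite mulrDl (le_trans (ler_normD _ _))// lerD.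
Qed.

Lemma smooth3M f g : smooth3 f -> smooth3 g -> smooth3 (fun x => f x * g x).
Proof.
move=> [C [L [H [mf fC LC HC rC]]]] [C' [L' [H' [mg gC LC' HC' rC']]]].
have C0 : 0 <= C by rewrite (le_trans _ (fC 0)).
have C0' : 0 <= C' by rewrite (le_trans _ (gC 0)).
pose K := 1 + k%:R + k%:R * k%:R : R.
have k0 : 0 <= k%:R :> R by [].
have kk0 : 0 <= k%:R * k%:R :> R by rewrite mulr_ge0.
pose E := K * (C * C').
have CC0 : 0 <= C * C' by rewrite mulr_ge0.
have K1 : 1 <= K by rewrite /K; lra.
have EE : E <= E * K by rewrite ler_peMr// mulr_ge0//; lra.
(* Ten products of degree at least [3] remain when two second order expansions are multiplied; each
   is at most [E * K] times the cube of the norm inside the unit ball. *)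
pose F := 10 * (E * K).
have E0 : 0 <= E by rewrite mulr_ge0//; lra.
have CE : C * C' <= E by rewrite ler_peMl.
(* Since [H] is half of the Hessian, the cross term appears once; [L x *m (L' x)^T] is not
   symmetric, but only its quadratic form matters. *)
apply: (@smooth3_local F (fun x => f x *: L' x + g x *: L x)
  (fun x => f x *: H' x + g x *: H x + L x *m (L' x)^T)).
- by move=> d T Z mZ; apply: measurable_funM; [exact: mf|exact: mg].
- by move=> x; rewrite normrM (le_trans (ler_pM _ _ (fC x) (gC x)))// /F; lra.
- move=> x; rewrite (le_trans (ler_normD _ _))// !normrZ.
  have h1 : `|f x| * `|L' x| <= C * C' by rewrite ler_pM.
  have h2 : `|g x| * `|L x| <= C * C' by rewrite mulrC ler_pM.
  by rewrite /F; lra.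
- move=> x; rewrite (le_trans (ler_normD _ _))//.
  have h3 : `|L x *m (L' x)^T| <= C * C'.
    by rewrite (le_trans (mx_normM _ _))// mul1r ler_pM// mx_norm_tr.
  have h4 : `|f x *: H' x + g x *: H x| <= C * C' + C * C'.
    rewrite (le_trans (ler_normD _ _))// !normrZ lerD//; first by rewrite ler_pM.
    by rewrite [leRHS]mulrC ler_pM.
  by rewrite /F; lra.
- move=> x v v1; set a := dotv (L x) v; set b := dotv v (H x *m v).
  set a' := dotv (L' x) v; set b' := dotv v (H' x *m v).
  set r := taylor_rem f L H x v; set r' := taylor_rem g L' H' x v.
  have qE : dotv v ((f x *: H' x + g x *: H x + L x *m (L' x)^T) *m v) =
      f x * b' + g x * b + a * a'.
    rewrite !mulmxDl !dotvDr -!scalemxAl !dotvZr; congr (_ + _).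
    by rewrite dotvE -!mulmxA mulmxA mxE big_ord1 -!dotvE dotvC.
  have fv : f (x + v) = f x + a + b + r by rewrite /r /taylor_rem -/a -/b; ring.
  have gv : g (x + v) = g x + a' + b' + r' by rewrite /r' /taylor_rem -/a' -/b'; ring.
  rewrite /taylor_rem fv gv qE dotvDl !dotvZl -/a -/a'.
  set T := (X in `|X|).
  have -> : T = f x * r' + g x * r + a * b' + a * r' + b * a' + b * b' + b * r' +
    r * a' + r * b' + r * r' by rewrite /T; ring.
  have t0 := normr_ge0 v; set t := `|v| in v1 t0 *.
  have aC : `|a| <= K * C * t.
    rewrite (le_trans (dotv_le _ _))// ler_wpM2r// ler_pM//; rewrite /K; lra.
  have aC' : `|a'| <= K * C' * t.
    rewrite (le_trans (dotv_le _ _))// ler_wpM2r// ler_pM//; rewrite /K; lra.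
  have bC : `|b| <= K * C * t ^+ 2.
    rewrite (le_trans (quad_le _ _ _))// -mulrA -expr2 ler_wpM2r ?exprn_ge0//.
    by rewrite ler_pM//; rewrite /K; lra.
  have bC' : `|b'| <= K * C' * t ^+ 2.
    rewrite (le_trans (quad_le _ _ _))// -mulrA -expr2 ler_wpM2r ?exprn_ge0//.
    by rewrite ler_pM//; rewrite /K; lra.
  have rK : `|r| <= K * C * t ^+ 3.
    by rewrite (le_trans (rC _ _))// ler_wpM2r ?exprn_ge0// ler_peMl.
  have rK' : `|r'| <= K * C' * t ^+ 3.
    by rewrite (le_trans (rC' _ _))// ler_wpM2r ?exprn_ge0// ler_peMl.
  have fK : `|f x| <= K * C by rewrite (le_trans (fC x))// ler_peMl.
  have gK : `|g x| <= K * C' by rewrite (le_trans (gC x))// ler_peMl.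
  have tX m : (3 <= m)%N -> t ^+ m <= t ^+ 3 by move=> h; exact: ler_wiXn2l.
  have prod3 y z m n : (3 <= m + n)%N -> `|y| <= K * C * t ^+ m -> `|z| <= K * C' * t ^+ n ->
      `|y * z| <= E * K * t ^+ 3.
    move=> mn yA zB; rewrite normrM (le_trans (ler_pM _ _ yA zB))// mulrACA -exprD.
    have -> : K * C * (K * C') = E * K by rewrite /E; ring.
    by rewrite ler_wpM2l ?tX//; apply: mulr_ge0 => //; lra.
  rewrite -[t]expr1 in aC aC'; rewrite -[K * C]mulr1 -(expr0 t) in fK.
  rewrite -[K * C']mulr1 -(expr0 t) in gK.
  have p1 := prod3 _ _ 0%N 3%N isT fK rK'.
  have p2 := prod3 _ _ 3%N 0%N isT rK gK; rewrite mulrC in p2.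
  have p3 := prod3 _ _ 1%N 2%N isT aC bC'.
  have p4 := prod3 _ _ 1%N 3%N isT aC rK'.
  have p5 := prod3 _ _ 2%N 1%N isT bC aC'.
  have p6 := prod3 _ _ 2%N 2%N isT bC bC'.
  have p7 := prod3 _ _ 2%N 3%N isT bC rK'.
  have p8 := prod3 _ _ 3%N 1%N isT rK aC'.
  have p9 := prod3 _ _ 3%N 2%N isT rK bC'.
  have p10 := prod3 _ _ 3%N 3%N isT rK rK'.
  have -> : F * t ^+ 3 = E * K * t ^+ 3 + E * K * t ^+ 3 + E * K * t ^+ 3 +
    E * K * t ^+ 3 + E * K * t ^+ 3 + E * K * t ^+ 3 + E * K * t ^+ 3 +
    E * K * t ^+ 3 + E * K * t ^+ 3 + E * K * t ^+ 3 by rewrite /F; ring.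
  by do 9!(rewrite (le_trans (ler_normD _ _))// lerD//).
Qed.

Lemma smooth3_sum (I : Type) (s : seq I) (F : I -> 'cV[R]_k -> R) :
  (forall i, smooth3 (F i)) -> smooth3 (fun x => \sum_(i <- s) F i x).
Proof.
move=> sF; elim: s => [|i s ih].
  by under eq_fun do rewrite big_nil; exact: smooth3_cst.
by under eq_fun do rewrite big_cons; exact: smooth3D.
Qed.

Lemma smooth3_prod (I : Type) (s : seq I) (F : I -> 'cV[R]_k -> R) :
  (forall i, smooth3 (F i)) -> smooth3 (fun x => \prod_(i <- s) F i x).
Proof.
move=> sF; elim: s => [|i s ih].
  by under eq_fun do rewrite big_nil; exact: smooth3_cst.
by under eq_fun do rewrite big_cons; exact: smooth3M.
Qed.

Lemma smooth3_coordinate (g g1 g2 : R -> R) (C a b : R) (i : 'I_k) :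
  measurable_fun setT g -> (forall y, `|g y| <= C) -> (forall y, `|g1 y| <= C) ->
  (forall y, `|g2 y| <= C) ->
  (forall y t, `|g (y + t) - g y - g1 y * t - g2 y * t ^+ 2| <= C * `|t| ^+ 3) ->
  smooth3 (fun x => g (a * x i ord0 + b)).
Proof.
move=> mg gC gC1 gC2 gr; have C0 : 0 <= C by rewrite (le_trans _ (gC 0)).
pose K := 1 + `|a| + `|a| ^+ 2 + `|a| ^+ 3.
have a0 := normr_ge0 a; have a20 : 0 <= `|a| ^+ 2 by rewrite exprn_ge0.
have a30 : 0 <= `|a| ^+ 3 by rewrite exprn_ge0.
have K1 : 1 <= K by rewrite /K; lra.
have CK : C <= C * K by rewrite ler_peMr.
have dE : `|delta_mx i ord0 : 'cV[R]_k| <= 1.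
  by apply: mx_norm_le => // p q; rewrite mxE; case: (_ && _); rewrite ?normr1 ?normr0.
have dotE (v : 'cV[R]_k) : dotv (delta_mx i ord0) v = v i ord0.
  rewrite /dotv (bigD1 i)//= mxE !eqxx mul1r big1 ?addr0// => j ji.
  by rewrite mxE (negPf ji) mul0r.
exists (C * K), (fun x => (a * g1 (a * x i ord0 + b)) *: delta_mx i ord0),
  (fun x => (a ^+ 2 * g2 (a * x i ord0 + b)) *:
     (delta_mx i ord0 *m (delta_mx i ord0 : 'cV[R]_k)^T)); split.
- move=> d T Z mZ; apply: (measurableT_comp mg).
  by apply: measurable_funD => //; apply: measurable_funM => //; exact: mZ.
- by move=> x; rewrite (le_trans (gC _)).
- move=> x; rewrite normrZ normrM -[leRHS]mulr1 ler_pM// ?mulr_ge0// mulrC ler_pM//.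
  by rewrite /K; lra.
- move=> x; rewrite normrZ normrM normrX -[leRHS]mulr1 ler_pM// ?mulr_ge0//.
    by rewrite mulrC ler_pM//; rewrite /K; lra.
  rewrite (le_trans (mx_normM _ _))// mul1r mx_norm_tr -[leRHS]mulr1 ler_pM//.
- move=> x v.
  have -> : taylor_rem (fun x => g (a * x i ord0 + b))
     (fun x => (a * g1 (a * x i ord0 + b)) *: delta_mx i ord0)
     (fun x => (a ^+ 2 * g2 (a * x i ord0 + b)) *:
     (delta_mx i ord0 *m (delta_mx i ord0 : 'cV[R]_k)^T)) x v =
     g (a * x i ord0 + b + a * v i ord0) - g (a * x i ord0 + b) -
       g1 (a * x i ord0 + b) * (a * v i ord0) - g2 (a * x i ord0 + b) * (a * v i ord0) ^+ 2.
    rewrite /taylor_rem mxE dotvZl dotE -scalemxAl dotvZr -mulmxA dotv_mulmx.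
    have -> : (delta_mx i ord0 : 'cV[R]_k)^T *m v = (v i ord0)%:M.
      by rewrite [LHS]mx11_scalar -dotvE dotE.
    rewrite [dotv _ _](_ : _ = v i ord0 ^+ 2); last first.
      by rewrite /dotv big_ord1 !mxE expr2 eqxx mulr1n.
    have -> : a * (x i ord0 + v i ord0) + b = a * x i ord0 + b + a * v i ord0 by ring.
    by ring.
  rewrite (le_trans (gr _ _))// normrM exprMn mulrA ler_pM ?mulr_ge0 ?exprn_ge0//.
    by rewrite ler_wpM2l// /K; lra.
  by rewrite lerXn2r ?nnegrE// mx_norm_entry.
Qed.

End smooth_functions.

(** * Spline approximation and convergence in law *)

Section cubic_spline.
Context {R : realType}.
Implicit Types (y t : R).

Definition pospart y : R := Num.max y 0.

Lemma pospartP y : (0 <= y /\ pospart y = y) \/ (y <= 0 /\ pospart y = 0).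
Proof.
rewrite /pospart; case: (leP 0 y) => y0; [left|right; split=> //].
  by split=> //; exact/max_idPl.
exact: ltW.
Qed.

(** The cube of the positive part has second derivative [6 * pospart], which is [6]-Lipschitz; hence
    a cubic remainder with constant [6 / 6 = 1]. *)
Lemma pospart_taylor y t :
  `|pospart (y + t) ^+ 3 - pospart y ^+ 3 - 3 * pospart y ^+ 2 * t
    - 3 * pospart y * t ^+ 2| <= `|t| ^+ 3.
Proof.
rewrite -normrX.
case: (pospartP (y + t)) => -[h1 ->]; case: (pospartP y) => -[h2 ->].
- have -> : (y + t) ^+ 3 - y ^+ 3 - 3 * y ^+ 2 * t - 3 * y * t ^+ 2 = t ^+ 3 by ring.
  by [].
- have -> : (y + t) ^+ 3 - 0 ^+ 3 - 3 * 0 ^+ 2 * t - 3 * 0 * t ^+ 2 = (y + t) ^+ 3 by ring.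
  rewrite !normrX lerXn2r ?nnegrE//.
  by rewrite !ger0_norm//; lra.
- have t0 : t <= 0 by lra.
  have -> : 0 ^+ 3 - y ^+ 3 - 3 * y ^+ 2 * t - 3 * y * t ^+ 2 = t ^+ 3 - (y + t) ^+ 3 :> R.
    by rewrite expr0n/=; ring.
  have e3 (a : R) : a <= 0 -> a ^+ 3 <= 0.
    by move=> a0; rewrite exprS mulr_le0_ge0// sqr_ge0.
  have h3 := e3 _ t0; have h4 := e3 _ h1.
  have h5 : t ^+ 3 <= (y + t) ^+ 3.
    rewrite -subr_ge0; have -> : (y + t) ^+ 3 - t ^+ 3 = y * (y ^+ 2 + 3 * (t * (y + t)) ).
      by ring.
    by rewrite mulr_ge0// addr_ge0 ?sqr_ge0// mulr_ge0// mulr_le0.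
  rewrite !ler0_norm//; last by rewrite subr_le0.
  lra.
- have -> : 0 ^+ 3 - 0 ^+ 3 - 3 * 0 ^+ 2 * t - 3 * 0 * t ^+ 2 = 0 by ring.
  by rewrite normr0.
Qed.

(* The integral of the quadratic B-spline; [step1] and [step2] are its derivative
   and half of its second derivative. *)
Definition smooth_step y : R := (pospart y ^+ 3 - 3 * pospart (y - 1) ^+ 3
  + 3 * pospart (y - 2) ^+ 3 - pospart (y - 3) ^+ 3) / 6.
Definition step1 y : R := (pospart y ^+ 2 - 3 * pospart (y - 1) ^+ 2
  + 3 * pospart (y - 2) ^+ 2 - pospart (y - 3) ^+ 2) / 2.
Definition step2 y : R := (pospart y - 3 * pospart (y - 1)
  + 3 * pospart (y - 2) - pospart (y - 3)) / 2.

(** The remainder is a combination of four remainders of cubes, with total weight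
    [(1 + 3 + 3 + 1) / 6 <= 2]. *)
Lemma step_taylor y t :
  `|smooth_step (y + t) - smooth_step y - step1 y * t - step2 y * t ^+ 2| <= 2 * `|t| ^+ 3.
Proof.
pose r (z : R) := pospart (z + t) ^+ 3 - pospart z ^+ 3 - 3 * pospart z ^+ 2 * t
    - 3 * pospart z * t ^+ 2.
have rE : smooth_step (y + t) - smooth_step y - step1 y * t - step2 y * t ^+ 2 =
    (r y - 3 * r (y - 1) + 3 * r (y - 2) - r (y - 3)) / 6.
  rewrite /r /smooth_step /step1 /step2 ![y + t - _]addrAC.
  move: (pospart (y + t)) (pospart (y - 1 + t)) (pospart (y - 2 + t)) (pospart (y - 3 + t)).
  move: (pospart y) (pospart (y - 1)) (pospart (y - 2)) (pospart (y - 3)) => *; lra.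
have := pospart_taylor y t; have := pospart_taylor (y - 1) t.
have := pospart_taylor (y - 2) t; have := pospart_taylor (y - 3) t.
rewrite rE -/(r y) -/(r (y - 1)) -/(r (y - 2)) -/(r (y - 3)).
have := exprn_ge0 3 (normr_ge0 t).
move: (`|t| ^+ 3) (r y) (r (y - 1)) (r (y - 2)) (r (y - 3)) => T a b c e T0.
rewrite !ler_norml => /andP[? ?] /andP[? ?] /andP[? ?] /andP[? ?].
apply/andP; split; lra.
Qed.

Lemma step_le0 y : y <= 0 -> smooth_step y = 0.
Proof.
move=> y0; have p0 z : z <= 0 -> pospart z = 0 by move=> z0; exact/max_idPr.
by rewrite /smooth_step !p0; try lra; rewrite expr0n/=; lra.
Qed.

Lemma step_ge3 y : 3 <= y -> smooth_step y = 1.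
Proof.
move=> y3; have p0 z : 0 <= z -> pospart z = z by move=> z0; exact/max_idPl.
by rewrite /smooth_step !p0; try lra; field.
Qed.

Lemma step_bounds y : 0 <= smooth_step y <= 1.
Proof.
have sqr0 := @sqr_ge0 R.
case: (leP y 0) => y0; first by rewrite step_le0 ?lexx ?ler01.
case: (leP 3 y) => y3; first by rewrite step_ge3// lexx ler01.
rewrite /smooth_step.
case: (pospartP y) => -[h1 ->]; first last; first by exfalso; lra.
case: (pospartP (y - 3)) => -[h4 ->]; first by exfalso; lra.
case: (pospartP (y - 1)) => -[h2 ->]; case: (pospartP (y - 2)) => -[h3 ->];
  rewrite ?expr0n/=.
(* On [[2, 3]] the step equals [1 - (3 - y) ^ 3 / 6]. *)
- have h : 0 <= (3 - y) ^+ 3 by rewrite exprn_ge0//; lra.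
  have h' : (3 - y) ^+ 3 <= 1 by rewrite exprn_ile1//; lra.
  apply/andP; split; lra.
- have -> : y = (y - 1) + 1 by lra.
  have : y - 1 <= 1 by lra.
  move: (y - 1) h2 => z z0 z1; rewrite addrK.
  have := mulr_ge0 z0 z0; have : 0 <= z * z * (1 - z) by rewrite !mulr_ge0//; lra.
  have : 0 <= z * (1 - z) by rewrite !mulr_ge0//; lra.
  have : 0 <= z * (1 - z) * (1 - z) by rewrite !mulr_ge0//; lra.
  move=> *; apply/andP; split; lra.
- by exfalso; lra.
- have h : 0 <= y ^+ 3 by rewrite exprn_ge0//; lra.
  have h' : y ^+ 3 <= 1 by rewrite exprn_ile1//; lra.
  apply/andP; split; lra.
Qed.

Lemma step1_bounds y : `|step1 y| <= 2.
Proof.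
have p0 z : z <= 0 -> pospart z = 0 by move=> z0; exact/max_idPr.
have p1 z : 0 <= z -> pospart z = z by move=> z0; exact/max_idPl.
have small (z : R) : `|z| <= 3 -> 0 <= pospart z ^+ 2 <= 9.
  move=> z3; rewrite sqr_ge0/=.
  case: (pospartP z) => -[h ->]; last by rewrite expr0n.
  by move: z3; rewrite ger0_norm// => z3; nra.
rewrite /step1.
case: (leP y 0) => y0.
  by rewrite !p0; try lra; rewrite expr0n/= !mulr0 !subr0 addr0 mul0r normr0.
case: (leP 3 y) => y3.
  rewrite !p1; try lra.
  by rewrite [X in `|X|](_ : _ = 0) ?normr0//; field.
case: (pospartP y) => -[h1 ->]; first last; first by exfalso; lra.
case: (pospartP (y - 3)) => -[h4 ->]; first by exfalso; lra.
case: (pospartP (y - 1)) => -[h2 ->]; case: (pospartP (y - 2)) => -[h3 ->];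
  rewrite ?expr0n/= ler_norml; apply/andP; split; nra.
Qed.

Lemma step2_bounds y : `|step2 y| <= 2.
Proof.
rewrite /step2.
case: (pospartP y) => -[h1 ->]; case: (pospartP (y - 1)) => -[h2 ->];
case: (pospartP (y - 2)) => -[h3 ->]; case: (pospartP (y - 3)) => -[h4 ->];
  rewrite ler_norml; apply/andP; split; lra.
Qed.

Lemma measurable_step : measurable_fun setT smooth_step.
Proof.
have mp (a : R) : measurable_fun setT (fun y : R => pospart (y - a) ^+ 3).
  apply: measurable_funX; apply: measurable_maxr => //.
  exact: measurable_funB.
rewrite /smooth_step; apply: measurable_funM => //; apply: measurable_funB => //.
apply: measurable_funD; last exact: measurable_funM.
apply: measurable_funB; last exact: measurable_funM.
by have := mp 0; under eq_fun do rewrite subr0.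
Qed.

(* The cubic B-spline. *)
Definition spline_bump y : R := smooth_step y - smooth_step (y - 1).

Lemma spline_bump_ge0 y : 0 <= spline_bump y.
Proof.
case: (leP y 0) => y0; first by rewrite /spline_bump !step_le0 ?subrr//; lra.
case: (leP 4 y) => y4; first by rewrite /spline_bump !step_ge3 ?subrr//; lra.
rewrite /spline_bump /smooth_step.
have -> : y - 1 - 1 = y - 2 by ring.
have -> : y - 1 - 2 = y - 3 by ring.
have -> : y - 1 - 3 = y - 4 by ring.
case: (pospartP y) => -[h1 ->]; first last; first by exfalso; lra.
case: (pospartP (y - 4)) => -[h5 ->]; first by exfalso; lra.
case: (pospartP (y - 1)) => -[h2 ->]; case: (pospartP (y - 2)) => -[h3 ->];
case: (pospartP (y - 3)) => -[h4 ->]; rewrite ?expr0n/=; try by (exfalso; lra).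
- have h : 0 <= (4 - y) ^+ 3 by rewrite exprn_ge0//; lra.
  lra.
- have : 3 - y <= 1 by lra.
  have -> : y = 3 - (3 - y) by lra.
  have : 0 <= 3 - y by lra.
  move: (3 - y) => z z0 z1.
  have := mulr_ge0 z0 z0; have : 0 <= z * z * (1 - z) by rewrite !mulr_ge0//; lra.
  have : 0 <= z * (1 - z) by rewrite !mulr_ge0//; lra.
  have : 0 <= z * (1 - z) * (1 - z) by rewrite !mulr_ge0//; lra.
  move=> *; lra.
- have : y - 1 <= 1 by lra.
  have -> : y = (y - 1) + 1 by lra.
  move: (y - 1) h2 => z z0 z1; rewrite addrK.
  have := mulr_ge0 z0 z0; have : 0 <= z * z * (1 - z) by rewrite !mulr_ge0//; lra.
  have : 0 <= z * (1 - z) by rewrite !mulr_ge0//; lra.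
  have : 0 <= z * (1 - z) * (1 - z) by rewrite !mulr_ge0//; lra.
  move=> *; lra.
- have h : 0 <= y ^+ 3 by rewrite exprn_ge0//; lra.
  lra.
Qed.

Lemma spline_bump_support y : spline_bump y != 0 -> 0 < y < 4.
Proof.
apply: contraR; rewrite negb_and -!leNgt => /orP[y0|y4]; apply/eqP.
  by rewrite /spline_bump !step_le0 ?subrr//; lra.
by rewrite /spline_bump !step_ge3 ?subrr//; lra.
Qed.

Lemma spline_bump_sum y (n : nat) : \sum_(j < n) spline_bump (y - j%:R) = smooth_step y - smooth_step (y - n%:R).
Proof.
elim: n => [|n ih]; first by rewrite big_ord0 subr0 subrr.
rewrite big_ord_recr/= ih /spline_bump -natr1.
have -> : y - (n%:R + 1) = y - n%:R - 1 by ring.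
by rewrite addrA subrK.
Qed.

Lemma smooth3_bump k (a b : R) (i : 'I_k) :
  smooth3 (fun x : 'cV[R]_k => spline_bump (a * x i ord0 + b)).
Proof.
have sm (b' : R) : smooth3 (fun x : 'cV[R]_k => smooth_step (a * x i ord0 + b')).
  apply: (@smooth3_coordinate _ _ smooth_step step1 step2 2).
  - exact: measurable_step.
  - by move=> y; have /andP[h1 h2] := step_bounds y; rewrite ger0_norm//; lra.
  - exact: step1_bounds.
  - exact: step2_bounds.
  - exact: step_taylor.
have := smooth3D (sm b) (smooth3M (smooth3_cst k (-1)) (sm (b - 1))).
by congr smooth3; apply/funext => x; rewrite /spline_bump mulN1r addrA.
Qed.

End cubic_spline.

(** * Approximation by tensor products of splines *)

Section spline_approximation.
Context {R : realType} (k : nat).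
Implicit Types (f : 'cV[R]_k -> R) (x y : 'cV[R]_k).

Lemma cube_compact (B : R) : compact [set x : 'cV[R]_k | `|x| <= B].
Proof.
have [B0|B0] := ltP B 0.
  rewrite (_ : [set x | _] = set0); first exact: compact0.
  by apply/seteqP; split=> x //= h; have := le_lt_trans h B0; rewrite normr_lt0.
pose D := [set v : 'rV[R]_k | forall i, `[- B, B]%classic (v ord0 i)].
have cD : compact D by apply: (@rV_compact R k (fun=> `[- B, B]%classic)) => i; exact: segment_compact.
have -> : [set x : 'cV[R]_k | `|x| <= B] = image D (@trmx R 1 k).
  apply/seteqP; split=> [x /= xB|_ [v vB <-] /=].
    exists x^T; last by rewrite trmxK.
    move=> i /=; rewrite mxE in_itv/= -ler_norml.
    exact: le_trans (mx_norm_entry _ _ _) xB.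
  apply: mx_norm_le => // i j; rewrite mxE ord1.
  by have := vB i; rewrite /= in_itv/= -ler_norml.
apply: continuous_compact cD; apply: continuous_subspaceT => v.
move=> A /nbhs_ballP[e e0 eA]; apply/nbhs_ballP; exists e => // w [_ vw].
by apply: eA; split=> // i l; rewrite !mxE.
Qed.

(** Compactness makes the rank uniform. The radius [4 / n] is the side of the support of a bump on
    the grid of mesh [1 / n]; only [x] has to lie in the cube. *)
Lemma uniform_continuity_on_cube f (B e : R) : continuous f -> 0 < e ->
  \forall n \near \oo, forall x, `|x| <= B ->
    forall y, `|x - y| <= 4 / n%:R -> `|f x - f y| <= e.
Proof.
move=> cf e0; have e2 : 0 < e / 2 by rewrite divr_gt0.
have /compact_near_coveringP cB := @cube_compact B.
apply: (cB nat \oo (fun n x => forall y, `|x - y| <= 4 / n%:R -> `|f x - f y| <= e)).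
move=> x _.
have /cvgrPdist_le/(_ _ e2) := cf x; rewrite near_nbhs => /nbhs_ballP[r r0 rB].
have r2 : 0 < r / 2 by rewrite divr_gt0.
near=> x' n => y xy.
have h1 : `|x - x'| < r / 2 by near: x'; exact: cvgr_dist_lt.
have h2 : `|x' - y| < r / 2.
  rewrite (le_lt_trans xy)//.
  have : 8 / r + 1 <= n%:R by near: n; exact: nbhs_infty_ger.
  have r8 : 0 <= 8 / r by rewrite divr_ge0// ltW.
  move=> hn; have n0 : 0 < n%:R :> R by lra.
  rewrite ltr_pdivrMr//.
  have : r * (8 / r + 1) <= r * n%:R by rewrite ler_pM2l.
  have -> : r * (8 / r + 1) = 8 + r by field; rewrite gt_eqF.
  lra.
have fx' : `|f x - f x'| <= e / 2.
  by apply: rB; rewrite -ball_normE /=; lra.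
have fy : `|f x - f y| <= e / 2.
  apply: rB; rewrite -ball_normE /=.
  by rewrite -(subrKA x') (le_lt_trans (ler_normD _ _))//; lra.
rewrite -(subrKA (f x)) (le_trans (ler_normD _ _))// distrC; lra.
Unshelve. all: by end_near. Qed.

(** A tensor product of cubic B-splines, supported by the cube of side [4 / N] whose lower corner is
    [grid_node N q]. The shift by [K] makes the indices below [2 * K] cover both signs. *)
Definition grid_bump (N K : nat) (q : {ffun 'I_k -> 'I_(2 * K)}) x : R :=
  \prod_i spline_bump (N%:R * x i ord0 + (K%:R - (q i)%:R)).

Definition grid_node (N K : nat) (q : {ffun 'I_k -> 'I_(2 * K)}) : 'cV[R]_k :=
  \col_i (((q i)%:R - K%:R) / N%:R).

(** The partition of unity by B-splines restricted to a finite grid. It serves as a smooth cutoff,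
    and in each coordinate its sum telescopes. *)
Definition plateau (N K : nat) x : R := \sum_(q : {ffun 'I_k -> 'I_(2 * K)}) grid_bump N q x.

Definition quasi_interpolant (N K : nat) f x : R :=
  \sum_(q : {ffun 'I_k -> 'I_(2 * K)}) f (grid_node N q) * grid_bump N q x.

Lemma smooth3_grid_bump (N K : nat) (q : {ffun 'I_k -> 'I_(2 * K)}) : smooth3 (grid_bump N q).
Proof. by apply: smooth3_prod => i; exact: smooth3_bump. Qed.

Lemma smooth3_plateau N K : smooth3 (plateau N K).
Proof. by apply: smooth3_sum => q; exact: smooth3_grid_bump. Qed.

Lemma smooth3_quasi_interpolant N K f : smooth3 (quasi_interpolant N K f).
Proof.
by apply: smooth3_sum => q; apply: smooth3M; [exact: smooth3_cst|exact: smooth3_grid_bump].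
Qed.

Lemma grid_bump_ge0 N K (q : {ffun 'I_k -> 'I_(2 * K)}) x : 0 <= grid_bump N q x.
Proof. by apply: prodr_ge0 => i _; exact: spline_bump_ge0. Qed.

Lemma plateauE N K x : plateau N K x =
  \prod_i (smooth_step (N%:R * x i ord0 + K%:R) - smooth_step (N%:R * x i ord0 - K%:R)).
Proof.
rewrite /plateau /grid_bump.
rewrite -(bigA_distr_bigA (fun i (j : 'I_(2 * K)) => spline_bump (N%:R * x i ord0 + (K%:R - j%:R)))).
apply: eq_bigr => i _; under eq_bigr do rewrite addrA.
rewrite (spline_bump_sum (N%:R * x i ord0 + K%:R) (2 * K)); congr (_ - smooth_step _).
by rewrite mul2n -addnn natrD; ring.
Qed.

Lemma plateau_ge0 N K x : 0 <= plateau N K x.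
Proof. by apply: sumr_ge0 => q _; exact: grid_bump_ge0. Qed.

Lemma plateau_le1 N K x : plateau N K x <= 1.
Proof.
rewrite plateauE; apply: prodr_ile1 => i _.
have /andP[h1 h2] := step_bounds (N%:R * x i ord0 + K%:R).
have /andP[h3 h4] := step_bounds (N%:R * x i ord0 - K%:R).
apply/andP; split; last lra.
have -> : N%:R * x i ord0 - K%:R = N%:R * x i ord0 + K%:R - (2 * K)%:R.
  by rewrite mul2n -addnn natrD; ring.
by rewrite -spline_bump_sum; apply: sumr_ge0 => j _; exact: spline_bump_ge0.
Qed.

(** The summand [3] is the length on which [smooth_step] rises from [0] to [1]. *)
Lemma plateau1 N b x : `|x| <= b%:R -> plateau N (N * b + 3) x = 1.
Proof.
move=> xb; rewrite plateauE big1// => i _.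
have : `|x i ord0| <= b%:R by exact: le_trans (mx_norm_entry _ _ _) xb.
rewrite ler_norml => /andP[h1 h2].
have N0 : 0 <= N%:R :> R by [].
by rewrite step_ge3 ?step_le0 ?subr0// natrD natrM; nra.
Qed.

(** Since the bumps sum to [chi], [f - h] is an average of [f x - f (grid_node N q)], over nodes
    within [4 / N] of [x], plus [f x * (1 - chi x)]. As [chi] is smooth too, the error outside the
    cube can be integrated under any law for which smooth test functions converge. *)
Lemma spline_approximation f (M e : R) (b : nat) : continuous f ->
  (forall x, `|f x| <= M) -> 0 < e -> exists h chi : 'cV[R]_k -> R,
  [/\ smooth3 h, smooth3 chi, forall x, 0 <= chi x <= 1,
      forall x, `|x| <= b%:R -> chi x = 1 &
      forall x, `|f x - h x| <= e + M * (1 - chi x)].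
Proof.
move=> cf fM e0.
(* The nodes have norm at most [(N * b + 3) / N], hence at most [b + 3]: uniform continuity is
   applied at the node, not at [x], which is arbitrary. *)
have [N [N0 hN]] : exists N : nat, (0 < N)%N /\ forall x, `|x| <= (b + 3)%:R ->
    forall y, `|x - y| <= 4 / N%:R -> `|f x - f y| <= e.
  have [N _ hN] := uniform_continuity_on_cube (b + 3)%:R cf e0.
  by exists N.+1; split=> //; apply: hN => /=.
have N0R : 0 < N%:R :> R by rewrite ltr0n.
pose K := (N * b + 3)%N.
exists (quasi_interpolant N K f), (plateau N K); split.
- exact: smooth3_quasi_interpolant.
- exact: smooth3_plateau.
- by move=> x; rewrite plateau_ge0 plateau_le1.
- by move=> x; exact: plateau1.
move=> x; have c1 := plateau_le1 N K x; have c0 := plateau_ge0 N K x.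
have -> : f x - quasi_interpolant N K f x =
    \sum_(q : {ffun 'I_k -> 'I_(2 * K)}) (f x - f (grid_node N q)) * grid_bump N q x +
    f x * (1 - plateau N K x).
  rewrite /quasi_interpolant mulrBr mulr1 /plateau mulr_sumr.
  under [X in _ = X + _]eq_bigr do rewrite mulrBl.
  by rewrite sumrB; ring.
rewrite (le_trans (ler_normD _ _))// lerD//; last first.
  by rewrite normrM ler_pM// ger0_norm//; lra.
apply: (@le_trans _ _ (e * plateau N K x)); last by rewrite ler_piMr// ltW.
rewrite (le_trans (ler_norm_sum _ _ _))// /plateau mulr_sumr; apply: ler_sum => q _.
rewrite normrM (ger0_norm (grid_bump_ge0 N q x)).
have [->|pN0] := eqVneq (grid_bump N q x) 0; first by rewrite !mulr0.
rewrite ler_wpM2r ?grid_bump_ge0// distrC; apply: hN.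
  apply: mx_norm_le => // i j; rewrite mxE normrM normfV (gtr0_norm N0R) ler_pdivrMr//.
  have qK : (q i)%:R <= K%:R + K%:R :> R.
    by rewrite -natrD ler_nat addnn -mul2n ltnW.
  have q0 : 0 <= (q i)%:R :> R by [].
  apply: (@le_trans _ _ K%:R); first by rewrite ler_norml; apply/andP; split; lra.
  by rewrite -natrM ler_nat /K mulnDl [(b * N)%N]mulnC leq_add2l leq_pmulr.
apply: mx_norm_le => [|i j]; first by rewrite divr_ge0.
rewrite !mxE ord1.
have /spline_bump_support/andP[h1 h2] : spline_bump (N%:R * x i ord0 + (K%:R - (q i)%:R)) != 0.
  by move: pN0; rewrite /grid_bump (bigD1 i)//= mulf_eq0 negb_or => /andP[].
have -> : ((q i)%:R - K%:R) / N%:R - x i ord0 =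
   - (N%:R * x i ord0 + (K%:R - (q i)%:R)) / N%:R by field; rewrite gt_eqF.
rewrite normrM normrN normfV (gtr0_norm N0R) ler_wpM2r ?invr_ge0// ger0_norm; lra.
Qed.

(** A pointwise limit of smooth approximations on growing cubes, each of which is measurable along
    random vectors. *)
Lemma continuous_cmeas f (M : R) : continuous f -> (forall x, `|f x| <= M) -> cmeas f.
Proof.
move=> cf fM d T Z mZ.
have h_ (n : nat) : {h : 'cV[R]_k -> R | smooth3 h /\
    forall x, `|x| <= n%:R -> `|f x - h x| <= n.+1%:R^-1}.
  apply: cid.
  have [|h [chi [sh _ _ c1 fh]]] := @spline_approximation f M n.+1%:R^-1 n cf fM.
    by rewrite invr_gt0.
  exists h; split=> // x xn; have := fh x; rewrite (c1 _ xn) subrr mulr0 addr0.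
  exact.
apply: (@measurable_fun_cvg _ _ R setT (fun n => sval (h_ n) \o Z)).
  by move=> n; apply: (smooth3_cmeas (svalP (h_ n)).1).
move=> w _; apply/cvgrPdist_le => e e0; near=> n.
have hn : `|Z w| <= n%:R by near: n; exact: nbhs_infty_ger.
rewrite (le_trans ((svalP (h_ n)).2 _ hn))//.
have en : e^-1 <= n%:R by near: n; exact: nbhs_infty_ger.
rewrite -[leRHS]invrK lef_pV2 ?posrE ?invr_gt0// (le_trans en)// ler_nat.
exact: leqnSn.
Unshelve. all: by end_near. Qed.

End spline_approximation.

(** * From smooth to continuous bounded test functions *)

Section portmanteau.
Context {R : realType} (k : nat).
Implicit Types (f : 'cV[R]_k -> R).

Definition tail (b : nat) (x : 'cV[R]_k) : R := Num.min 1 (Num.max 0 (`|x| - b%:R)).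

Lemma tail_ge0 b x : 0 <= tail b x.
Proof. by rewrite /tail le_min ler01 le_max lexx. Qed.

Lemma tail_le1 b x : tail b x <= 1.
Proof. by rewrite /tail ge_min lexx. Qed.

Lemma tail_bounded b : bounded_by 1 (tail b).
Proof. by move=> x; rewrite ger0_norm ?tail_ge0 ?tail_le1. Qed.

Lemma tail_eq0 b x : `|x| <= b%:R -> tail b x = 0.
Proof.
move=> xb; rewrite /tail (max_idPl _) ?subr_le0//.
by apply/min_idPr; exact: ler01.
Qed.

Lemma tail_eq1 b x : b.+1%:R <= `|x| -> tail b x = 1.
Proof.
rewrite -natr1 => xb; rewrite /tail; apply/min_idPl.
by rewrite le_max; apply/orP; right; lra.
Qed.

Lemma tail_continuous b : continuous (tail b).
Proof.
have c1 (a : R) : continuous (fun _ : 'cV[R]_k => a) by move=> x; exact: (@cst_continuous _ R a).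
have c2 : continuous (fun x : 'cV[R]_k => `|x| - b%:R).
  move=> x; apply: (@cvgB _ _ _ (nbhs x)); last exact: cvg_cst.
  exact: norm_continuous.
move=> x; apply: (@continuous_min _ _ (fun=> 1) (fun x => Num.max 0 (`|x| - b%:R))).
  exact: c1.
by apply: (@continuous_max _ _ (fun=> 0) (fun x => `|x| - b%:R)); [exact: c1|exact: c2].
Qed.

Lemma tail_cmeas b : cmeas (tail b).
Proof. exact: continuous_cmeas (@tail_continuous b) (tail_bounded b). Qed.

Lemma tail_vanishes d (T : measurableType d) (P : probability T R) (G : T -> 'cV[R]_k) :
  random_vector G -> \int[P]_w tail b (G w) @[b --> \oo] --> (0 : R).
Proof.
move=> mG; rewrite -(Rintegral_prob_cst P 0).
apply: (@Rdominated_cvg _ _ _ P (fun b w => tail b (G w)) (fun=> 0) (fun=> 1)).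
- by move=> b; exact: tail_cmeas.
- exact: finite_measure_integrable_cst.
- move=> w; apply/cvgrPdist_le => e e0; near=> b.
  rewrite tail_eq0 ?subrr ?normr0 ?(ltW e0)//.
  by near: b; exact: nbhs_infty_ger.
- by move=> b w; exact: tail_bounded.
Unshelve. all: by end_near. Qed.

Lemma expectation_Rintegral d (T : measurableType d) (P : probability T R) (X : T -> R) :
  P.-integrable setT (EFin \o X) -> 'E_P[X]%E = (\int[P]_w X w)%:E.
Proof.
move=> Xi; rewrite unlock /Rintegral fineK//; exact: (integrable_fin_num _ Xi).
Qed.

Lemma cmeas_integrable d (T : measurableType d) (P : probability T R)
    (Z : T -> 'cV[R]_k) f (C : R) : random_vector Z -> cmeas f -> bounded_by C f ->
  P.-integrable setT (EFin \o (fun w => f (Z w))).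
Proof.
move=> mZ mf fC; apply: (@bounded_integrable _ _ _ _ _ C) => [|w]; last exact: fC.
exact: (mf _ _ Z mZ).
Qed.

(** The cutoff [chi] is itself a smooth test function, so that its expectations converge: the
    tightness of the single vector [G] passes to the sequence [Z]. *)
Lemma smooth_test_functions d (T : measurableType d) (P : probability T R)
    d' (T' : measurableType d') (P' : probability T' R)
    (Z : nat -> T -> 'cV[R]_k) (G : T' -> 'cV[R]_k) :
  (forall n, random_vector (Z n)) -> random_vector G ->
  (forall f, smooth3 f -> \int[P]_w f (Z n w) @[n --> \oo] --> \int[P']_w f (G w)) ->
  cvg_in_law P P' Z G.
Proof.
move=> mZ mG cvgZ f cf [M fM].
have M0 : 0 <= M by rewrite (le_trans _ (fM 0)).
have mf := continuous_cmeas cf fM.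
have fi d0 (T0 : measurableType d0) (P0 : probability T0 R) (V : T0 -> 'cV[R]_k) :
    random_vector V -> P0.-integrable setT (EFin \o (fun w => f (V w))).
  by move=> mV; exact: cmeas_integrable mV mf fM.
rewrite expectation_Rintegral; last exact: fi.
rewrite (_ : (fun n => _) = fun n => (\int[P]_w f (Z n w))%:E); last first.
  by apply/funext => n; rewrite expectation_Rintegral//; exact: fi.
apply: cvg_EFin; first by near=> n.
(* The error is [eta + M * eta] for [G], [eta + 2 * M * eta] for [Z n], and [eta] for the smooth
   function [h], in total [3 * (M + 1) * eta]. *)
apply/cvgrPdist_le => e e0; pose eta := e / (3 * (M + 1)).
have M1 : 0 < 3 * (M + 1) by lra.
have eta0 : 0 < eta by rewrite divr_gt0.
have [b hb] : exists b, \int[P']_w tail b (G w) <= eta.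
  have /cvgrPdist_le/(_ _ eta0)[b _ hb] := tail_vanishes P' mG.
  exists b; have := hb b; rewrite /= sub0r normrN => /(_ (leqnn b)).
  exact: le_trans (ler_norm _).
have [h [chi [sh schi chi01 chi1 fh]]] := spline_approximation b.+1 cf fM eta0.
have [Ch hC] := smooth3_bounded sh; have [Cc cC] := smooth3_bounded schi.
have near_f d0 (T0 : measurableType d0) (P0 : probability T0 R) (V : T0 -> 'cV[R]_k) :
    random_vector V ->
    `|\int[P0]_w f (V w) - \int[P0]_w h (V w)| <= eta + M * (1 - \int[P0]_w chi (V w)).
  move=> mV; have hi := cmeas_integrable P0 mV (smooth3_cmeas sh) hC.
  have ci := cmeas_integrable P0 mV (smooth3_cmeas schi) cC.
  rewrite -RintegralB//; last exact: fi.
  have -> : eta + M * (1 - \int[P0]_w chi (V w)) = \int[P0]_w (eta + M * (1 - chi (V w))).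
    have i1 : P0.-integrable setT (EFin \o (fun w => 1 - chi (V w))).
      by apply: Rintegrable_sub => //; exact: finite_measure_integrable_cst.
    rewrite RintegralD//; last 2 first.
    - exact: finite_measure_integrable_cst.
    - exact: Rintegrable_scale.
    rewrite RintegralZl// RintegralB//; last exact: finite_measure_integrable_cst.
    by rewrite !Rintegral_prob_cst.
  have di := Rintegrable_sub (fi _ _ P0 _ mV) hi.
  rewrite (le_trans (le_normr_Rintegral _ di))//; apply: le_Rintegral => //.
  - exact: (integrable_norm di).
  - apply: Rintegrable_add; first exact: finite_measure_integrable_cst.
    apply: Rintegrable_scale; apply: Rintegrable_sub => //.
    exact: finite_measure_integrable_cst.
have chiG : 1 - \int[P']_w chi (G w) <= eta.
  apply: le_trans hb; rewrite lerBlDr -[leLHS](Rintegral_prob_cst P').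
  have ci := cmeas_integrable P' mG (smooth3_cmeas schi) cC.
  have ti := cmeas_integrable P' mG (@tail_cmeas b) (@tail_bounded b).
  rewrite -RintegralD//; apply: le_Rintegral => //.
  - exact: finite_measure_integrable_cst.
  - exact: Rintegrable_add.
  - move=> w _; have [xb|xb] := leP `|G w| b.+1%:R.
      by rewrite chi1// lerDr tail_ge0.
    by rewrite tail_eq1 ?(ltW xb)// lerDl; have /andP[] := chi01 (G w).
near=> n.
have hn : `|\int[P']_w h (G w) - \int[P]_w h (Z n w)| <= eta.
  by near: n; exact: cvgr_dist_le (cvgZ _ sh) _ eta0.
have cn : `|\int[P']_w chi (G w) - \int[P]_w chi (Z n w)| <= eta.
  by near: n; exact: cvgr_dist_le (cvgZ _ schi) _ eta0.
have fG := near_f _ _ P' _ mG; have fZ := near_f _ _ P _ (mZ n).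
have etaE : e = 3 * (M + 1) * eta by rewrite /eta; field; lra.
have p1 : M * (1 - \int[P']_w chi (G w)) <= M * eta by rewrite ler_wpM2l.
have p2 : M * (1 - \int[P]_w chi (Z n w)) <= M * (2 * eta).
  rewrite ler_wpM2l//; move: cn; rewrite ler_norml => /andP[]; lra.
rewrite etaE; move: fG fZ hn; rewrite /= !ler_norml => /andP[? ?] /andP[? ?] /andP[? ?].
apply/andP; split; lra.
Unshelve. all: by end_near. Qed.

End portmanteau.

(** * Independent normal variables *)

Section product_moment.
Context d (T : measurableType d) {R : realType} (P : probability T R).

Lemma mul_integrable (X Y : T -> R) :
  measurable_fun setT X -> measurable_fun setT Y ->
  P.-integrable setT (EFin \o (fun w => X w ^+ 2)) ->
  P.-integrable setT (EFin \o (fun w => Y w ^+ 2)) ->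
  P.-integrable setT (EFin \o (fun w => X w * Y w)).
Proof.
move=> mX mY Xi Yi; apply: (le_integrable measurableT _ _ (Rintegrable_add Xi Yi)).
  by apply/measurable_EFinP; exact: measurable_funM.
move=> w _ /=; rewrite lee_fin [leRHS]ger0_norm ?addr_ge0 ?sqr_ge0// ler_norml.
have h1 := sqr_ge0 (X w - Y w); have h2 := sqr_ge0 (X w + Y w).
have h3 := sqr_ge0 (X w); have h4 := sqr_ge0 (Y w).
apply/andP; split; nra.
Qed.

Lemma square_integrable (X : T -> R) : measurable_fun setT X ->
  P.-integrable setT (EFin \o (fun w => X w ^+ 2)) -> P.-integrable setT (EFin \o X).
Proof.
move=> mX Xi; have i1 := finite_measure_integrable_cst P (1 : R).
have := mul_integrable mX (measurable_cst (1 : R)) Xi.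
under [in X in X -> _]eq_fun do rewrite expr1n.
move=> /(_ (i1 _ measurableT))/(eq_integrable measurableT _ _); apply.
by move=> w _; rewrite /= mulr1.
Qed.

Variables (X Y : {RV P >-> R}).
Hypothesis indep : forall A B, measurable A -> measurable B ->
  P (X @^-1` A `&` Y @^-1` B) = (P (X @^-1` A) * P (Y @^-1` B))%E.
Hypothesis X2 : P.-integrable setT (EFin \o (fun w => X w ^+ 2)).
Hypothesis Y2 : P.-integrable setT (EFin \o (fun w => Y w ^+ 2)).

Lemma id_integrable_distribution (Z : {RV P >-> R}) :
  P.-integrable setT (EFin \o Z) ->
  (distribution P Z).-integrable setT (EFin \o (fun x : R => x)).
Proof.
move=> Zi; apply/integrableP; split; first exact/measurable_EFinP.
rewrite ge0_integral_distribution//; last first.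
  by do 2 apply: measurableT_comp => //.
by have /integrableP[] := Zi.
Qed.

Lemma independent_mul_expectation :
  \int[P]_w (X w * Y w) = \int[P]_w X w * \int[P]_w Y w.
Proof.
have Xi : P.-integrable setT (EFin \o X) by exact: square_integrable.
have Yi : P.-integrable setT (EFin \o Y) by exact: square_integrable.
have XYi := mul_integrable (@measurable_funPT _ _ _ _ X) (@measurable_funPT _ _ _ _ Y) X2 Y2.
pose F (z : R * R) := z.1 * z.2.
have mF : measurable_fun setT F by exact: measurable_funM.
have intF : \int[P]_w (X w * Y w) =
    \int[(distribution P X \x distribution P Y)%E]_z F z.
  rewrite /Rintegral; congr fine.
  rewrite (@eq_measure_integral _ _ _ _ (distribution P (joint_mfun X Y))); last first.
    by move=> A mA _; exact/esym/(joint_distribution indep mA).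
  by rewrite integral_distribution//; exact/measurable_EFinP.
have Fi : (distribution P X \x distribution P Y)%E.-integrable setT (EFin \o F).
  apply/integrableP; split; first exact/measurable_EFinP.
  rewrite (@eq_measure_integral _ _ _ _ (distribution P (joint_mfun X Y))); last first.
    by move=> A mA _; exact/esym/(joint_distribution indep mA).
  rewrite ge0_integral_distribution//; last first.
    by apply: measurableT_comp => //; exact/measurable_EFinP.
  by have /integrableP[] := XYi.
have muE (Z : {RV P >-> R}) : P.-integrable setT (EFin \o Z) ->
    \int[distribution P Z]_x x = \int[P]_w Z w.
  move=> Zi; rewrite /Rintegral integral_distribution//; exact/measurable_EFinP.
have idX := id_integrable_distribution Xi; have idY := id_integrable_distribution Yi.
rewrite intF Rintegral12_prod//; last by move=> x; exact: Rintegrable_scale.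
rewrite -(muE _ Xi) -(muE _ Yi).
under eq_Rintegral do rewrite /F/= RintegralZl//.
by rewrite RintegralZr.
Qed.

End product_moment.

Section orthogonal_family.
Context d (T : measurableType d) {R : realType} (P : probability T R).
Context (I : finType) (zeta : I -> T -> R) (s : R).
Hypothesis zz_int : forall i j, P.-integrable setT (EFin \o (fun w => zeta i w * zeta j w)).
Hypothesis zz : forall i j, \int[P]_w (zeta i w * zeta j w) = (i == j)%:R * s.

Lemma quadratic_integrable (M : I -> I -> R) : P.-integrable setT
  (EFin \o (fun w => \sum_i \sum_j M i j * (zeta i w * zeta j w))).
Proof.
by apply: Rintegrable_sum => i; apply: Rintegrable_sum => j; exact: Rintegrable_scale.
Qed.

Lemma quadratic_expectation (M : I -> I -> R) :
  \int[P]_w (\sum_i \sum_j M i j * (zeta i w * zeta j w)) = s * \sum_i M i i.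
Proof.
rewrite Rintegral_sum => [|i]; last first.
  by apply: Rintegrable_sum => j; exact: Rintegrable_scale.
rewrite mulr_sumr; apply: eq_bigr => i _.
rewrite Rintegral_sum => [|j]; last exact: Rintegrable_scale.
rewrite (bigD1 i)//= RintegralZl// zz eqxx mul1r big1 ?addr0 1?mulrC// => j ji.
by rewrite RintegralZl// zz eq_sym (negPf ji) mul0r mulr0.
Qed.

End orthogonal_family.

Section independent_families.
Context d (T : measurableType d) {R : realType} (P : probability T R).

Lemma independent_pair (I : choiceType) (X : I -> {RV P >-> R}) (i j : I) A B :
  mutually_independent X -> i != j -> measurable A -> measurable B ->
  P (X i @^-1` A `&` X j @^-1` B) = (P (X i @^-1` A) * P (X j @^-1` B))%E.
Proof.
move=> indX ij mA mB; pose C l := if l == i then A else B.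
have mC l : measurable (C l) by rewrite /C; case: ifP.
have := indX [fset i; j]%fset C mC.
rewrite big_fsetU1 ?inE//= big_seq_fset1 /C eqxx (negPf (_ : j != i)); last by rewrite eq_sym.
move=> <-; congr (P _); apply/seteqP; split=> w.
  move=> [wi wj] l; rewrite /= !inE => /orP[]/eqP->; first by rewrite eqxx.
  by rewrite eq_sym (negPf ij).
move=> h; split; first by have := h i; rewrite /= !inE !eqxx => /(_ isT).
by have := h j; rewrite /= !inE eqxx orbT eq_sym (negPf ij) => /(_ isT).
Qed.

Lemma mutually_independent_full (I : finType) (X : I -> {RV P >-> R}) :
  (forall A : I -> set R, (forall i, measurable (A i)) ->
     P (\bigcap_(i in setT) (X i @^-1` A i)) = (\prod_i P (X i @^-1` A i))%E) ->
  mutually_independent X.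
Proof.
move=> full J A mA; pose A' i := if i \in J then A i else setT.
have mA' i : measurable (A' i) by rewrite /A'; case: ifP.
have -> : \bigcap_(i in [set` J]) (X i @^-1` A i) = \bigcap_(i in setT) (X i @^-1` A' i).
  apply/seteqP; split=> w h i.
    by move=> _; rewrite /= /A'; case: ifP => // iJ; exact: h.
  by move=> iJ; have := h i Logic.I; rewrite /A' /= iJ.
rewrite full// (big_uniq _ (fset_uniq J)) [RHS]big_mkcond/=; apply: eq_bigr => i _.
by rewrite /A'; case: ifP => // _; rewrite preimage_setT probability_setT.
Qed.

End independent_families.

Section standard_normal_family.
Context {R : realType}.

Definition normal_family disp (T : measurableType disp) (P : probability T R)
    (l : nat) (W : 'I_l -> {RV P >-> R}) : Prop :=
  mutually_independent W /\ forall i (B : set R), measurable B ->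
    distribution P (W i) B = @normal_prob R 0 1 B.

Section extension.
Context disp (T : measurableType disp) (P : probability T R) (l : nat).
Variable W : 'I_l -> {RV P >-> R}.
Local Notation Q := (P \x (@std_normal R))%E.

Definition extended_family_fun (i : 'I_l.+1) (z : T * R) : R :=
  if unlift ord_max i is Some j then W j z.1 else z.2.

Lemma extended_family_measurable i : measurable_fun setT (extended_family_fun i).
Proof.
rewrite /extended_family_fun; case: (unlift _ _) => [j|]; last exact: measurable_snd.
exact: (@measurableT_comp _ _ _ _ _ _ (W j)).
Qed.

Definition extended_family (i : 'I_l.+1) : {RV Q >-> R} :=
  HB.pack (extended_family_fun i)
    (isMeasurableFun.Build _ _ _ _ _ (@extended_family_measurable i)).

Lemma extended_family_normal : normal_family W -> normal_family extended_family.
Proof.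
move=> [indW normW].
have mW j A : measurable A -> measurable (W j @^-1` A).
  by move=> mA; rewrite -[_ @^-1` _]setTI; exact: measurable_funP.
have liftE (j : 'I_l) A : extended_family (lift ord_max j) @^-1` A = (W j @^-1` A) `*` setT.
  apply/seteqP; split=> -[x y]; rewrite /preimage/= /extended_family_fun liftK//=.
  by case.
have maxE A : extended_family ord_max @^-1` A = setT `*` A.
  apply/seteqP; split=> -[x y]; rewrite /preimage/= /extended_family_fun unlift_none//=.
  by case.
have PW j A : measurable A -> Q (extended_family (lift ord_max j) @^-1` A) = P (W j @^-1` A).
  move=> mA; rewrite liftE product_measure1E//; last exact: mW.
  by rewrite [X in (_ * X)%E](_ : _ = 1%E) ?mule1//; exact: probability_setT.
have Pmax A : measurable A -> Q (extended_family ord_max @^-1` A) = @std_normal R A.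
  move=> mA; rewrite maxE product_measure1E//.
  by rewrite [X in (X * _)%E](_ : _ = 1%E) ?mul1e//; exact: probability_setT.
have widenE (j : 'I_l) : widen_ord (leqnSn l) j = lift ord_max j.
  by apply/val_inj; exact/esym/lift_max.
split; last first.
  move=> i B mB; rewrite -[LHS]/(Q (extended_family i @^-1` B)).
  case: (unliftP ord_max i) => [j|] ->; last by rewrite Pmax// std_normalE.
  by rewrite PW// -(normW j).
apply: mutually_independent_full => A mA.
have -> : \bigcap_(i in setT) (extended_family i @^-1` A i) =
    (\bigcap_(j in [set` [fset j in 'I_l]%fset]) (W j @^-1` A (lift ord_max j))) `*` A ord_max.
  apply/seteqP; split=> [z zA|z [z1 z2] i _].
    split.
      move=> j _; have := zA (lift ord_max j) Logic.I; rewrite liftE.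
      by case.
    by have := zA ord_max Logic.I; rewrite maxE => -[].
  case: (unliftP ord_max i) => [j|] ->; last by rewrite maxE.
  by rewrite liftE; split=> //; apply: z1; rewrite /= !inE.
have mcap : measurable (\bigcap_(j in [set` [fset j in 'I_l]%fset])
    (W j @^-1` A (lift ord_max j))).
  by apply: fin_bigcap_measurable => [|j _]; [exact: finite_fset|exact: mW].
apply: (etrans (product_measure1E _ _ mcap (mA ord_max))).
have capE := indW [fset j in 'I_l]%fset (fun j => A (lift ord_max j)) (fun j => mA _).
apply: (etrans (congr1 (fun z => (z * std_normal (A ord_max))%E) capE)).
rewrite big_ord_recr/= Pmax//; congr (_ * _)%E.
rewrite (big_uniq _ (fset_uniq _)); apply: eq_big => [j|j _].
  by rewrite !inE.
by rewrite widenE PW.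
Qed.

End extension.

Lemma normal_family_exists (l : nat) : exists (disp : measure_display)
  (T : measurableType disp) (P : probability T R) (W : 'I_l -> {RV P >-> R}),
  normal_family W.
Proof.
elim: l => [|l [disp [T [P [W hW]]]]]; last first.
  by exists _, _, _, (extended_family W); exact: extended_family_normal.
exists _, R, (@std_normal R), (fun i : 'I_0 => match notF (ltn_ord i) with end); split; last by case.
apply: mutually_independent_full => A mA.
rewrite big_ord0 (_ : \bigcap_(i in _) _ = setT) ?probability_setT//.
by apply/seteqP; split=> // x _ [].
Qed.

End standard_normal_family.

(** * Second order expansions and dependence on the covariance matrix *)

Section gaussian_expansion.
Context {R : realType} (k : nat).
Local Notation S := (@std_normal R).
Implicit Types (f : 'cV[R]_k -> R) (x u v : 'cV[R]_k) (s : seq 'cV[R]_k).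

Lemma dotv_trace (H : 'M[R]_k) v : dotv v (H *m v) = \tr (H *m (v *m v^T)).
Proof. by rewrite dotvE -trace_mx11 mxtrace_mulC -mulmxA. Qed.

Lemma trace_le (H D : 'M[R]_k) : `|\tr (H *m D)| <= k%:R * (k%:R * `|H| * `|D|).
Proof.
rewrite (le_trans (ler_norm_sum _ _ _))//.
rewrite (le_trans (ler_sum _ (fun i _ => mx_norm_entry _ i i)))//.
rewrite sumr_const card_ord -[leLHS]mulr_natl ler_wpM2l//; exact: mx_normM.
Qed.

Lemma sum_cube_le (I : Type) (r : seq I) : exists2 K : R, 0 <= K &
  forall a : I -> R, (forall i, 0 <= a i) ->
    (\sum_(i <- r) a i) ^+ 3 <= K * \sum_(i <- r) a i ^+ 3.
Proof.
elim: r => [|i r [K K0 hK]]; first by exists 0 => // a _; rewrite !big_nil expr0n mul0r.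
exists (4 * (K + 1)); first lra.
move=> a a0; rewrite !big_cons; have := hK a a0.
have b0 : 0 <= \sum_(j <- r) a j by apply: sumr_ge0.
have q0 : 0 <= \sum_(j <- r) a j ^+ 3 by apply: sumr_ge0 => j _; rewrite exprn_ge0.
move: b0 q0 (a0 i); move: (\sum_(j <- r) a j) (\sum_(j <- r) a j ^+ 3) (a i).
move=> b q y b0 q0 y0 bq.
have h : (y + b) ^+ 3 <= 4 * (y ^+ 3 + b ^+ 3).
  have -> : 4 * (y ^+ 3 + b ^+ 3) = (y + b) ^+ 3 + 3 * ((y + b) * (y - b) ^+ 2) by ring.
  rewrite lerDl; apply: mulr_ge0 => //; apply: mulr_ge0; last exact: sqr_ge0.
  exact: addr_ge0.
have y3 : 0 <= y ^+ 3 by rewrite exprn_ge0.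
have : 0 <= K * y ^+ 3 by rewrite mulr_ge0.
lra.
Qed.

Section taylor_witness.
Variables (f : 'cV[R]_k -> R) (C : R) (L : 'cV[R]_k -> 'cV[R]_k) (H : 'cV[R]_k -> 'M[R]_k).
Hypothesis mf : cmeas f.
Hypothesis fC : bounded_by C f.
Hypothesis rC : forall x v, `|taylor_rem f L H x v| <= C * `|v| ^+ 3.

Let C0 : 0 <= C. Proof. exact: le_trans (fC 0). Qed.

(** Integration of the Taylor expansion along the line: the first order term vanishes with the mean.
    Two laws with the same first two moments thus differ by third moments only. *)
Lemma avg_second_order (mu : probability R R) (s2 : R) u x :
  mu.-integrable setT (EFin \o (fun t : R => t)) ->
  mu.-integrable setT (EFin \o (fun t : R => t ^+ 2)) ->
  mu.-integrable setT (EFin \o (fun t : R => `|t| ^+ 3)) ->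
  \int[mu]_t t = 0 -> \int[mu]_t (t ^+ 2) = s2 ->
  `|avg mu u f x - f x - s2 * dotv u (H x *m u)| <= C * `|u| ^+ 3 * \int[mu]_t (`|t| ^+ 3).
Proof.
move=> i1 i2 i3 m1 m2; pose r (t : R) := taylor_rem f L H x (t *: u).
have rE t : r t = f (x + t *: u) - f x - (dotv (L x) u * t + dotv u (H x *m u) * t ^+ 2).
  rewrite /r /taylor_rem -scalemxAr !dotvZr dotvZl; ring.
have fi := line_integrable mu x u mf fC.
have pi : mu.-integrable setT
    (EFin \o (fun t => dotv (L x) u * t + dotv u (H x *m u) * t ^+ 2)).
  by apply: Rintegrable_add; exact: Rintegrable_scale.
have ci := finite_measure_integrable_cst mu (f x) measurableT.
have ri : mu.-integrable setT (EFin \o r).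
  have -> : r = fun t => f (x + t *: u) - f x - (dotv (L x) u * t + dotv u (H x *m u) * t ^+ 2).
    by apply/funext => t; rewrite rE.
  by apply: Rintegrable_sub => //; exact: Rintegrable_sub.
have -> : avg mu u f x - f x - s2 * dotv u (H x *m u) = \int[mu]_t r t.
  under eq_Rintegral do rewrite rE.
  rewrite RintegralB//; last exact: Rintegrable_sub.
  rewrite RintegralB// RintegralD//; last 2 first.
  - exact: Rintegrable_scale.
  - exact: Rintegrable_scale.
  by rewrite !RintegralZl// Rintegral_prob_cst m1 m2 mulr0 add0r mulrC.
rewrite (le_trans (le_normr_Rintegral _ ri))// -RintegralZl//; apply: le_Rintegral => //.
- exact: (integrable_norm ri).
- exact: Rintegrable_scale.
move=> t _; rewrite (le_trans (rC _ _))// normrZ exprMn -mulrA ler_wpM2l//.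
by rewrite mulrC.
Qed.

End taylor_witness.

Lemma eq_avg (mu nu : probability R R) u f : (forall A, measurable A -> mu A = nu A) ->
  avg mu u f = avg nu u f.
Proof.
move=> munu; apply/funext => x; rewrite /avg /Rintegral; congr fine.
apply: eq_measure_integral => A mA _; exact: munu.
Qed.

Lemma eq_avgs (I : Type) (r : seq I) (mu nu : I -> probability R R) (u : I -> 'cV[R]_k) f :
  (forall i A, measurable A -> mu i A = nu i A) ->
  avgs [seq (mu i, u i) | i <- r] f = avgs [seq (nu i, u i) | i <- r] f.
Proof.
move=> munu; elim: r f => [//|i r ih] f /=; rewrite ih (@eq_avg (mu i) (nu i))//.
by move=> A; exact: munu.
Qed.

Lemma expectation_avgs d (T : measurableType d) (P : probability T R) (I : choiceType)
    (X : I -> {RV P >-> R}) (C : R) (r : seq I) (u : I -> 'cV[R]_k) f x :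
  mutually_independent X -> uniq r -> cmeas f -> bounded_by C f ->
  \int[P]_w f (x + \sum_(j <- r) X j w *: u j) =
  avgs [seq (distribution P (X j) : probability R R, u j) | j <- r] f x.
Proof.
move=> indX ur mf fC; rewrite (expectation_independent_sum indX _ _ ur mf fC) /avgs.
by elim: r f {mf fC ur} => [//|i r ih] f /=; rewrite ih.
Qed.

Section normal_vectors.
Context d (T : measurableType d) (P : probability T R) (l : nat) (W : 'I_l -> {RV P >-> R}).
Hypothesis hW : normal_family W.

Lemma distribution_normal i (A : set R) : measurable A -> distribution P (W i) A = S A.
Proof. by move=> mA; rewrite (hW.2 i A mA). Qed.

Lemma normal_transfer_integrable i (g : R -> R) : S.-integrable setT (EFin \o g) ->
  P.-integrable setT (EFin \o (fun w => g (W i w))).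
Proof.
move=> gi; have mg : measurable_fun setT g by exact: (measurable_EFinP _ _).1 (measurable_int _ gi).
apply/integrableP; split; first by apply/measurable_EFinP; exact: measurableT_comp.
have := ge0_integral_distribution (W i) (f := fun x : R => `|(g x)%:E|%E).
move=> <-//; last by apply: measurableT_comp => //; exact/measurable_EFinP.
rewrite (@eq_measure_integral _ _ _ _ S); last first.
  by move=> A mA _; exact: distribution_normal.
by have /integrableP[] := gi.
Qed.

Lemma normal_transfer i (g : R -> R) : S.-integrable setT (EFin \o g) ->
  \int[P]_w g (W i w) = \int[S]_x g x.
Proof.
move=> gi; have mg : measurable_fun setT g by exact: (measurable_EFinP _ _).1 (measurable_int _ gi).
rewrite /Rintegral -(@eq_measure_integral _ _ _ _ S (distribution P (W i))).
  by rewrite integral_distribution//; [exact/measurable_EFinP|exact: normal_transfer_integrable].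
by move=> A mA _; exact: distribution_normal.
Qed.

Lemma normal_sqr_integrable i : P.-integrable setT (EFin \o (fun w => W i w ^+ 2)).
Proof. exact: (normal_transfer_integrable i std_normal_sqr_integrable). Qed.

Lemma normal_product_integrable i j :
  P.-integrable setT (EFin \o (fun w => W i w * W j w)).
Proof. by apply: mul_integrable => //; exact: normal_sqr_integrable. Qed.

Lemma normal_mean i : \int[P]_w W i w = 0.
Proof. by rewrite (normal_transfer i std_normal_id_integrable) std_normal_mean. Qed.

Lemma normal_covariance i j : \int[P]_w (W i w * W j w) = (i == j)%:R * 1.
Proof.
have [<-|ij] := eqVneq i j.
  under eq_Rintegral do rewrite -expr2.
  by rewrite (normal_transfer i std_normal_sqr_integrable) std_normal_variance mul1r.
rewrite independent_mul_expectation ?normal_mean ?mul0r//; last 2 first.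
- exact: normal_sqr_integrable.
- exact: normal_sqr_integrable.
by move=> A B mA mB; exact: independent_pair hW.1 ij mA mB.
Qed.

Lemma expectation_gsteps (C a : R) (u : 'I_l -> 'cV[R]_k) f x :
  cmeas f -> bounded_by C f ->
  \int[P]_w f (x + a *: \sum_j W j w *: u j) =
  avgs (gsteps a [seq u j | j <- enum 'I_l]) f x.
Proof.
move=> mf fC; rewrite /gsteps -map_comp.
rewrite -(eq_avgs (enum 'I_l) (mu := fun j => distribution P (W j))); last first.
  by move=> i A mA; exact: distribution_normal.
rewrite -(expectation_avgs _ _ hW.1 (enum_uniq _) mf fC).
apply: eq_Rintegral => w _; congr (f (_ + _)).
rewrite big_enum scaler_sumr; apply: eq_bigr => j _.
by rewrite /= !scalerA mulrC.
Qed.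

(** The whole block of steps is treated as one Gaussian vector: independence kills the off-diagonal
    second order terms, and the cubic remainder is integrable. The constant is uniform in the scale
    [a] and in [x]. *)
Lemma normal_second_order f C L (H : 'cV[R]_k -> 'M[R]_k) (u : 'I_l -> 'cV[R]_k) :
  cmeas f -> bounded_by C f ->
  (forall x v, `|taylor_rem f L H x v| <= C * `|v| ^+ 3) ->
  exists K, forall a x,
  `|avgs (gsteps a [seq u j | j <- enum 'I_l]) f x - f x -
    a ^+ 2 * \sum_j dotv (u j) (H x *m u j)| <= K * `|a| ^+ 3.
Proof.
move=> mf fC rC; have C0 : 0 <= C by exact: le_trans (fC 0).
have [K0 K00 hK0] := sum_cube_le (index_enum 'I_l).
pose V w := \sum_j W j w *: u j.
pose g w := K0 * \sum_j (`|W j w| ^+ 3 * `|u j| ^+ 3).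
have gi : P.-integrable setT (EFin \o g).
  apply: Rintegrable_scale; apply: Rintegrable_sum => j.
  have := Rintegrable_scale (`|u j| ^+ 3)
    (normal_transfer_integrable j (std_normal_abs_moment 2)).
  by apply: eq_integrable => // w _ /=; rewrite mulrC.
have Vg w : `|V w| ^+ 3 <= g w.
  rewrite (le_trans _ (_ : (\sum_j `|W j w| * `|u j|) ^+ 3 <= _))//; last first.
    have := hK0 (fun j => `|W j w| * `|u j|) (fun j => mulr_ge0 (normr_ge0 _) (normr_ge0 _)).
    move=> /le_trans; apply; rewrite /g ler_wpM2l//; apply: ler_sum => j _.
    by rewrite exprMn.
  rewrite lerXn2r ?nnegrE//; first by apply: sumr_ge0 => j _; apply: mulr_ge0.
  rewrite (le_trans (ler_norm_sum _ _ _))//; apply: ler_sum => j _.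
  by rewrite normrZ.
exists (C * \int[P]_w g w) => a x; rewrite -(expectation_gsteps _ _ _ mf fC).
pose lin w := \sum_j dotv (L x) (u j) * W j w.
pose quad w := \sum_i \sum_j dotv (u i) (H x *m u j) * (W i w * W j w).
have Wi j : P.-integrable setT (EFin \o W j).
  exact: (normal_transfer_integrable j std_normal_id_integrable).
have lini : P.-integrable setT (EFin \o lin).
  by apply: Rintegrable_sum => j; exact: Rintegrable_scale.
have quadi : P.-integrable setT (EFin \o quad).
  exact: quadratic_integrable normal_product_integrable _.
have linE w : dotv (L x) (V w) = lin w.
  by rewrite /V dotv_sumr; apply: eq_bigr => j _; rewrite dotvZr mulrC.
have quadE w : dotv (V w) (H x *m V w) = quad w.
  rewrite dotvC {2}/V dotv_sumr; apply: eq_bigr => i _.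
  rewrite dotvZr dotvC /V mulmx_sumr dotv_sumr mulr_sumr; apply: eq_bigr => j _.
  by rewrite -scalemxAr dotvZr; ring.
have mV : random_vector V.
  have := @random_vector_sum R k _ T _ (index_enum 'I_l) W u 0 (fun i => measurable_funPT _).
  by congr random_vector; apply/funext => w; rewrite add0r.
have fi : P.-integrable setT (EFin \o (fun w => f (x + a *: V w))).
  apply: (@bounded_integrable _ _ _ _ _ C) => [|w]; last exact: fC.
  apply: (mf _ _ (fun w => x + a *: V w)) => i.
  apply: (eq_measurable_fun (fun w => x i ord0 + a * V w i ord0)).
    by move=> w _; rewrite !mxE.
  by apply: measurable_funD => //; apply: measurable_funM => //; exact: mV.
pose r w := taylor_rem f L H x (a *: V w).
have rE w : r w = f (x + a *: V w) - f x - (a * lin w + a ^+ 2 * quad w).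
  by rewrite /r /taylor_rem -scalemxAr !dotvZr dotvZl linE quadE; ring.
have ci := finite_measure_integrable_cst P (f x) measurableT.
have pi : P.-integrable setT (EFin \o (fun w => a * lin w + a ^+ 2 * quad w)).
  by apply: Rintegrable_add; exact: Rintegrable_scale.
have ri : P.-integrable setT (EFin \o r).
  have -> : r = fun w => f (x + a *: V w) - f x - (a * lin w + a ^+ 2 * quad w).
    by apply/funext => w; rewrite rE.
  by apply: Rintegrable_sub => //; exact: Rintegrable_sub.
have -> : \int[P]_w f (x + a *: V w) - f x - a ^+ 2 * \sum_j dotv (u j) (H x *m u j) =
    \int[P]_w r w.
  under [RHS]eq_Rintegral do rewrite rE.
  rewrite RintegralB//; last exact: Rintegrable_sub.
  rewrite RintegralB// RintegralD//; last 2 first.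
  - exact: Rintegrable_scale.
  - exact: Rintegrable_scale.
  rewrite !RintegralZl// Rintegral_prob_cst.
  rewrite (quadratic_expectation normal_product_integrable normal_covariance) mul1r.
  have -> : \int[P]_w lin w = 0.
    rewrite Rintegral_sum => [|j]; last exact: Rintegrable_scale.
    by apply: big1 => j _; rewrite RintegralZl// normal_mean mulr0.
  by rewrite mulr0 add0r.
rewrite (le_trans (le_normr_Rintegral _ ri))//.
have -> : C * \int[P]_w g w * `|a| ^+ 3 = \int[P]_w (C * `|a| ^+ 3 * g w).
  by rewrite RintegralZl//; ring.
apply: le_Rintegral => //.
- exact: (integrable_norm ri).
- exact: Rintegrable_scale.
move=> w _; rewrite (le_trans (rC _ _))// normrZ exprMn mulrA ler_wpM2l//.
by rewrite mulr_ge0// exprn_ge0.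
Qed.

End normal_vectors.

(** The operators are realized by an actual normal family. In trace form the second order term
    depends on [s] through its covariance matrix only. *)
Lemma gsteps_second_order f C L (H : 'cV[R]_k -> 'M[R]_k) s :
  cmeas f -> bounded_by C f ->
  (forall x v, `|taylor_rem f L H x v| <= C * `|v| ^+ 3) ->
  exists K, forall a x, `|avgs (gsteps a s) f x - f x -
    a ^+ 2 * \tr (H x *m \sum_(v <- s) v *m v^T)| <= K * `|a| ^+ 3.
Proof.
move=> mf fC rC; have [d [T [P [W hW]]]] := @normal_family_exists R (size s).
have [K hK] := normal_second_order hW (tnth (in_tuple s)) mf fC rC.
exists K => a x; have := hK a x; rewrite map_tnth_enum/=.
rewrite [\sum_(v <- s) _]big_tnth mulmx_sumr raddf_sum/=.
by under eq_bigr do rewrite dotv_trace.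
Qed.

(* Replacing [s] by [s / sqrt 2 ^ m] and iterating [2 ^ m] times, only the second
   order terms survive as [m] tends to infinity. *)
Lemma gaussian_covariance_le f : smooth3 f -> exists2 K, 0 <= K & forall s (t : seq 'cV[R]_k) x,
  `|avgs (gsteps 1 s) f x - avgs (gsteps 1 t) f x| <=
  K * `|\sum_(v <- s) v *m v^T - \sum_(v <- t) v *m v^T|.
Proof.
move=> sf; have [D fL] := smooth3_lipschitz sf.
case: sf => C [L [H [mf fC LC HC rC]]]; have C0 : 0 <= C by exact: le_trans (fC 0).
exists (k%:R * (k%:R * C)) => [|s t x]; first by rewrite !mulr_ge0.
set A := \sum_(v <- s) _; set B := \sum_(v <- t) _.
have [Ks hs] := gsteps_second_order s mf fC rC.
have [Kt ht] := gsteps_second_order t mf fC rC.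
have c0 : 0 < (Num.sqrt 2)^-1 :> R by rewrite invr_gt0 sqrtr_gt0.
set c := (Num.sqrt 2)^-1 in c0.
have c2 : 2 * c ^+ 2 = 1 by rewrite /c exprVn sqr_sqrtr// mulfV.
have c1 : `|c| < 1.
  rewrite gtr0_norm//; have := c0; have := c2; nra.
(* Each scaled operator contributes the covariance term times [(c ^ m) ^ 2], which the [2 ^ m]
   iterations restore exactly, and a remainder of order [(c ^ m) ^ 3], of which a factor [c ^ m]
   survives. *)
have bound m : `|avgs (gsteps 1 s) f x - avgs (gsteps 1 t) f x| <=
    k%:R * (k%:R * C) * `|A - B| + (Ks + Kt) * c ^+ m.
  have cm0 : 0 <= c ^+ m by rewrite exprn_ge0// ltW.
  have step y : `|avgs (gsteps (c ^+ m) s) f y - avgs (gsteps (c ^+ m) t) f y| <=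
      (c ^+ m) ^+ 2 * (k%:R * (k%:R * C) * `|A - B| + (Ks + Kt) * c ^+ m).
    have := hs (c ^+ m) y; have := ht (c ^+ m) y; rewrite -/A -/B (ger0_norm cm0).
    have trE : \tr (H y *m A) = \tr (H y *m B) + \tr (H y *m (A - B)).
      by rewrite -raddfD/= -mulmxDr addrC subrK.
    have trB : `|\tr (H y *m (A - B))| <= k%:R * (k%:R * C) * `|A - B|.
      rewrite (le_trans (trace_le _ _))// -[leRHS]mulrA ler_wpM2l// ler_wpM2r//.
      by rewrite ler_wpM2l.
    rewrite trE; move: trB; move: (\tr (H y *m (A - B))) (\tr (H y *m B)) => tr1 tr2.
    move: (k%:R * (k%:R * C) * `|A - B|) => N trN.
    have sq0 : 0 <= (c ^+ m) ^+ 2 by exact: sqr_ge0.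
    have p1 : (c ^+ m) ^+ 2 * `|tr1| <= (c ^+ m) ^+ 2 * N by rewrite ler_wpM2l.
    move: p1; rewrite -[X in X * `|tr1|](ger0_norm sq0) -normrM.
    rewrite !ler_norml => /andP[? ?] /andP[? ?] /andP[? ?].
    apply/andP; split; lra.
  have := gsteps_le mf fC fL step x.
  rewrite [2 ^+ m * _]mulrA; have -> : 2 ^+ m * (c ^+ m) ^+ 2 = 1.
    by rewrite -exprM mulnC exprM -exprMn c2 expr1n.
  by rewrite mul1r.
apply/ler_addgt0Pr => e e0.
have := @cvg_geometric R (Ks + Kt) c c1.
move=> /cvgrPdist_le/(_ _ e0)[m _ hm]; have := hm m (leqnn m).
rewrite /= /geometric/= sub0r normrN => h; rewrite (le_trans (bound m))// lerD2l.
exact: le_trans (ler_norm _) h.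
Qed.

End gaussian_expansion.

(** * Central limit theorem *)

Section transformed_variables.
Context d (T : measurableType d) {R : realType} (P : probability T R).

Definition rv_comp (g : R -> R) (mg : measurable_fun setT g) (X : {RV P >-> R}) : {RV P >-> R} :=
  HB.pack (g \o X)
    (isMeasurableFun.Build _ _ _ _ _ (measurableT_comp mg (@measurable_funPT _ _ _ _ X))).

Lemma independent_rv_comp (I : choiceType) (g : R -> R) (mg : measurable_fun setT g)
    (X : I -> {RV P >-> R}) :
  mutually_independent X -> mutually_independent (fun i => rv_comp mg (X i)).
Proof.
move=> indX J A mA; rewrite -[RHS](indX J (fun i => g @^-1` A i))// => i.
by rewrite -[_ @^-1` _]setTI; exact: mg.
Qed.

Lemma Rintegral_distribution (X : {RV P >-> R}) (g : R -> R) :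
  measurable_fun setT g -> P.-integrable setT (EFin \o (fun w => g (X w))) ->
  \int[distribution P X]_x g x = \int[P]_w g (X w).
Proof.
by move=> mg gi; rewrite /Rintegral integral_distribution//; exact/measurable_EFinP.
Qed.

Lemma integrable_distribution (X : {RV P >-> R}) (g : R -> R) :
  measurable_fun setT g -> P.-integrable setT (EFin \o (fun w => g (X w))) ->
  (distribution P X).-integrable setT (EFin \o g).
Proof.
move=> mg gi; apply/integrableP; split; first exact/measurable_EFinP.
rewrite ge0_integral_distribution//; last first.
  by apply: measurableT_comp => //; exact/measurable_EFinP.
by have /integrableP[] := gi.
Qed.

Lemma identically_distributed_Rintegral (X Y : {RV P >-> R}) (g : R -> R) :
  (forall A : set R, measurable A -> distribution P X A = distribution P Y A) ->
  measurable_fun setT g -> P.-integrable setT (EFin \o (fun w => g (X w))) ->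
  P.-integrable setT (EFin \o (fun w => g (Y w))) ->
  \int[P]_w g (X w) = \int[P]_w g (Y w).
Proof.
move=> XY mg Xi Yi; rewrite -!Rintegral_distribution// /Rintegral; congr fine.
by apply: eq_measure_integral => A mA _; exact: XY.
Qed.

Lemma Rintegral_markov (X : T -> R) (a : R) : measurable_fun setT X ->
  P.-integrable setT (EFin \o X) -> (forall w, 0 <= X w) -> 0 < a ->
  (P [set w | (a < X w)%R] <= ((\int[P]_w X w) / a)%:E)%E.
Proof.
move=> mX Xi X0 a0; set B := [set w | _].
have mB : measurable B.
  have := measurable_fun_ltr (measurable_cst (a : R)) mX; rewrite /B.
  by move=> /(_ measurableT [set true]); rewrite setTI => h; apply: h.
have PB : P B = (\int[P]_w (\1_B w))%:E.
  by rewrite /Rintegral integral_indic// setIT fineK// fin_num_measure.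
rewrite PB lee_fin ler_pdivlMr// mulrC -RintegralZl//; last first.
  apply: (@bounded_integrable _ _ _ _ _ 1) => // w.
  by rewrite indicE; case: (_ \in _); rewrite ?normr1 ?normr0.
apply: le_Rintegral => //.
  apply: Rintegrable_scale; apply: (@bounded_integrable _ _ _ _ _ 1) => // w.
  by rewrite indicE; case: (_ \in _); rewrite ?normr1 ?normr0.
move=> w _; rewrite indicE; case: (boolP (w \in B)) => [|_]; last by rewrite mulr0.
by rewrite inE => /ltW; rewrite mulr1.
Qed.

End transformed_variables.

Section weighted_sums.
Context d (T : measurableType d) {R : realType} (P : probability T R).
Variables (zeta : nat -> {RV P >-> R}) (s2 : R).
Hypothesis indz : mutually_independent zeta.
Hypothesis zeta2 : forall i, P.-integrable setT (EFin \o (fun w => zeta i w ^+ 2)).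
Hypothesis zeta_mean : forall i, \int[P]_w zeta i w = 0.
Hypothesis zeta_var : forall i, \int[P]_w (zeta i w ^+ 2) = s2.

Lemma weighted_sum_second_moment (a : nat -> R) (n : nat) :
  P.-integrable setT (EFin \o (fun w => (\sum_(i < n) a i * zeta i w) ^+ 2)) /\
  \int[P]_w ((\sum_(i < n) a i * zeta i w) ^+ 2) = s2 * \sum_(i < n) a i ^+ 2.
Proof.
have zz_int (i j : 'I_n) : P.-integrable setT (EFin \o (fun w => zeta i w * zeta j w)).
  exact: mul_integrable.
have zz (i j : 'I_n) : \int[P]_w (zeta i w * zeta j w) = (i == j)%:R * s2.
  have [<-|ij] := eqVneq i j.
    by under eq_Rintegral do rewrite -expr2; rewrite zeta_var mul1r.
  rewrite independent_mul_expectation ?zeta_mean ?mul0r//.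
  by move=> A B mA mB; exact: independent_pair indz ij mA mB.
have sqE : (fun w => (\sum_(i < n) a i * zeta i w) ^+ 2) =
    (fun w => \sum_(i < n) \sum_(j < n) a i * a j * (zeta i w * zeta j w)).
  apply/funext => w; rewrite expr2 mulr_suml; apply: eq_bigr => i _; rewrite mulr_sumr.
  by apply: eq_bigr => j _; ring.
rewrite sqE; split; first exact: quadratic_integrable zz_int _.
by rewrite (quadratic_expectation zz_int zz).
Qed.

End weighted_sums.

Lemma cst_div_sqrt_cvg (R : realType) (B : R) : 0 <= B ->
  B / Num.sqrt n%:R @[n --> \oo] --> (0 : R).
Proof.
move=> B0; apply/cvgrPdist_le => e e0; near=> n.
have hn : (B / e) ^+ 2 + 1 <= n%:R by near: n; exact: nbhs_infty_ger.
have ke0 : 0 <= (B / e) ^+ 2 by exact: sqr_ge0.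
have s0 : 0 < Num.sqrt n%:R :> R by rewrite sqrtr_gt0; lra.
rewrite sub0r normrN ger0_norm ?divr_ge0 ?(ltW s0)// ler_pdivrMr// mulrC -ler_pdivrMr//.
rewrite -(ger0_norm (divr_ge0 B0 (ltW e0))) -sqrtr_sqr ler_sqrt; lra.
Unshelve. all: by end_near. Qed.

Section central_limit.
Context {R : realType} (k : nat).
Local Notation S := (@std_normal R).

(** Replacing each [xi i] by a normal variable of the same variance costs a multiple of [b n ^ 3],
    hence [n * b n ^ 3] in all. The Gaussian sum so obtained is compared with [A] through covariance
    matrices, which is why [A] may have any number of columns. *)
Lemma central_limit d (T : measurableType d) (P : probability T R)
    (xi : nat -> {RV P >-> R}) (s2 m3 : R) (c : nat -> nat -> 'cV[R]_k) (b : nat -> R)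
    d' (T' : measurableType d') (P' : probability T' R) (l : nat) (A : 'M[R]_(k, l))
    (W : 'I_l -> {RV P' >-> R}) (f : 'cV[R]_k -> R) :
  mutually_independent xi ->
  (forall i, P.-integrable setT (EFin \o (fun w => xi i w))) ->
  (forall i, P.-integrable setT (EFin \o (fun w => xi i w ^+ 2))) ->
  (forall i, P.-integrable setT (EFin \o (fun w => `|xi i w| ^+ 3))) ->
  (forall i, \int[P]_w xi i w = 0) ->
  (forall i, \int[P]_w (xi i w ^+ 2) = s2) ->
  (forall i, \int[P]_w (`|xi i w| ^+ 3) <= m3) ->
  (forall n i, `|c n i| <= b n) ->
  n%:R * b n ^+ 3 @[n --> \oo] --> (0 : R) ->
  s2 *: \sum_(i < n) c n i *m (c n i)^T @[n --> \oo] --> A *m A^T ->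
  normal_family W -> smooth3 f ->
  \int[P]_w f (\sum_(i < n) xi i w *: c n i) @[n --> \oo] -->
  \int[P']_w f (A *m \col_j W j w).
Proof.
move=> indxi i1 i2 i3 xi1 xi2 xi3 cb nb cov hW sf.
have [K K0 hK] := gaussian_covariance_le sf.
case: sf => C [L [H [mf fC _ HC rC]]]; have C0 : 0 <= C by exact: le_trans (fC 0).
have s20 : 0 <= s2 by rewrite -(xi2 0%N); apply: Rintegral_ge0 => w _; exact: sqr_ge0.
pose s := Num.sqrt s2; have ss : s ^+ 2 = s2 by rewrite sqr_sqrtr.
have m1 : measurable_fun setT (fun x : R => x) by [].
have m2 : measurable_fun setT (fun x : R => x ^+ 2) by exact: measurable_funX.
have m3' : measurable_fun setT (fun x : R => `|x| ^+ 3).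
  by apply: measurable_funX; exact: continuous_measurable_fun (@norm_continuous _ R^o).
pose kappa := \int[S]_x (`|x| ^+ 3).
pose E := C * (m3 + s ^+ 3 * kappa).
have one_step n i x : `|avg (distribution P (xi i)) (c n i) f x - avg S (s *: c n i) f x| <=
    E * b n ^+ 3.
  have b0 : 0 <= b n by exact: le_trans (cb n i).
  have cb3 : `|c n i| ^+ 3 <= b n ^+ 3 by rewrite lerXn2r ?nnegrE.
  have h1 := @avg_second_order R k f C L H mf fC rC (distribution P (xi i)) s2 (c n i) x
    (integrable_distribution m1 (i1 i)) (integrable_distribution m2 (i2 i))
    (integrable_distribution m3' (i3 i)).
  rewrite !Rintegral_distribution// xi1 xi2 in h1; have {}h1 := h1 erefl erefl.
  have h2 := @avg_second_order R k f C L H mf fC rC S 1 (s *: c n i) x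
    std_normal_id_integrable std_normal_sqr_integrable (std_normal_abs_moment 2)
    std_normal_mean std_normal_variance.
  rewrite -scalemxAr dotvZr dotvZl mul1r mulrA -expr2 ss in h2.
  have e1 : C * `|c n i| ^+ 3 * \int[P]_w `|xi i w| ^+ 3 <= C * b n ^+ 3 * m3.
    rewrite ler_pM// ?mulr_ge0 ?exprn_ge0//; last by rewrite ler_wpM2l.
    by apply: Rintegral_ge0 => w _; rewrite exprn_ge0.
  have e2 : C * `|s *: c n i| ^+ 3 * kappa <= C * (s ^+ 3 * b n ^+ 3) * kappa.
    rewrite ler_wpM2r//; first by apply: Rintegral_ge0 => w _; rewrite exprn_ge0.
    by rewrite ler_wpM2l// normrZ exprMn ger0_norm ?sqrtr_ge0// ler_wpM2l// exprn_ge0// sqrtr_ge0.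
  have -> : E * b n ^+ 3 = C * b n ^+ 3 * m3 + C * (s ^+ 3 * b n ^+ 3) * kappa.
    by rewrite /E; ring.
  (* The second order expansion common to both laws is inserted between the two averages. *)
  rewrite -(subrKA (f x + s2 * dotv (c n i) (H x *m c n i))).
  rewrite (le_trans (ler_normD _ _))// lerD//.
    by rewrite opprD addrA (le_trans h1).
  by rewrite distrC opprD addrA (le_trans h2).
have gauss_end : \int[P']_w f (A *m \col_j W j w) =
    avgs (gsteps 1 [seq col j A | j <- enum 'I_l]) f 0.
  rewrite -(expectation_gsteps hW _ _ _ mf fC); apply: eq_Rintegral => w _; congr f.
  rewrite add0r scale1r; apply/matrixP => p q; rewrite mxE summxE; apply: eq_bigr => j _.
  by rewrite !mxE mulrC.
have gauss_cov : \sum_(v <- [seq col j A | j <- enum 'I_l]) v *m v^T = A *m A^T.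
  rewrite big_map big_enum/=; apply/matrixP => p q; rewrite summxE mxE.
  by apply: eq_bigr => j _; rewrite !mxE big_ord1 !mxE.
have step_cov n : \sum_(v <- [seq s *: c n j | j <- index_iota 0 n]) v *m v^T =
    s2 *: \sum_(i < n) c n i *m (c n i)^T.
  rewrite big_map big_mkord scaler_sumr; apply: eq_bigr => i _.
  by rewrite linearZ/= -scalemxAl -scalemxAr scalerA -expr2 ss.
have main n : `|\int[P']_w f (A *m \col_j W j w) - \int[P]_w f (\sum_(i < n) xi i w *: c n i)| <=
    E * (n%:R * b n ^+ 3) + K * `|A *m A^T - s2 *: \sum_(i < n) c n i *m (c n i)^T|.
  have -> : \int[P]_w f (\sum_(i < n) xi i w *: c n i) =
     avgs [seq (distribution P (xi j) : probability R R, c n j) | j <- index_iota 0 n] f 0.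
    rewrite -(expectation_avgs _ _ indxi (iota_uniq _ _) mf fC).
    by apply: eq_Rintegral => w _; rewrite add0r big_mkord.
  have h1 := foldl_avg_le (index_iota 0 n) mf fC (one_step n) 0.
  have h2 := hK [seq s *: c n j | j <- index_iota 0 n] [seq col j A | j <- enum 'I_l] 0.
  have gE : gsteps 1 [seq s *: c n j | j <- index_iota 0 n] =
      [seq (S, s *: c n j) | j <- index_iota 0 n].
    by rewrite /gsteps -map_comp; apply: eq_map => j /=; rewrite scale1r.
  rewrite gE step_cov gauss_cov -gauss_end in h2.
  rewrite sumr_const_nat subn0 -[X in _ <= X]mulr_natl mulrCA in h1.
  rewrite distrC -(subrKA (avgs [seq (S, s *: c n j) | j <- index_iota 0 n] f 0)).
  by rewrite (le_trans (ler_normD _ _))// lerD// [X in K * X]distrC.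
apply/cvgrPdist_le => e e0.
have e2 : 0 < e / 2 by rewrite divr_gt0.
have eK : 0 < e / 2 / (K + 1) by rewrite divr_gt0//; lra.
have Enb : E * (n%:R * b n ^+ 3) @[n --> \oo] --> (0 : R).
  by rewrite -(mulr0 E); apply: cvgM; [exact: cvg_cst|exact: nb].
move/cvgrPdist_le in Enb; move/cvgrPdist_le in cov.
near=> n; rewrite (le_trans (main n))//.
have h1 : `|0 - E * (n%:R * b n ^+ 3)| <= e / 2.
  by near: n; exact: (Enb _ e2).
have h2 : `|A *m A^T - s2 *: \sum_(i < n) c n i *m (c n i)^T| <= e / 2 / (K + 1).
  by near: n; exact: (cov _ eK).
have h3 : K * `|A *m A^T - s2 *: \sum_(i < n) c n i *m (c n i)^T| <= e / 2.
  rewrite (le_trans (ler_wpM2l K0 h2))// mulrCA ler_piMr ?(ltW e2)//.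
  by rewrite ler_pdivrMr ?mul1r; lra.
move: h1; rewrite sub0r normrN => /(le_trans (ler_norm _)); lra.
Unshelve. all: by end_near. Qed.

(** Outside [B] the Lipschitz constant of the test function is used, inside [B] its bound. Closeness
    is expressed by a measurable exceptional event that may depend on [n]. *)
Lemma slutsky d (T : measurableType d) (P : probability T R)
    (Z V : nat -> T -> 'cV[R]_k) (f : 'cV[R]_k -> R) (a : R) :
  (forall n, random_vector (Z n)) -> (forall n, random_vector (V n)) -> smooth3 f ->
  (forall delta q : R, 0 < delta -> 0 < q -> \forall n \near \oo,
     exists B : set T, [/\ measurable B, (P B <= q%:E)%E &
       forall w, ~ B w -> `|Z n w - V n w| <= delta]) ->
  \int[P]_w f (V n w) @[n --> \oo] --> a -> \int[P]_w f (Z n w) @[n --> \oo] --> a.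
Proof.
move=> mZ mV sf close cV; have [C fC] := smooth3_bounded sf.
have [D fD] := smooth3_lipschitz sf; have mf := smooth3_cmeas sf.
have C0 : 0 <= C by exact: le_trans (fC 0).
apply/cvgrPdist_le => e e0.
have D0 : 0 < 3 * (`|D| + 1) by rewrite mulr_gt0// ltr_wpDl.
have C1 : 0 < 6 * (C + 1) by lra.
(* One third of [e] is allotted to each of the Lipschitz part, the exceptional event and the
   convergence along [V]. *)
pose delta := e / (3 * (`|D| + 1)); pose q := e / (6 * (C + 1)).
have delta0 : 0 < delta by rewrite divr_gt0.
have q0 : 0 < q by rewrite divr_gt0.
have e3 : 0 < e / 3 by rewrite divr_gt0.
near=> n.
have [B [mB PB hB]] : exists B : set T, [/\ measurable B, (P B <= q%:E)%E &
   forall w, ~ B w -> `|Z n w - V n w| <= delta].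
  by near: n; exact: close.
have Zi := cmeas_integrable P (mZ n) mf fC; have Vi := cmeas_integrable P (mV n) mf fC.
have ZVi := Rintegrable_sub Zi Vi.
have Bi : P.-integrable setT (EFin \o (\1_B : T -> R)).
  apply: (@bounded_integrable _ _ _ _ _ 1) => // w.
  by rewrite indicE; case: (_ \in _); rewrite ?normr1 ?normr0.
have IB : \int[P]_w (\1_B w) <= q.
  rewrite -lee_fin (le_trans _ PB)// /Rintegral integral_indic// setIT fineK//.
  exact: fin_num_measure.
have diff : `|\int[P]_w f (Z n w) - \int[P]_w f (V n w)| <= `|D| * delta + 2 * C * q.
  rewrite -RintegralB// (le_trans (le_normr_Rintegral _ ZVi))//.
  apply: (@le_trans _ _ (\int[P]_w (`|D| * delta + 2 * C * \1_B w))).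
    apply: le_Rintegral => //.
    - exact: (integrable_norm ZVi).
    - apply: Rintegrable_add; first exact: finite_measure_integrable_cst.
      exact: Rintegrable_scale.
    move=> w _; rewrite indicE; case: (boolP (w \in B)) => wB.
      rewrite mulr1 (le_trans (ler_normB _ _))//.
      have := fC (Z n w); have := fC (V n w).
      have : 0 <= `|D| * delta by rewrite mulr_ge0// ltW.
      rewrite /=; lra.
    rewrite mulr0 addr0 (le_trans (fD _ _))//.
    have hw : `|Z n w - V n w| <= delta by apply: hB => Bw; move: wB; rewrite mem_set.
    rewrite (le_trans (_ : _ <= `|D| * `|Z n w - V n w|))//; first by rewrite ler_wpM2r// ler_norm.
    by rewrite ler_wpM2l.
  rewrite RintegralD//; last 2 first.
  - exact: finite_measure_integrable_cst.
  - exact: Rintegrable_scale.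
  by rewrite RintegralZl// Rintegral_prob_cst lerD2l ler_wpM2l// mulr_ge0.
have hV : `|a - \int[P]_w f (V n w)| <= e / 3 by near: n; exact: cvgr_dist_le.
have d1 : `|D| * delta <= e / 3.
  rewrite /delta mulrCA; have -> : e / 3 = e * (1 / 3) by field.
  rewrite ler_pM2l// ler_pdivrMr//; lra.
have d2 : 2 * C * q <= e / 3.
  rewrite /q mulrCA; have -> : e / 3 = e * (1 / 3) by field.
  rewrite ler_pM2l// ler_pdivrMr//; lra.
rewrite -(subrKA (\int[P]_w f (V n w))) (le_trans (ler_normD _ _))//.
rewrite [X in _ + X]distrC; lra.
Unshelve. all: by end_near. Qed.

End central_limit.

(** * Asymptotic normality of the lasso estimate *)

Section error_moments.
Context d (T : measurableType d) {R : realType} (P : probability T R).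
Variables (eps : nat -> {RV P >-> R}) (tau : R).
Hypothesis tau01 : 0 < tau < 1.
Hypothesis ind_eps : mutually_independent eps.
Hypothesis id_eps : identically_distributed eps.
Hypothesis eps_expectile : forall i, 'E_P[fun w => g_tau tau (eps i w)]%E = 0%E.
Hypothesis eps_density : forall i, exists f : R -> R, has_density (eps i) f.
Hypothesis eps4 : forall i, ('E_P[fun w => (eps i w ^+ 4)%R] < +oo)%E.

Lemma measurable_h_tau : measurable_fun setT (h_tau tau).
Proof.
have -> : h_tau tau = (fun e => 2 * (if e < 0 then 1 - tau else tau)).
  by apply/funext => e; rewrite h_tauE.
apply: measurable_funM => //; apply: measurable_fun_ifT => //.
exact: measurable_fun_ltr.
Qed.

Lemma measurable_g_tau : measurable_fun setT (g_tau tau).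
Proof.
have -> : g_tau tau = (fun e => - h_tau tau e * e).
  by apply/funext => e; rewrite g_tauE.
apply: measurable_funM => //; apply: measurableT_comp => //; exact: measurable_h_tau.
Qed.

Lemma error_pow4_integrable i : P.-integrable setT (EFin \o (fun w => eps i w ^+ 4)).
Proof.
have m4 : measurable_fun setT (fun w => eps i w ^+ 4) by exact: measurable_funX.
apply/integrableP; split; first exact/measurable_EFinP.
rewrite (_ : \int[P]_x _ = 'E_P[fun w => (eps i w ^+ 4)%R])%E//.
rewrite unlock; apply: eq_integral => w _ /=; rewrite ger0_norm//.
by rewrite (exprM _ 2 2) sqr_ge0.
Qed.

Lemma dominated_by_pow4 (g : R -> R) (C : R) i : measurable_fun setT g ->
  (forall e, `|g e| <= C * (1 + e ^+ 4)) -> P.-integrable setT (EFin \o (fun w => g (eps i w))).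
Proof.
move=> mg gC.
have i4 : P.-integrable setT (EFin \o (fun w => C * (1 + eps i w ^+ 4))).
  apply: Rintegrable_scale; apply: Rintegrable_add; last exact: error_pow4_integrable.
  exact: finite_measure_integrable_cst.
apply: (le_integrable measurableT _ _ i4).
  by apply/measurable_EFinP; exact: measurableT_comp.
by move=> w _ /=; rewrite lee_fin (le_trans (gC _))// ler_norm.
Qed.

Lemma pow_le_pow4 (e : R) n : (n <= 4)%N -> `|e| ^+ n <= 1 + e ^+ 4.
Proof.
move=> n4; have e4 : e ^+ 4 = `|e| ^+ 4 by rewrite -normrX ger0_norm// (exprM _ 2 2) sqr_ge0.
have e40 : 0 <= `|e| ^+ 4 by rewrite exprn_ge0.
rewrite e4; have [e1|e1] := leP `|e| 1.
  have : `|e| ^+ n <= 1 by rewrite exprn_ile1.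
  by lra.
have h : `|e| ^+ n <= `|e| ^+ 4 by apply: ler_weXn2l => //; exact: ltW.
by lra.
Qed.

Lemma normr_g_tauX (e : R) n : (n <= 4)%N -> `|g_tau tau e| ^+ n <= 2 ^+ n * (1 + e ^+ 4).
Proof.
move=> n4; apply: (@le_trans _ _ ((2 * `|e|) ^+ n)).
  by rewrite lerXn2r ?nnegrE ?mulr_ge0// normr_g_tau.
by rewrite exprMn ler_wpM2l ?exprn_ge0// pow_le_pow4.
Qed.

Definition score_error i : {RV P >-> R} := rv_comp measurable_g_tau (eps i).

Lemma independent_score_error : mutually_independent score_error.
Proof. exact: independent_rv_comp. Qed.

Lemma score_error_integrable i : P.-integrable setT (EFin \o (fun w => score_error i w)).
Proof.
apply: (@dominated_by_pow4 _ (2 ^+ 1) i measurable_g_tau) => e.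
by have := @normr_g_tauX e 1 isT; rewrite expr1.
Qed.

Lemma score_error_sqr_integrable i :
  P.-integrable setT (EFin \o (fun w => score_error i w ^+ 2)).
Proof.
apply: (@dominated_by_pow4 (fun e => g_tau tau e ^+ 2) (2 ^+ 2) i).
  exact: measurable_funX measurable_g_tau.
by move=> e; rewrite normrX normr_g_tauX.
Qed.

Lemma score_error_cube_integrable i :
  P.-integrable setT (EFin \o (fun w => `|score_error i w| ^+ 3)).
Proof.
apply: (@dominated_by_pow4 (fun e => `|g_tau tau e| ^+ 3) (2 ^+ 3) i).
  apply: measurable_funX; apply: measurableT_comp measurable_g_tau.
  exact: continuous_measurable_fun (@norm_continuous _ R^o).
by move=> e; rewrite normrX normr_id normr_g_tauX.
Qed.

Lemma score_error_mean i : \int[P]_w score_error i w = 0.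
Proof.
have := eps_expectile i; rewrite expectation_Rintegral; last exact: score_error_integrable.
by move=> h; apply: EFin_inj; exact: h.
Qed.

Lemma error_Rintegral (g : R -> R) i : measurable_fun setT g ->
  (forall j, P.-integrable setT (EFin \o (fun w => g (eps j w)))) ->
  \int[P]_w g (eps i w) = \int[P]_w g (eps 0%N w).
Proof.
by move=> mg gi; apply: identically_distributed_Rintegral => // A mA; exact: id_eps.
Qed.

Definition error_variance : R := \int[P]_w (score_error 0%N w ^+ 2).

Lemma score_error_variance i : \int[P]_w (score_error i w ^+ 2) = error_variance.
Proof.
apply: (@error_Rintegral (fun e => g_tau tau e ^+ 2)).
  exact: measurable_funX measurable_g_tau.
exact: score_error_sqr_integrable.
Qed.

Lemma score_error_cube i :
  \int[P]_w (`|score_error i w| ^+ 3) = \int[P]_w (`|score_error 0%N w| ^+ 3).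
Proof.
apply: (@error_Rintegral (fun e => `|g_tau tau e| ^+ 3)).
  apply: measurable_funX; apply: measurableT_comp measurable_g_tau.
  exact: continuous_measurable_fun (@norm_continuous _ R^o).
exact: score_error_cube_integrable.
Qed.

Lemma variance_g_tau : 'V_P[fun w => g_tau tau (eps 0%N w)]%E = error_variance%:E.
Proof.
rewrite /variance covariance.unlock eps_expectile/=.
rewrite -expectation_Rintegral; last exact: score_error_sqr_integrable.
rewrite !unlock; apply: eq_integral => w _; congr EFin.
by rewrite !fctE/= subr0 expr2.
Qed.

Definition mean_h : R := \int[P]_w h_tau tau (eps 0%N w).

Lemma h_tau_integrable i : P.-integrable setT (EFin \o (fun w => h_tau tau (eps i w))).
Proof.
apply: (@bounded_integrable _ _ _ _ _ 2) => [|w].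
  exact: (measurableT_comp measurable_h_tau).
by have /andP[h0 h2] := h_tau_le2 tau01 (eps i w); rewrite ger0_norm.
Qed.

Lemma expectation_h_tau : 'E_P[fun w => h_tau tau (eps 0%N w)]%E = mean_h%:E.
Proof. by rewrite expectation_Rintegral//; exact: h_tau_integrable. Qed.

Lemma mean_h_gt0 : 0 < mean_h.
Proof.
have /andP[t0 t1] := tau01; pose c := Num.min tau (1 - tau).
have c0 : 0 < c by rewrite lt_min t0 subr_gt0.
have ct : c <= tau by rewrite ge_min lexx.
have ct1 : c <= 1 - tau by rewrite ge_min lexx orbT.
apply: (@lt_le_trans _ _ (2 * c)); first lra.
rewrite -[leLHS](Rintegral_prob_cst P); apply: le_Rintegral => //.
- exact: finite_measure_integrable_cst.
- exact: h_tau_integrable.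
- by move=> w _; rewrite h_tauE; case: ifP => _; lra.
Qed.

Lemma measurable_h_dev : measurable_fun setT (fun e => h_tau tau e - mean_h).
Proof. by apply: measurable_funB => //; exact: measurable_h_tau. Qed.

Definition hessian_error i : {RV P >-> R} := rv_comp measurable_h_dev (eps i).

Lemma independent_hessian_error : mutually_independent hessian_error.
Proof. exact: independent_rv_comp. Qed.

Lemma hessian_error_sqr_integrable i :
  P.-integrable setT (EFin \o (fun w => hessian_error i w ^+ 2)).
Proof.
have mh0 := mean_h_gt0.
apply: (@bounded_integrable _ _ _ _ _ ((2 + mean_h) ^+ 2)) => [|w].
  exact: measurable_funX.
rewrite normrX lerXn2r ?nnegrE//; first lra.
have /andP[h0 h2] := h_tau_le2 tau01 (eps i w).
rewrite (le_trans (ler_normB _ _))// lerD//; rewrite ger0_norm//; exact: ltW.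
Qed.

Lemma hessian_error_mean i : \int[P]_w hessian_error i w = 0.
Proof.
rewrite RintegralB//; last 2 first.
- exact: h_tau_integrable.
- exact: finite_measure_integrable_cst.
rewrite Rintegral_prob_cst (error_Rintegral i measurable_h_tau h_tau_integrable).
by rewrite subrr.
Qed.

Lemma hessian_error_variance i :
  \int[P]_w (hessian_error i w ^+ 2) = \int[P]_w (hessian_error 0%N w ^+ 2).
Proof.
apply: (@error_Rintegral (fun e => (h_tau tau e - mean_h) ^+ 2)).
  exact: measurable_funX measurable_h_dev.
exact: hessian_error_sqr_integrable.
Qed.

Definition small_error_prob (a : R) : R := \int[P]_w (`|eps 0%N w| <= a)%R%:R.

Lemma measurable_small (a : R) : measurable_fun setT (fun e : R => (`|e| <= a)%R%:R : R).
Proof.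
have -> : (fun e : R => (`|e| <= a)%R%:R : R) = (fun e => if `|e| <= a then 1 else 0).
  by apply/funext => e; case: (_ <= _).
apply: measurable_fun_ifT => //; exact: measurable_fun_ler.
Qed.

Lemma small_integrable (a : R) i :
  P.-integrable setT (EFin \o (fun w => (`|eps i w| <= a)%R%:R : R)).
Proof.
apply: (@bounded_integrable _ _ _ _ _ 1) => [|w].
  exact: (measurableT_comp (measurable_small a)).
by case: (`|eps i w| <= a); rewrite ?normr1 ?normr0.
Qed.

(** The indicators converge pointwise to that of the event where the error is exactly [0], which is
    null since the law has a density; dominated convergence concludes. *)
Lemma small_error_prob_cvg (a : nat -> R) : (forall n, 0 <= a n) -> a @ \oo --> (0 : R) ->
  small_error_prob (a n) @[n --> \oo] --> (0 : R).
Proof.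
move=> a_ge0 a0; have [f df] := eps_density 0%N.
have P0 : \int[P]_w (eps 0%N w == 0)%R%:R = 0 :> R.
  have -> : (fun w => (eps 0%N w == 0)%R%:R : R) = \1_(eps 0%N @^-1` [set 0]).
    apply/funext => w; rewrite indicE; congr (_%:R); congr nat_of_bool.
    by apply/eqP/idP => [h|]; rewrite ?inE.
  rewrite /Rintegral integral_indic// setIT.
  have := df.2 [set 0] (measurable_set1 _).
  rewrite null_set_integral//; last 2 first.
  - by apply/measurable_EFinP; apply: measurable_funTS df.1.
  - exact: lebesgue_measure_set1.
  by rewrite /distribution/= /pushforward => ->.
rewrite -P0 /small_error_prob.
apply: (@Rdominated_cvg _ _ _ P (fun n w => (`|eps 0%N w| <= a n)%R%:R)
  (fun w => (eps 0%N w == 0)%R%:R) (fun=> 1)).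
- by move=> n; exact: (measurableT_comp (measurable_small (a n))).
- exact: finite_measure_integrable_cst.
- move=> w; apply/cvgrPdist_le => e e0.
  have [->|ew] := eqVneq (eps 0%N w) 0.
    by near=> n; rewrite normr0 a_ge0 subrr normr0 ltW.
  have ew0 : 0 < `|eps 0%N w| by rewrite normr_gt0.
  move/cvgrPdist_lt/(_ _ ew0) in a0; near=> n.
  have : `|0 - a n| < `|eps 0%N w| by near: n.
  rewrite sub0r normrN (ger0_norm (a_ge0 n)) ltNge => /negPf ->.
  by rewrite subrr normr0 ltW.
- by move=> n w; case: (`|eps 0%N w| <= a n); rewrite ?normr1 ?normr0.
Unshelve. all: by end_near. Qed.

End error_moments.

(** * Moment bounds and events of probability close to one *)

Section asymptotic_events.
Context d (T : measurableType d) {R : realType} (P : probability T R).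
Variables (eps : nat -> {RV P >-> R}) (tau : R).
Hypothesis tau01 : 0 < tau < 1.
Hypothesis ind_eps : mutually_independent eps.
Hypothesis id_eps : identically_distributed eps.
Hypothesis eps_expectile : forall i, 'E_P[fun w => g_tau tau (eps i w)]%E = 0%E.
Hypothesis eps_density : forall i, exists f : R -> R, has_density (eps i) f.
Hypothesis eps4 : forall i, ('E_P[fun w => (eps i w ^+ 4)%R] < +oo)%E.
Variables (r : nat) (X : nat -> 'cV[R]_r) (C0 : R).
Hypothesis C0_ge0 : 0 <= C0.
Hypothesis XC0 : forall i, `|X i| <= C0.

Local Notation mu := (mean_h eps tau).
Local Notation s2 := (error_variance eps tau).
Local Notation e_ w := (eps ^~ w).

Lemma scoreE w n q : score tau X (e_ w) n q ord0 =
  \sum_(i < n) (Num.sqrt n%:R)^-1 * X i q ord0 * score_error eps tau i w.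
Proof.
rewrite /score mxE summxE mulr_sumr; apply: eq_bigr => i _.
by rewrite mxE -mulrA [X i q ord0 * _]mulrC.
Qed.

Lemma hessian_devE w n q q' : hessian_dev tau X mu (e_ w) n q q' =
  \sum_(i < n) n%:R^-1 * (X i q ord0 * X i q' ord0) * hessian_error eps tau i w.
Proof.
rewrite /hessian_dev mxE summxE mulr_sumr; apply: eq_bigr => i _.
by rewrite !mxE big_ord1 !mxE -mulrA [X i q ord0 * _ * _]mulrC.
Qed.

Lemma score_second_moment n q :
  P.-integrable setT (EFin \o (fun w => score tau X (e_ w) n q ord0 ^+ 2)) /\
  \int[P]_w (score tau X (e_ w) n q ord0 ^+ 2) <= s2 * C0 ^+ 2.
Proof.
have [h1 h2] := weighted_sum_second_moment (independent_score_error tau ind_eps)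
  (score_error_sqr_integrable tau01 eps4) (score_error_mean tau01 eps_expectile eps4)
  (score_error_variance tau01 id_eps eps4) (fun i => (Num.sqrt n%:R)^-1 * X i q ord0) n.
have E : (fun w => score tau X (e_ w) n q ord0 ^+ 2) =
    fun w => (\sum_(i < n) (Num.sqrt n%:R)^-1 * X i q ord0 * score_error eps tau i w) ^+ 2.
  by apply/funext => w; rewrite scoreE.
rewrite E; split=> //; rewrite h2; apply: ler_wpM2l.
  by apply: Rintegral_ge0 => w _; exact: sqr_ge0.
have -> : \sum_(i < n) ((Num.sqrt n%:R)^-1 * X i q ord0) ^+ 2 =
    n%:R^-1 * \sum_(i < n) X i q ord0 ^+ 2.
  by rewrite mulr_sumr; apply: eq_bigr => i _; rewrite exprMn exprVn sqr_sqrtr.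
apply: (@mean_le R n (fun i => X i q ord0 ^+ 2)) => [|i]; first exact: sqr_ge0.
rewrite -real_normK ?num_real// lerXn2r ?nnegrE//.
exact: le_trans (mx_norm_entry _ _ _) (XC0 i).
Qed.

(** Centred independent terms with coefficients of order [1 / n] are orthogonal, so that the sum of
    their second moments is of order [1 / n]. *)
Lemma hessian_second_moment n q q' : (0 < n)%N ->
  P.-integrable setT (EFin \o (fun w => hessian_dev tau X mu (e_ w) n q q' ^+ 2)) /\
  \int[P]_w (hessian_dev tau X mu (e_ w) n q q' ^+ 2) <=
  \int[P]_w (hessian_error eps tau 0%N w ^+ 2) * C0 ^+ 4 / n%:R.
Proof.
move=> n0; have nR : 0 < n%:R :> R by rewrite ltr0n.
have [h1 h2] := weighted_sum_second_moment (independent_hessian_error tau ind_eps)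
  (hessian_error_sqr_integrable eps tau01) (hessian_error_mean tau01 id_eps)
  (hessian_error_variance tau01 id_eps)
  (fun i => n%:R^-1 * (X i q ord0 * X i q' ord0)) n.
have E : (fun w => hessian_dev tau X mu (e_ w) n q q' ^+ 2) =
    fun w => (\sum_(i < n) n%:R^-1 * (X i q ord0 * X i q' ord0) *
      hessian_error eps tau i w) ^+ 2.
  by apply/funext => w; rewrite hessian_devE.
rewrite E; split=> //; rewrite h2 -mulrA; apply: ler_wpM2l.
  by apply: Rintegral_ge0 => w _; exact: sqr_ge0.
have -> : \sum_(i < n) (n%:R^-1 * (X i q ord0 * X i q' ord0)) ^+ 2 =
    (n%:R^-1 * \sum_(i < n) (X i q ord0 * X i q' ord0) ^+ 2) / n%:R.
  rewrite mulr_sumr mulr_suml; apply: eq_bigr => i _.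
  by move: (X i q ord0 * X i q' ord0) (n%:R^-1 : R) => y z; ring.
apply: ler_wpM2r; first by rewrite invr_ge0.
apply: (@mean_le R n (fun i => (X i q ord0 * X i q' ord0) ^+ 2)) => [|i].
  by rewrite exprn_ge0.
have -> : C0 ^+ 4 = (C0 * C0) ^+ 2 by ring.
rewrite -real_normK ?num_real// lerXn2r ?nnegrE ?mulr_ge0// normrM.
by rewrite ler_pM//; exact: le_trans (mx_norm_entry _ _ _) (XC0 i).
Qed.

Lemma small_error_freq_expectation (kap : R) n :
  P.-integrable setT (EFin \o (fun w => small_error_freq kap (e_ w) n)) /\
  \int[P]_w small_error_freq kap (e_ w) n <=
  small_error_prob eps (kap / Num.sqrt n%:R).
Proof.
have si := small_integrable eps (kap / Num.sqrt n%:R).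
split; first by apply: Rintegrable_scale; apply: Rintegrable_sum => i; exact: si.
rewrite RintegralZl//; last by apply: Rintegrable_sum => i; exact: si.
rewrite Rintegral_sum => [|i]; last exact: si.
apply: (@mean_le R n (fun i => \int[P]_w (`|eps i w| <= kap / Num.sqrt n%:R)%R%:R)).
  by apply: Rintegral_ge0 => w _.
move=> i; rewrite (error_Rintegral id_eps i (measurable_small (kap / Num.sqrt n%:R)))//.
Qed.

(* A single Markov bound on the sum of the three rescaled nonnegative quantities. *)
Lemma asymptotic_event (q : R) : 0 < q -> exists2 K : R, 0 <= K &
  forall kap eta : R, 0 <= kap -> 0 < eta -> \forall n \near \oo,
    exists B : set T, [/\ measurable B, (P B <= q%:E)%E & forall w, ~ B w ->
      [/\ `|score tau X (e_ w) n| <= K, small_error_freq kap (e_ w) n <= eta &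
          `|hessian_dev tau X mu (e_ w) n| <= eta]].
Proof.
move=> q0; pose c1 := r%:R * (s2 * C0 ^+ 2).
have s20 : 0 <= s2 by apply: Rintegral_ge0 => w _; exact: sqr_ge0.
have c10 : 0 <= c1 by rewrite mulr_ge0// mulr_ge0// sqr_ge0.
(* Chosen so that the expected squared norm of the score, at most [c1], contributes at most [q / 3];
   the [1] makes [K2] positive. *)
pose K2 := 3 * c1 / q + 1.
have K20 : 0 < K2 by rewrite ltr_wpDl// divr_ge0 ?(ltW q0)// mulr_ge0.
have c1K : c1 / K2 <= q / 3.
  rewrite ler_pdivrMr//; have -> : q / 3 * K2 = c1 + q / 3.
    by rewrite /K2; field; rewrite gt_eqF.
  by rewrite lerDl divr_ge0// ltW.
exists (Num.sqrt K2) => [|kap eta kap0 eta0]; first exact: sqrtr_ge0.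
pose sh := \int[P]_w (hessian_error eps tau 0%N w ^+ 2).
pose c2 := r%:R * (r%:R * (sh * C0 ^+ 4)) / eta ^+ 2.
have c20 : 0 <= c2.
  rewrite divr_ge0 ?sqr_ge0//; do 2 apply: mulr_ge0 => //; apply: mulr_ge0.
    by apply: Rintegral_ge0 => w _; exact: sqr_ge0.
  by rewrite exprn_ge0.
have kapn := cst_div_sqrt_cvg kap0.
have kap_ge0 n : 0 <= kap / Num.sqrt n%:R by rewrite divr_ge0// sqrtr_ge0.
have small := small_error_prob_cvg eps_density kap_ge0 kapn.
move/cvgrPdist_le in small.
have q3 : 0 < q / 3 by rewrite divr_gt0.
have qe : 0 < q / 3 * eta by rewrite mulr_gt0.
near=> n.
have n0 : (0 < n)%N by near: n; exists 1%N.
have nR : 0 < n%:R :> R by rewrite ltr0n.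
(* Each summand exceeds [1] as soon as the corresponding bound fails, and has expectation at most
   [q / 3] for [n] large. *)
pose Psi w := (\sum_i score tau X (e_ w) n i ord0 ^+ 2) / K2 +
  (\sum_i \sum_j hessian_dev tau X mu (e_ w) n i j ^+ 2) / eta ^+ 2 +
  small_error_freq kap (e_ w) n / eta.
have i1 : P.-integrable setT (EFin \o (fun w => \sum_i score tau X (e_ w) n i ord0 ^+ 2)).
  by apply: Rintegrable_sum => i; case: (score_second_moment n i).
have i2 : P.-integrable setT
    (EFin \o (fun w => \sum_i \sum_j hessian_dev tau X mu (e_ w) n i j ^+ 2)).
  apply: Rintegrable_sum => i; apply: Rintegrable_sum => j.
  by case: (hessian_second_moment i j n0).
have [i3 small_le] := small_error_freq_expectation kap n.
have scaleV (f : T -> R) (a : R) : P.-integrable setT (EFin \o f) ->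
    P.-integrable setT (EFin \o (fun w => f w / a)) /\
    \int[P]_w (f w / a) = (\int[P]_w f w) / a.
  move=> fi; have fE : (fun w => f w / a) = (fun w => a^-1 * f w).
    by apply/funext => w; rewrite mulrC.
  by rewrite fE; split; [exact: Rintegrable_scale|rewrite RintegralZl// mulrC].
have [j1 e1] := scaleV _ K2 i1; have [j2 e2] := scaleV _ (eta ^+ 2) i2.
have [j3 e3] := scaleV _ eta i3.
have j12 := Rintegrable_add j1 j2; have Psi_i := Rintegrable_add j12 j3.
have eta20 : 0 < eta ^+ 2 by rewrite exprn_gt0.
have freq0 w : 0 <= small_error_freq kap (e_ w) n.
  by rewrite mulr_ge0 ?invr_ge0// sumr_ge0.
have sc0 w : 0 <= \sum_i score tau X (e_ w) n i ord0 ^+ 2.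
  by apply: sumr_ge0 => i _; exact: sqr_ge0.
have he0 w : 0 <= \sum_i \sum_j hessian_dev tau X mu (e_ w) n i j ^+ 2.
  by apply: sumr_ge0 => i _; apply: sumr_ge0 => j _; exact: sqr_ge0.
have t1 w : 0 <= (\sum_i score tau X (e_ w) n i ord0 ^+ 2) / K2.
  by rewrite divr_ge0// ltW.
have t2 w : 0 <= (\sum_i \sum_j hessian_dev tau X mu (e_ w) n i j ^+ 2) / eta ^+ 2.
  by rewrite divr_ge0// ltW.
have t3 w : 0 <= small_error_freq kap (e_ w) n / eta by rewrite divr_ge0// ltW.
have Psi0 w : 0 <= Psi w by rewrite /Psi !addr_ge0.
have mPsi : measurable_fun setT Psi.
  exact: (measurable_EFinP _ _).1 (measurable_int _ Psi_i).
have intPsi : \int[P]_w Psi w <= q.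
  rewrite RintegralD// RintegralD// e1 e2 e3.
  have b1 : (\int[P]_w \sum_i score tau X (e_ w) n i ord0 ^+ 2) / K2 <= q / 3.
    apply: le_trans c1K; rewrite ler_wpM2r ?invr_ge0 ?(ltW K20)//.
    rewrite Rintegral_sum => [|i]; last by case: (score_second_moment n i).
    rewrite (le_trans (ler_sum _ (fun i _ => (score_second_moment n i).2)))//.
    by rewrite sumr_const card_ord -[leLHS]mulr_natl.
  have b2 : (\int[P]_w \sum_i \sum_j hessian_dev tau X mu (e_ w) n i j ^+ 2) / eta ^+ 2 <=
      c2 / n%:R.
    rewrite /c2 mulrAC ler_wpM2r ?invr_ge0 ?(ltW eta20)//.
    rewrite Rintegral_sum => [|i]; last first.
      by apply: Rintegrable_sum => j; case: (hessian_second_moment i j n0).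
    rewrite (le_trans (_ : _ <= \sum_(i < r) \sum_(j < r) sh * C0 ^+ 4 / n%:R))//; last first.
      by rewrite !sumr_const card_ord -[leLHS]mulr_natl -[X in _ * X]mulr_natl !mulrA.
    apply: ler_sum => i _.
    rewrite Rintegral_sum => [|j]; last by case: (hessian_second_moment i j n0).
    by apply: ler_sum => j _; exact: (hessian_second_moment i j n0).2.
  have b2' : c2 / n%:R <= q / 3.
    have : c2 / (q / 3) <= n%:R by near: n; exact: nbhs_infty_ger.
    by rewrite !ler_pdivrMr// [n%:R * _]mulrC.
  have b3 : (\int[P]_w small_error_freq kap (e_ w) n) / eta <= q / 3.
    rewrite ler_pdivrMr// (le_trans small_le)//.
    have : `|0 - small_error_prob eps (kap / Num.sqrt n%:R)| <= q / 3 * eta.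
      by near: n; exact: small.
    by rewrite sub0r normrN; exact: le_trans (ler_norm _).
  lra.
exists [set w | (1 < Psi w)%R]; split.
- have := measurable_fun_ltr (measurable_cst (1 : R)) mPsi.
  by move=> /(_ measurableT [set true]); rewrite setTI => h; apply: h.
- have := Rintegral_markov mPsi Psi_i Psi0 ltr01.
  by rewrite divr1 => /le_trans; apply; rewrite lee_fin.
move=> w /negP; rewrite -leNgt => Psi1; have := t1 w; have := t2 w; have := t3 w.
move: Psi1; rewrite /Psi => Psi1 t3w t2w t1w; split.
- apply: mx_norm_le => [|i j]; first exact: sqrtr_ge0.
  rewrite ord1 -sqrtr_sqr ler_sqrt ?(ltW K20)//.
  have : (\sum_i score tau X (e_ w) n i ord0 ^+ 2) / K2 <= 1 by lra.
  rewrite ler_pdivrMr// mul1r; apply: le_trans.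
  by rewrite (bigD1 i)//= lerDl sumr_ge0// => j' _; exact: sqr_ge0.
- have : small_error_freq kap (e_ w) n / eta <= 1 by lra.
  by rewrite ler_pdivrMr// mul1r.
- apply: mx_norm_le => [|i j]; first exact: ltW.
  have : (\sum_i \sum_j hessian_dev tau X mu (e_ w) n i j ^+ 2) / eta ^+ 2 <= 1 by lra.
  rewrite ler_pdivrMr// mul1r => h.
  rewrite -[leRHS]gtr0_norm// -ler_sqr ?nnegrE// !real_normK ?num_real//.
  apply: le_trans h; rewrite (bigD1 i)//= (bigD1 j)//= -addrA lerDl addr_ge0//.
    by apply: sumr_ge0 => j' _; exact: sqr_ge0.
  by apply: sumr_ge0 => i' _; apply: sumr_ge0 => j' _; exact: sqr_ge0.
Unshelve. all: by end_near. Qed.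

End asymptotic_events.

(** * The leading term as a weighted sum of independent variables *)

Section leading_term_law.
Context {R : realType} (p p0 : nat) (hp : (p0 <= p)%N) (d : 'I_p -> nat).
Local Notation r := (\sum_(j < p) d j)%N.
Local Notation r0 := (\sum_(j < p0) d (widen_ord hp j))%N.
Local Notation J := (@sel_mx R p p0 hp d).
Variables (X : nat -> 'cV[R]_r) (Upsilon : 'M[R]_r) (tau mu C0 : R).
Hypothesis mu0 : 0 < mu.
Hypothesis C0_ge0 : 0 <= C0.
Hypothesis XC0 : forall i, `|X i| <= C0.
Hypothesis gram_cvg : gram X n @[n --> \oo] --> Upsilon.
Hypothesis Upd : posdef Upsilon.

Local Notation S0 := (J^T *m Upsilon *m J).

Definition leading_coef (n i : nat) : 'cV[R]_r0 :=
  - (mu^-1 * (Num.sqrt n%:R)^-1) *: (invmx S0 *m (J^T *m X i)).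

Lemma leading_termE e n : leading_term hp X tau Upsilon mu e n =
  \sum_(i < n) g_tau tau (e i) *: leading_coef n i.
Proof.
rewrite /leading_term /score -!scalemxAr scalerA -scaleNr mulmx_sumr mulmx_sumr scaler_sumr.
apply: eq_bigr => i _; rewrite /leading_coef -!scalemxAr scalerA [RHS]scalerA.
by rewrite [X in X *: _]mulrC.
Qed.

Definition leading_bound (n : nat) : R :=
  mu^-1 * (r0%:R * `|invmx S0| * C0) * (Num.sqrt n%:R)^-1.

Lemma leading_coef_le n i : `|leading_coef n i| <= leading_bound n.
Proof.
have s0 : 0 <= (Num.sqrt n%:R)^-1 :> R by rewrite invr_ge0 sqrtr_ge0.
have m0 : 0 <= mu^-1 by rewrite invr_ge0 ltW.
rewrite /leading_coef /leading_bound normrZ normrN normrM (ger0_norm s0) (ger0_norm m0).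
rewrite [leRHS]mulrAC ler_wpM2l// ?mulr_ge0//.
rewrite (le_trans (mx_normM _ _))// ler_wpM2l ?mulr_ge0//.
exact: le_trans (norm_tr_sel_mx _ _) (XC0 i).
Qed.

(** The coefficients are of order [n^(-1/2)], so that the total cost of [n] replacements is of the
    same order. *)
Lemma leading_bound_cvg : n%:R * leading_bound n ^+ 3 @[n --> \oo] --> (0 : R).
Proof.
pose B := (mu^-1 * (r0%:R * `|invmx S0| * C0)) ^+ 3.
have B0 : 0 <= B.
  by rewrite exprn_ge0// mulr_ge0 ?invr_ge0 ?(ltW mu0)// !mulr_ge0.
have E n : n%:R * leading_bound n ^+ 3 = B / Num.sqrt n%:R.
  rewrite /leading_bound exprMn -/B mulrCA; congr (_ * _).
  rewrite -[X in X * _ = _](@sqr_sqrtr _ n%:R)//; set s := Num.sqrt _.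
  have [->|s0] := eqVneq s 0; first by rewrite invr0 expr0n mul0r.
  by field.
under eq_fun do rewrite E; exact: cst_div_sqrt_cvg.
Qed.

(** Up to a scalar the covariance is [M *m gram X n *m M^T] with [M := invmx S0 *m J^T]. In the
    limit the middle factor becomes [S0], the active block of [Upsilon], which cancels one of the
    two inverses. *)
Lemma leading_cov_cvg (s2 : R) :
  s2 *: \sum_(i < n) leading_coef n i *m (leading_coef n i)^T @[n --> \oo] -->
  (s2 * mu ^- 2) *: invmx S0.
Proof.
have Sp : posdef S0 by exact: posdef_sel.
have Su := posdef_unitmx Sp; have [St _] := Sp.
pose M := invmx S0 *m J^T.
have covE n : s2 *: \sum_(i < n) leading_coef n i *m (leading_coef n i)^T =
    (s2 * mu ^- 2) *: (M *m gram X n *m M^T).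
  rewrite /gram -scalemxAr -scalemxAl scalerA -[RHS]scalerA -[in RHS]scalerA; congr (_ *: _).
  rewrite mulmx_sumr mulmx_suml scaler_sumr scaler_sumr; apply: eq_bigr => i _.
  have -> : (leading_coef n i)^T =
      - (mu^-1 * (Num.sqrt n%:R)^-1) *: (invmx S0 *m (J^T *m X i))^T.
    by rewrite /leading_coef linearZ.
  rewrite /leading_coef -scalemxAl -scalemxAr !scalerA.
  rewrite trmx_mul trmx_mul trmxK /M trmx_mul trmxK !mulmxA; congr (_ *: _).
  (* For an empty sample both scalars vanish, by the convention on the inverse of [0]. *)
  have [->|nn] := eqVneq (n%:R : R) 0.
    by rewrite sqrtr0 !invr0 !(mulr0, mul0r) oppr0 mulr0.
  rewrite -[in RHS](@sqr_sqrtr _ n%:R)//.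
  have sn : Num.sqrt n%:R != 0 :> R.
    by rewrite gt_eqF// sqrtr_gt0 lt_neqAle eq_sym nn ler0n.
  by move: (Num.sqrt n%:R) sn => s sn; field; rewrite sn gt_eqF.
have limE : M *m Upsilon *m M^T = invmx S0.
  rewrite /M trmx_mul trmxK trmx_inv St -!mulmxA [X in _ *m X](_ : _ = 1%:M) ?mulmx1//.
  by rewrite !mulmxA mulmxV.
rewrite -limE; apply/cvgrPdist_le => e e0.
pose D := r%:R * (r%:R * `|M|) * `|M^T|.
have D0 : 0 <= D by rewrite !mulr_ge0.
pose K := `|s2 * mu ^- 2| * D + 1.
have K0 : 0 < K by rewrite ltr_wpDl// mulr_ge0.
have eK : 0 < e / K by rewrite divr_gt0.
have := gram_cvg => /cvgrPdist_le/(_ _ eK) gK; near=> n.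
rewrite covE -scalerBr -mulmxBl -mulmxBr normrZ.
have h1 : `|Upsilon - gram X n| <= e / K by near: n.
have h2 : `|M *m (Upsilon - gram X n) *m M^T| <= D * `|Upsilon - gram X n|.
  rewrite (le_trans (mx_normM _ _))// [leRHS]mulrAC ler_wpM2r//.
  rewrite -[leRHS]mulrA ler_wpM2l//; exact: mx_normM.
rewrite (le_trans (ler_wpM2l (normr_ge0 _) h2))// [_ * (D * _)]mulrA.
have -> : e = K * (e / K) by rewrite mulrC divfK// gt_eqF.
apply: ler_pM => //; first by apply: mulr_ge0.
by rewrite /K lerDl.
Unshelve. all: by end_near. Qed.

End leading_term_law.

Lemma random_vector_mulmx (R : realType) disp (T : measurableType disp) (k l : nat)
    (A : 'M[R]_(k, l)) (Z : T -> 'cV[R]_l) :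
  random_vector Z -> random_vector (fun w => A *m Z w).
Proof.
move=> mZ i; apply: (eq_measurable_fun (fun w => \sum_j A i j * Z w j ord0)).
  by move=> w _; rewrite mxE.
by apply: measurable_sum => j; apply: measurable_funM.
Qed.

Theorem theorem3p1 (R : realType)
  (disp : measure_display) (T : measurableType disp) (P : probability T R)
  (p p0 : nat) (hp : (p0 <= p)%N) (d : 'I_p -> nat)
  (X : nat -> 'cV[R]_(\sum_(j < p) d j))
  (beta0 : 'cV[R]_(\sum_(j < p) d j))
  (eps : nat -> {RV P >-> R}) (Y : nat -> T -> R)
  (tau gamma : R) (lam : nat -> R)
  (Upsilon : 'M[R]_(\sum_(j < p) d j))
  (beta_tilde beta_hat : nat -> T -> 'cV[R]_(\sum_(j < p) d j)) :
  (forall j, (0 < d j)%N) ->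
  (forall j : 'I_p, norm2 (submxcol beta0 j) != 0 <-> (j < p0)%N) ->
  (forall i w, Y i w = dotv (X i) beta0 + eps i w) ->
  0 < tau < 1 ->
  0 < gamma ->
  (forall n, 0 < lam n) ->
  mutually_independent eps ->
  identically_distributed eps ->
  (forall i, 'E_P[fun w => g_tau tau (eps i w)]%E = 0%E) ->
  (exists f : R -> R, [/\ forall i, has_density (eps i) f,
     forall x, 0 < f x & \forall x \near (0 : R), {for x, continuous f}]) ->
  (forall i, ('E_P[fun w => (eps i w ^+ 4)%R] < +oo)%E) ->
  (exists2 C0 : R, 0 < C0 & forall i, `|X i| <= C0) ->
  (exists m0 M0 : R, [/\ 0 < m0, m0 <= M0 &
     \forall n \near \oo,
       [/\ m0 <= eigen_min (gram X n),
           eigen_min (gram X n) <= eigen_max (gram X n) &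
           eigen_max (gram X n) <= M0]]) ->
  gram X n @[n --> \oo] --> Upsilon ->
  posdef Upsilon ->
  lam n @[n --> \oo] --> (0 : R) ->
  Num.sqrt n%:R * lam n @[n --> \oo] --> (0 : R) ->
  n%:R `^ ((gamma + 1) / 2) * lam n @[n --> \oo] --> +oo ->
  (forall n, random_vector (beta_tilde n)) ->
  (forall n, random_vector (beta_hat n)) ->
  (forall n w, is_expectile_estimate tau X (Y^~ w) n (beta_tilde n w)) ->
  (forall n w, is_lasso_estimate tau gamma (lam n) X (Y^~ w) n
     (beta_tilde n w) (beta_hat n w)) ->
  cvg_in_law_normal P
    (fun n w => Num.sqrt n%:R *: first_groups hp (beta_hat n w - beta0))
    0
    ((fine 'V_P[fun w => g_tau tau (eps 0%N w)]%E *
      fine 'E_P[fun w => h_tau tau (eps 0%N w)]%E ^- 2) *: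
     invmx (first_groups_mx hp Upsilon)).
Proof.
move=> _ hbeta0 YE tau01 gamma0 lam0 ind_eps id_eps eps_expectile [f [df _ _]] eps4.
move=> [C0 C0_gt0 XC0] _ gram_cvg Upd _ lam_sqrt lam_gamma _ mbh bt_est bh_est.
have eps_density i : exists f : R -> R, has_density (eps i) f by exists f.
have C0_ge0 := ltW C0_gt0.
rewrite variance_g_tau// expectation_h_tau// first_groups_mxE /=.
set s2 := error_variance eps tau; set mu := mean_h eps tau; set J := sel_mx hp d.
have mu0 : 0 < mu := mean_h_gt0 eps tau01.
have s20 : 0 <= s2 by apply: Rintegral_ge0 => w _; exact: sqr_ge0.
have [Lc LcE] := posdef_cholesky (posdef_invmx (posdef_sel hp Upd)).
(* A square root of the limiting covariance: [Lc] is a Cholesky factor of the inverse active block,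
   scaled by the deviation of the score over the mean curvature. *)
pose A := (Num.sqrt s2 / mu) *: Lc.
have AE : A *m A^T = (s2 * mu ^- 2) *: invmx (J^T *m Upsilon *m J).
  rewrite /A linearZ/= -scalemxAl -scalemxAr scalerA LcE; congr (_ *: _).
  by rewrite -expr2 expr_div_n sqr_sqrtr.
have [disp' [T' [P' [W hW]]]] := @normal_family_exists R (\sum_(j < p0) d (widen_ord hp j)).
exists disp', T', P', (fun w => 0 + A *m \col_j W j w); split.
  by exists _, A, W; split; [exact: hW.1|exact: hW.2|exact: AE|].
have mW : random_vector (fun w => \col_j W j w).
  by move=> j; apply: (eq_measurable_fun (W j)) => // w _; rewrite mxE.
have mZ n : random_vector (fun w => Num.sqrt n%:R *: first_groups hp (beta_hat n w - beta0)).
  have mb : random_vector (fun w => beta_hat n w - beta0).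
    move=> i; apply: (eq_measurable_fun (fun w => beta_hat n w i ord0 - beta0 i ord0)).
      by move=> w _; rewrite !mxE.
    by apply: measurable_funB => //; exact: mbh.
  have := random_vector_mulmx (Num.sqrt n%:R *: J^T) mb; congr random_vector.
  by apply/funext => w; rewrite first_groupsE scalemxAl.
apply: smooth_test_functions => //.
  have := random_vector_mulmx A mW; congr random_vector.
  by apply/funext => w; rewrite add0r.
move=> g sg.
pose V n w := leading_term hp X tau Upsilon mu (eps ^~ w) n.
have VE n w : V n w = \sum_(i < n) score_error eps tau i w *: leading_coef hp X Upsilon mu n i.
  exact: leading_termE.
have mV n : random_vector (V n).
  have := random_vector_sum (index_enum 'I_n) (X := fun i : 'I_n => score_error eps tau i)
    (fun i : 'I_n => leading_coef hp X Upsilon mu n i) 0 (fun i => measurable_funPT _).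
  by congr random_vector; apply/funext => w; rewrite add0r VE.
(* Order of the choices: [q] determines the bound [K] on the score, then [K] and [delta] determine
   [kap] and [eta], and only then is the rank of [n] fixed. *)
apply: (slutsky mZ mV sg) => [delta q delta0 q0|].
  have [K K0 hK] := asymptotic_event tau01 ind_eps id_eps eps_expectile eps_density eps4
    C0_ge0 XC0 q0.
  have [kap [eta [kap0 eta0 core]]] := lasso_expansion hp hbeta0 tau01 gamma0 lam0 C0_gt0 XC0
    gram_cvg Upd lam_sqrt lam_gamma mu0 K0 delta0.
  have ev := hK kap eta kap0 eta0.
  near=> n.
  have [B [mB PB hB]] : exists B : set T, [/\ measurable B, (P B <= q%:E)%E & forall w, ~ B w ->
      [/\ `|score tau X (eps ^~ w) n| <= K, small_error_freq kap (eps ^~ w) n <= eta &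
          `|hessian_dev tau X mu (eps ^~ w) n| <= eta]] by near: n.
  exists B; split=> // w /hB[h1 h2 h3]; rewrite first_groupsE.
  have yE : (fun i => dotv (X i) beta0 + eps i w) = Y ^~ w.
    by apply/funext => i; rewrite YE.
  have coren : forall (e : nat -> R) (bt bh : 'cV_(\sum_(j < p) d j)),
      is_expectile_estimate tau X (fun i : nat => dotv (X i) beta0 + e i) n bt ->
      is_lasso_estimate tau gamma (lam n) X (fun i : nat => dotv (X i) beta0 + e i) n bt bh ->
      `|score tau X e n| <= K -> small_error_freq kap e n <= eta ->
      `|hessian_dev tau X mu e n| <= eta ->
      `|Num.sqrt n%:R *: (J^T *m (bh - beta0)) - leading_term hp X tau Upsilon mu e n| <= delta.
    by near: n.
  by apply: (coren (eps ^~ w) (beta_tilde n w)) => //; rewrite yE.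
have -> : (fun n => \int[P]_w g (V n w)) = (fun n => \int[P]_w g
    (\sum_(i < n) score_error eps tau i w *: leading_coef hp X Upsilon mu n i)).
  by apply/funext => n; apply: eq_Rintegral => w _; rewrite VE.
have -> : \int[P']_w g (0 + A *m \col_j W j w) = \int[P']_w g (A *m \col_j W j w).
  by apply: eq_Rintegral => w _; rewrite add0r.
(* There remains the exact weighted sum [V n]: identical distribution makes the variance and the
   third absolute moment common to all summands. *)
apply: (central_limit (s2 := s2) (m3 := \int[P]_w (`|score_error eps tau 0%N w| ^+ 3))
   (b := leading_bound hp Upsilon mu C0)) => //.
- exact: independent_score_error.
- exact: score_error_integrable.
- exact: score_error_sqr_integrable.
- exact: score_error_cube_integrable.
- exact: score_error_mean.
- exact: score_error_variance.
- by move=> i; rewrite (score_error_cube tau01 id_eps eps4).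
- exact: leading_coef_le.
- exact: leading_bound_cvg.
- rewrite AE; exact: (@leading_cov_cvg _ _ _ hp _ _ _ _ mu0 gram_cvg Upd s2).
Unshelve. all: by end_near. Qed.
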